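(* There exists an absolute constant $c>0$ (independent of $p$ and $k$) such that for every odd $k\in\mathbb{N}$ and every $p\in(1,\infty)$, $$\|R^k\|_p\;\ge\; c\,k^{1-2/p^*}(p^*-1).$$
   Context: Identify $\mathbb{R}^2\equiv\mathbb{C}$. $R=R_2+iR_1$, where $R_1,R_2$ are the classical scalar Riesz transforms on $\mathbb{R}^2$. Equivalently, with $\hat f(\xi)=\int f(x)e^{-2\pi i x\cdot\xi}\,dx$, $R^k$ is the Fourier multiplier operator with symbol $(\bar\zeta/|\zeta|)^k$. It extends to a bounded operator on $L^p(\mathbb{C})$ (complex-valued functions) for all $1<p<\infty$; $\|R^k\|_p$ denotes its operator norm on $L^p(\mathbb{C})$. For $p\in(1,\infty)$, $q=p/(p-1)$ and $p^*=\max\{p,q\}$. *)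

(* Defs.v *)
From mathcomp Require Import all_boot all_order all_algebra.
From mathcomp Require Import all_classical all_reals all_analysis.
From mathcomp Require Import complex.

Set Implicit Arguments.
Unset Strict Implicit.
Unset Printing Implicit Defensive.
Import Order.TTheory GRing.Theory Num.Theory.
Import numFieldNormedType.Exports.

Local Open Scope classical_set_scope.
Local Open Scope ring_scope.
Local Open Scope complex_scope.

Section ComplexRiesz.
Context {R : realType}.

Local Notation plane := (measurableTypeR R * measurableTypeR R)%type.
Implicit Types (f g : plane -> R[i]) (x xi : plane) (p t : R) (k : nat).

Definition leb2 : {measure set plane -> \bar R} :=
  (@lebesgue_measure R \x @lebesgue_measure R)%E.

(* The identification of R^2 with C. *)
Definition toC (x : plane) : R[i] := x.1 +i* x.2.

Definition cmeasurable (f : plane -> R[i]) : Prop :=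
  measurable_fun setT (fun x => complex.Re (f x)) /\
  measurable_fun setT (fun x => complex.Im (f x)).

Definition cintegrable (f : plane -> R[i]) : Prop :=
  leb2.-integrable setT (fun x => (complex.Re (f x))%:E) /\
  leb2.-integrable setT (fun x => (complex.Im (f x))%:E).

Definition cintegral (f : plane -> R[i]) : R[i] :=
  Rintegral leb2 setT (fun x => complex.Re (f x)) +i*
  Rintegral leb2 setT (fun x => complex.Im (f x)).

Definition cLnorm (p : R) (f : plane -> R[i]) : \bar R :=
  Lnorm leb2 p%:E (fun x => (Normc.normc (f x))%:E).

Definition cLfun (p : R) (f : plane -> R[i]) : Prop :=
  cmeasurable f /\ (cLnorm p f < +oo)%E.

Definition cis (t : R) : R[i] := cos t +i* sin t.

Definition dot2 (x xi : plane) : R := x.1 * xi.1 + x.2 * xi.2.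

Definition fourier (f : plane -> R[i]) (xi : plane) : R[i] :=
  cintegral (fun x => f x * cis (- (2 * pi * dot2 x xi))).

Definition inv_fourier (g : plane -> R[i]) (x : plane) : R[i] :=
  cintegral (fun xi => g xi * cis (2 * pi * dot2 x xi)).

(* Functions with f and its Fourier transform both integrable. Fourier
   inversion holds for them, they lie in every L^p with 1 <= p <= oo (in
   particular in L^2), and they include the Schwartz functions, hence are
   dense in L^p for p < oo. A multiplier operator with bounded measurable
   symbol is given on them by an absolutely convergent integral. *)
Definition fourier_class (f : plane -> R[i]) : Prop :=
  cintegrable f /\ cintegrable (fourier f).

Definition fourier_multiplier (m : plane -> R[i]) (f : plane -> R[i]) :
    plane -> R[i] :=
  inv_fourier (fun xi => m xi * fourier f xi).

(* The graph of the continuous extension to L^p of the multiplier operator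
   with symbol m: an L^p function g is the image of f when f is an L^p-limit
   of functions f_ n of the class above whose images tend to g in L^p. When
   the multiplier operator is bounded on L^p, every f in L^p has an image,
   unique almost everywhere. *)
Definition Lp_multiplier (m : plane -> R[i]) (p : R)
    (f g : plane -> R[i]) : Prop :=
  [/\ cLfun p f, cLfun p g &
    exists f_ : nat -> plane -> R[i],
      [/\ forall n, fourier_class (f_ n),
          (fun n => cLnorm p (fun x => f_ n x - f x)) @ \oo --> 0%E &
          (fun n => cLnorm p (fun x => fourier_multiplier m (f_ n) x - g x))
            @ \oo --> 0%E]].

Definition Lp_opnorm (p : R)
    (T : (plane -> R[i]) -> (plane -> R[i]) -> Prop) : \bar R :=
  ereal_sup [set y | exists f g, [/\ T f g, (cLnorm p f <= 1)%E &
                                    y = cLnorm p g]].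

(* The symbol of the scalar Riesz transform R_j is -i xi_j / |xi|. *)
Definition riesz1_symbol (xi : plane) : R[i] :=
  - 'i * (xi.1)%:C / `|toC xi|.

Definition riesz2_symbol (xi : plane) : R[i] :=
  - 'i * (xi.2)%:C / `|toC xi|.

(* The symbol of R = R_2 + i R_1. *)
Definition criesz_symbol (xi : plane) : R[i] := (toC xi)^* / `|toC xi|.

Lemma criesz_symbolE (xi : plane) :
  criesz_symbol xi = riesz2_symbol xi + 'i * riesz1_symbol xi.
Proof.
rewrite /criesz_symbol /riesz1_symbol /riesz2_symbol !mulrA -mulrDl; congr (_ / _).
by case: xi => a b; rewrite /toC; simpc.
Qed.

(* The operator norm of R^k on L^p(C). *)
Definition criesz_pow_norm (k : nat) (p : R) : \bar R :=
  Lp_opnorm p (Lp_multiplier (fun xi => criesz_symbol xi ^+ k) p).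

Definition pstar (p : R) : R := Num.max p (p / (p - 1)).

End ComplexRiesz.

(* Main.v *)
(* Write m for the symbol of R^k, P for p^* and g for the Gaussian exp(-pi |z|^2).
   Up to a power of -i, the Fourier transform maps z^k exp(-pi a |z|^2) to
   z^k a^(-k-1) exp(-pi |z|^2 / a), hence z^k times a superposition of Gaussians
   to a function of the same kind. Take
     f = lam z^k \int_{w0}^{w1} s^(k-1) exp(-pi s^2 |z|^2) ds,
   with w1 = k^(-1/2) and w0 = exp(-P) w1. Since |z|^(-k) is proportional to the
   same integral taken over all s, f is bounded, and its L^P norm is controlled by
   its supremum and its L^1 norm.
   The pairing of R^k f with g is the integral of |z|^k times a positive mixture
   against g, and evaluates to lam * \int |z|^k g * \int_{w0}^{w1} ds / s up to a
   bounded factor; the last integral is P, the source of the factor p^* - 1.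
   For p > 2, R^k f is paired with g in L^q. For p <= 2, R^k g is computed from the
   mixture for |z|^(-k) and paired with f in L^q; both pairings are equal.
   The remaining power of k comes from comparing \int |z|^k g with the
   one-dimensional moment \int x^(k-1) exp(-pi x^2) dx. *)
Require Import Defs.
From HB Require Import structures.
From mathcomp Require Import all_boot all_order all_algebra.
From mathcomp Require Import all_classical all_reals all_analysis.
From mathcomp Require Import measurable_realfun complex ring lra.

Set Implicit Arguments.
Unset Strict Implicit.
Unset Printing Implicit Defensive.
Import Order.TTheory GRing.Theory Num.Theory.
Import numFieldNormedType.Exports.

Local Open Scope classical_set_scope.
Local Open Scope ring_scope.

(** * Gaussian integrals on the line *)

(** The operator norm is a supremum over a graph, so a lower bound at p needs a test function whose
    image is known to lie in L^p. This forces the split at p = 2. The image of f is controlled only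
    through a Lipschitz bound on its transform, which gives decay 1/|x|, enough in the plane for p >
    2 only. The image of g is explicit enough to decay like |z|^(-2N) for every N < 1, and N p > 1
    can be met for each p > 1. Oddness of k makes s^(k-1) nonnegative on the whole line, so |z|^(-k)
    is a positive mixture over all real s and neither polar coordinates nor the Gamma function
    enter. Truncating s to [w0, w1] keeps the widths of f and of its transform in a compact range.
    The phases of f and of the image of g are opposite up to a constant, so absolute values are
    paired without loss. The constant is exp(-6) / (4 pi): one exp(-3) normalises f in L^P, where it
    pays for exp(2P), coming from w0^(-2), and for P; the other bounds (1 + 1/k)^((k+2)/2); and 4 pi
    comes from the comparison of the two moments. *)

Section LebesgueAffine.
Context {R : realType}.
Local Notation mu := (@lebesgue_measure R).
Implicit Types (c d : R).

Let aff c d (x : measurableTypeR R) : measurableTypeR R := c * x + d.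

Let maff c d : measurable_fun setT (aff c d).
Proof. by apply: measurable_funD => //; apply: measurable_funM. Qed.

Let affM c d : {mfun (measurableTypeR R) >-> (measurableTypeR R)} :=
  HB.pack (aff c d) (isMeasurableFun.Build _ _ _ _ _ (maff c d)).

(** The push-forward of [mu] under the affine map, scaled by [c], gives half-open intervals their
    length; uniqueness of Lebesgue measure identifies it with [mu]. *)
Lemma ge0_integral_affine c d (F : measurableTypeR R -> \bar R) : 0 < c ->
  measurable_fun setT F -> (forall x, (0 <= F x)%E) ->
  (\int[mu]_x F x = c%:E * \int[mu]_x F (c * x + d)%R)%E.
Proof.
move=> c0 mF F0.
have -> : (\int[mu]_x F (c * x + d)%R = \int[pushforward mu (affM c d)]_x F x)%E.
  by rewrite ge0_integral_pushforward//; exact: maff.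
rewrite -[c%:E]/((NngNum (ltW c0))%:num%:E) -ge0_integral_mscale//.
apply: eq_measure_integral => //= A mA _; move: A mA.
apply: (lebesgue_measure_unique
  (mu := mscale (NngNum (ltW c0)) (pushforward mu (affM c d)))) => /= _ [[a b]] /= _ <-.
rewrite /mscale /pushforward /=.
rewrite [X in (_ * lebesgue_measure X)%E](_ : _ = `](a - d) / c, (b - d) / c]%classic); last first.
  apply/seteqP; split => x /=; rewrite /aff !in_itv/=.
    by rewrite ltr_pdivrMr// ler_pdivlMr// ltrBlDr lerBrDr (mulrC x).
  by rewrite ltr_pdivrMr// ler_pdivlMr// ltrBlDr lerBrDr (mulrC x).
rewrite !lebesgue_measure_itv/= !lte_fin ltr_pM2r ?invr_gt0// ltrD2r.
case: ifPn => _; last by rewrite mule0.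
by rewrite -EFinB -!EFinM; congr EFin; field; rewrite gt_eqF.
Qed.
End LebesgueAffine.

Section GaussianTools.
Context {R : realType}.
Local Notation mu := (@lebesgue_measure R).
Implicit Types (a b c C t : R) (n : nat).

Lemma measurable_inv : measurable_fun setT (fun x : R => x^-1).
Proof.
(* Inversion is not continuous at 0, but real powers are measurable, and both sides vanish at 0. *)
have -> : (fun x : R => x^-1) = (fun x => x * (x ^+ 2) `^ (-1)).
  apply/funext => x; rewrite powR_inv1 ?sqr_ge0//.
  have [->|x0] := eqVneq x 0; first by rewrite invr0 mul0r.
  by field.
apply: measurable_funM => //.
by apply: (measurableT_comp (@measurable_powR R (-1))); exact: exprn_measurable.
Qed.

Lemma measurable_sqrt : measurable_fun setT (@Num.sqrt R).
Proof. by apply: continuous_measurable_fun; exact: sqrt_continuous. Qed.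

Lemma measurable_cos : measurable_fun setT (@cos R).
Proof. by apply: continuous_measurable_fun; exact: continuous_cos. Qed.

Lemma measurable_sin : measurable_fun setT (@sin R).
Proof. by apply: continuous_measurable_fun; exact: continuous_sin. Qed.

Lemma exprn_le_expR n t : 0 <= t -> t ^+ n <= n`!%:R * expR t.
Proof.
case: n => [|n] t0; first by rewrite expr0 fact0 mul1r -expR0 ler_expR.
have := expR_ge1Dxn n t0; rewrite -ler_pdivrMl ?ltr0n ?fact_gt0// mulrC.
by apply: le_trans; rewrite lerDr.
Qed.

(** Half of the exponent absorbs the power, by [exprn_le_expR] at [a / 2 * t]; the other half is
    kept for integrability. *)
Lemma exprn_expRN_le n a t : 0 < a -> 0 <= t ->
  t ^+ n * expR (- (a * t)) <= n`!%:R * (2 / a) ^+ n * expR (- (a / 2 * t)).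
Proof.
move=> a0 t0.
have -> : - (a * t) = - (a / 2 * t) + - (a / 2 * t) by field.
rewrite expRD mulrA ler_wpM2r ?expR_ge0//.
rewrite expRN ler_pdivrMr ?expR_gt0//.
have /(exprn_le_expR n) : 0 <= a / 2 * t by rewrite mulr_ge0// divr_ge0// ltW.
have a20 : 0 < a / 2 by rewrite divr_gt0.
rewrite exprMn -ler_pdivlMl ?exprn_gt0// => /le_trans; apply.
by rewrite -exprVn invf_div mulrCA mulrA.
Qed.

Lemma integral_gauss_scale a : 0 < a ->
  (\int[mu]_x (expR (- (pi * a * x ^+ 2)))%:E = (Num.sqrt a)^-1%:E)%E.
Proof.
move=> a0; have c0 : 0 < Num.sqrt (pi * a) by rewrite sqrtr_gt0 mulr_gt0// pi_gt0.
have := @integralT_gauss R.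
rewrite (@ge0_integral_affine _ (Num.sqrt (pi * a)) 0)//; last 2 first.
- by apply/measurable_EFinP; exact: measurable_gauss_fun.
- by move=> x; rewrite lee_fin gauss_fun_ge0.
under eq_integral => x _.
  rewrite addr0 /gauss_fun exprMn sqr_sqrtr ?mulr_ge0 ?pi_ge0 ?ltW//.
  over.
set I := (\int[_]_x _)%E; rewrite sqrtrM ?pi_ge0//.
have sp : 0 < Num.sqrt pi :> R by rewrite sqrtr_gt0 pi_gt0.
have sa : 0 < Num.sqrt a by rewrite sqrtr_gt0.
move=> /(congr1 (fun z => (Num.sqrt pi * Num.sqrt a)^-1%:E * z)%E).
rewrite muleA -EFinM mulVf ?gt_eqF ?mulr_gt0// mul1e -EFinM => ->.
by congr EFin; field; rewrite !gt_eqF.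
Qed.

Lemma integrable_gauss a : 0 < a ->
  mu.-integrable setT (fun x => (expR (- (pi * a * x ^+ 2)))%:E).
Proof.
move=> a0; apply/integrableP; split.
  apply/measurable_EFinP; apply: (measurableT_comp (@measurable_expR R)).
  by apply: measurable_funN; apply: measurable_funM => //.
under eq_integral do rewrite gee0_abs ?lee_fin ?expR_ge0//.
by rewrite integral_gauss_scale// ltry.
Qed.

Lemma integrable_le_gauss (f : R -> R) C a : 0 < a ->
  measurable_fun setT f -> (forall x, `|f x| <= C * expR (- (pi * a * x ^+ 2))) ->
  mu.-integrable setT (EFin \o f).
Proof.
move=> a0 mf fle.
have ig : mu.-integrable setT (fun x => (C * expR (- (pi * a * x ^+ 2)))%:E).
  under eq_fun do rewrite EFinM.
  by apply: integrableZl => //; exact: integrable_gauss.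
apply: le_integrable ig => //; first exact/measurable_EFinP.
by move=> x _ /=; rewrite lee_fin (le_trans (fle x)) ?ler_norm.
Qed.

(* Boundary terms vanish because [F] is dominated by a Gaussian. *)
Lemma Rintegral_derive_gauss (F f : R -> R) C a : 0 < a ->
  (forall x : R, is_derive x (1 : R) F (f x)) -> continuous f ->
  (forall x, `|F x| <= C * expR (- (pi * a * x ^+ 2))) ->
  (forall x, `|f x| <= C * expR (- (pi * a * x ^+ 2))) ->
  \int[mu]_x f x = 0.
Proof.
move=> a0 dF cf Fle fle.
have mf : measurable_fun setT f by exact: continuous_measurable_fun.
have intf := integrable_le_gauss a0 mf fle.
have ig : mu.-integrable setT (fun x => (C * expR (- (pi * a * x ^+ 2)))%:E).
  under eq_fun do rewrite EFinM.
  by apply: integrableZl => //; exact: integrable_gauss.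
have derF x : derivable F x 1 by apply: ex_derive; exact: dF.
have cF : continuous F.
  by move=> x; exact/differentiable_continuous/derivable1_diffP/derF.
pose I n : set R := `[- n.+1%:R, n.+1%:R]%classic.
have FTC n : (\int[mu]_(x in I n) (f x)%:E = (F n.+1%:R - F (- n.+1%:R))%:E)%E.
  rewrite EFinB; apply: continuous_FTC2.
  - by rewrite gtrN // ltr0n.
  - exact: continuous_subspaceT.
  - split => [x _||]; first exact: derF.
      by apply: cvg_at_right_filter; exact: cF.
    by apply: cvg_at_left_filter; exact: cF.
  - by move=> x _; rewrite derive1E; exact: derive_val.
have pa0 : 0 < pi * a by rewrite mulr_gt0// pi_gt0.
have C0 : 0 <= C.
  by have := le_trans (normr_ge0 _) (Fle 0); rewrite pmulr_lge0 ?expR_gt0.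
(* The Gaussian is at most 1 / (pi a x^2), hence at most 1 / (pi a |x|) as |x| >= 1: a harmonic rate
   is enough for the boundary terms. *)
have Fn x n : `|x| = n.+1%:R -> `|F x| <= C / (pi * a) * n.+1%:R^-1.
  move=> xn; apply: (le_trans (Fle x)); rewrite -[leRHS]mulrA -invfM ler_wpM2l// expRN.
  rewrite lef_pV2 ?posrE ?expR_gt0 ?mulr_gt0 ?ltr0n ?pi_gt0//.
  rewrite -[x ^+ 2]ger0_norm ?sqr_ge0// normrX xn.
  apply: le_trans (expR_ge1Dx _); rewrite ler_wpDl// ler_wpM2l ?(ltW pa0)//.
  by rewrite expr2 ler_peMr ?ler0n// ler1n.
have cF0 : (F n.+1%:R - F (- n.+1%:R)) @[n --> \oo] --> (0 : R).
  apply: norm_cvg0; apply: (@squeeze_cvgr _ _ _ _ (cst 0) (fun n => 2 * (C / (pi * a)) * harmonic n)).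
  - near=> n; rewrite normr_ge0/= (le_trans (ler_normB _ _))//.
    rewrite -mulrA mulrDl mul1r lerD// Fn ?normrN ?ger0_norm ?ler0n//.
  - exact: cvg_cst.
  - by rewrite -[X in _ --> X](mulr0 (2 * (C / (pi * a)))); apply: cvgMl_tmp; exact: cvg_harmonic.
have [] // := @dominated_convergence _ _ _ mu setT measurableT
  (fun n => (EFin \o f) \_ (I n)) (EFin \o f) (fun x => (C * expR (- (pi * a * x ^+ 2)))%:E).
- move=> n; apply/(measurable_restrictT _ _).1; first exact: measurable_itv.
  by apply/measurable_EFinP; exact: measurable_funTS.
- exact/measurable_EFinP.
- apply/aeW => x _; apply: (@cvg_near_cst _ _ _ _ _ _); near=> n.
  rewrite patchE mem_set// /I/= in_itv/= -ler_norml.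
  near: n; exists (Num.truncn `|x|) => // n /= xn.
  by rewrite (le_trans (ltW (Num.Theory.truncnS_gt _)))// ler_nat ltnS.
- apply/aeW => x n _; rewrite patchE; case: ifPn => _ /=; rewrite ?normr0 lee_fin.
    exact: fle.
  by rewrite mulr_ge0// expR_ge0.
move=> _ _.
under eq_fun do rewrite -integral_mkcond FTC.
move=> H; rewrite /Rintegral.
have -> : (\int[mu]_x (f x)%:E = 0)%E.
  apply: (cvg_unique _ H) => //.
  by apply: cvg_EFin; [exact: nearW|].
by [].
Unshelve. all: by end_near. Qed.

End GaussianTools.

(** * Domination by a Gaussian *)

Section GaussianDomination.
Context {R : realType} {T : Type} (s : T -> R) (s_ge0 : forall x, 0 <= s x).
Implicit Types f g : T -> R.

(** [s] is the square on the line and [nsq] on the plane. Leaving [C] and [a] existential makes the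
    class stable under sums and under bounded or polynomial factors, so integrability and vanishing
    boundary terms follow from closure rules instead of explicit constants. *)
Definition gdom f := exists C a : R, [/\ 0 <= C, 0 < a &
  forall x, `|f x| <= C * expR (- (pi * a * s x))].

Lemma gdom_le f g : (forall x, `|f x| <= `|g x|) -> gdom g -> gdom f.
Proof.
move=> fg [C [a [C0 a0 gle]]]; exists C, a; split => // x.
exact: le_trans (fg x) (gle x).
Qed.

Lemma gdom_gauss a : 0 < a -> gdom (fun x => expR (- (pi * a * s x))).
Proof. by move=> a0; exists 1, a; split => // x; rewrite mul1r ger0_norm ?expR_ge0. Qed.

Lemma gdomD f g : gdom f -> gdom g -> gdom (fun x => f x + g x).
Proof.
move=> [C [a [C0 a0 fle]]] [D [b [D0 b0 gle]]].
exists (C + D), (Num.min a b); split; rewrite ?addr_ge0 ?lt_min ?a0// => x.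
rewrite (le_trans (ler_normD _ _))// mulrDl lerD//.
  apply: (le_trans (fle x)); rewrite ler_wpM2l// ler_expR lerN2 ler_wpM2r//.
  by rewrite ler_wpM2l ?pi_ge0// ge_min lexx.
apply: (le_trans (gle x)); rewrite ler_wpM2l// ler_expR lerN2 ler_wpM2r//.
by rewrite ler_wpM2l ?pi_ge0// ge_min lexx orbT.
Qed.

(** A factor of linear growth in [s] costs half of the Gaussian exponent, whence the width
    [a / 2]. *)
Lemma gdomM K f g : (forall x, `|g x| <= K * (1 + s x)) -> gdom f ->
  gdom (fun x => g x * f x).
Proof.
move=> gK [C [a [C0 a0 fle]]].
have pa0 : 0 < pi * a by rewrite mulr_gt0// pi_gt0.
have K0 (x : T) : 0 <= K.
  by have := le_trans (normr_ge0 _) (gK x); rewrite pmulr_lge0// ltr_wpDr.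
exists (`|K| * C * (1 + 2 / (pi * a))), (a / 2); split.
- by rewrite !mulr_ge0// addr_ge0// divr_ge0// ltW.
- by rewrite divr_gt0.
move=> x; rewrite normrM (ger0_norm (K0 x)).
apply: (le_trans (ler_pM _ _ (gK x) (fle x))) => //.
rewrite mulrACA -[leRHS]mulrA ler_wpM2l ?mulr_ge0 ?(K0 x)//.
have := @exprn_expRN_le R 1 _ _ pa0 (s_ge0 x).
rewrite !expr1 -[1`!]/1%N mul1r.
have : expR (- (pi * a * s x)) <= expR (- (pi * (a / 2) * s x)).
  by rewrite ler_expR lerN2 ler_wpM2r// ler_wpM2l ?pi_ge0// ler_pdivrMr// ler_peMr ?ltW// ltr1n.
rewrite [pi * (a / 2)]mulrA.
move: (expR (- (pi * a * s x))) (expR (- (pi * a / 2 * s x))) (2 / (pi * a)) => E1 E2 p h1 h2.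
by rewrite [leLHS]mulrDl [leRHS]mulrDl !mul1r lerD.
Qed.

Lemma gdomMl K f g : (forall x, `|g x| <= K) -> gdom f -> gdom (fun x => g x * f x).
Proof.
move=> gK; apply: (@gdomM `|K|) => x.
apply: (le_trans (gK x)); apply: (le_trans (ler_norm _)).
by rewrite ler_peMr// lerDl.
Qed.

Lemma gdomZ c f : gdom f -> gdom (fun x => c * f x).
Proof. exact: (@gdomMl `|c|). Qed.

Lemma gdomX n f g : (forall x, g x ^+ 2 <= s x) -> gdom f ->
  gdom (fun x => g x ^+ n * f x).
Proof.
move=> gs df; elim: n => [|n IH].
  by apply: gdom_le df => x; rewrite expr0 mul1r.
apply: (@gdom_le _ (fun x => g x * (g x ^+ n * f x))).
  by move=> x; rewrite exprS mulrA.
(* One factor [g] grows at most like 1 + s, since |g| <= 1 + g^2. *)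
apply: (@gdomM 1) IH => x; rewrite mul1r.
have := gs x; rewrite -real_normK ?num_real// => gsx.
have := sqr_ge0 (`|g x| - 1); rewrite sqrrB1 => h.
have := sqr_ge0 (`|g x|); lra.
Qed.
End GaussianDomination.

Lemma integrable_scale d (T : measurableType d) (R : realType)
    (m : {measure set T -> \bar R}) (D : set T) (c : R) (f : T -> R) : measurable D ->
  m.-integrable D (EFin \o f) -> m.-integrable D (EFin \o (fun x => c * f x)).
Proof. by move=> mD; exact: integrableZl. Qed.

(** * Integration by parts and cosine transforms of Gaussians *)

Section GaussianIntegrals.
Context {R : realType}.
Local Notation mu := (@lebesgue_measure R).
Implicit Types (a b c C t : R) (n : nat).
Local Notation sq := (fun x : R => x ^+ 2).

Lemma gdom_integrable (f : R -> R) : measurable_fun setT f -> gdom sq f ->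
  mu.-integrable setT (EFin \o f).
Proof. by move=> mf [C [a [C0 a0 fle]]]; exact: integrable_le_gauss a0 mf fle. Qed.

Lemma Rintegral_derive0 (F f : R -> R) :
  (forall x : R, is_derive x (1 : R) F (f x)) -> continuous f ->
  gdom sq F -> gdom sq f -> \int[mu]_x f x = 0.
Proof.
move=> dF cf [C [a [C0 a0 fle]]] [D [b [D0 b0 gle]]].
apply: (@Rintegral_derive_gauss _ F f (C + D) (Num.min a b)) => //.
- by rewrite lt_min a0.
- move=> x; apply: (le_trans (fle x)); apply: ler_pM => //.
    by rewrite lerDl.
  by rewrite ler_expR lerN2 ler_wpM2r ?sqr_ge0// ler_wpM2l ?pi_ge0// ge_min lexx.
- move=> x; apply: (le_trans (gle x)); apply: ler_pM => //.
    by rewrite lerDr.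
  by rewrite ler_expR lerN2 ler_wpM2r ?sqr_ge0// ler_wpM2l ?pi_ge0// ge_min lexx orbT.
Qed.

Lemma is_derive_continuous (f : R -> R) (df : R -> R) :
  (forall x : R, is_derive x (1 : R) f (df x)) -> continuous f.
Proof.
move=> dfP x; apply/differentiable_continuous/derivable1_diffP.
by apply: ex_derive; exact: dfP.
Qed.

Lemma is_derive_exprn (x : R) n :
  is_derive x (1 : R) (fun x : R => x ^+ n.+1) (n.+1%:R * x ^+ n).
Proof.
elim: n => [|n IH].
  have -> : (fun x : R => x ^+ 1) = id by [].
  by apply: is_derive_eq; rewrite expr0 mulr1.
have -> : (fun x : R => x ^+ n.+2) = (fun x => x * x ^+ n.+1) by apply/funext => t; rewrite exprS.
by apply: is_derive_eq; rewrite /GRing.scale /= -[n.+2]addn1 natrD exprS; ring.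
Qed.

Section cosine.
Variables (a : R) (a0 : 0 < a).
Let g x := expR (- (pi * a * x ^+ 2)).

Let dg (x : R) : is_derive x (1 : R) g (- (2 * pi * a * x) * g x).
Proof. by apply: is_derive_eq; rewrite /g /GRing.scale /=; ring. Qed.

Let gdom_g : gdom sq g. Proof. exact: gdom_gauss. Qed.

Let gdom_xg : gdom sq (fun x => x * g x).
Proof. by apply: (@gdomX _ _ _ _ 1 _ id) => // x; rewrite sqr_ge0. Qed.

Let mg : measurable_fun setT g.
Proof. by apply: continuous_measurable_fun; exact: is_derive_continuous dg. Qed.

Let mcos (b c : R) : measurable_fun setT (fun x : R => cos (2 * pi * x * b + c)).
Proof.
apply: (measurableT_comp (@measurable_cos R)); apply: measurable_funD => //.
by apply: measurable_funM => //; apply: measurable_funM.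
Qed.

Let msin (b c : R) : measurable_fun setT (fun x : R => sin (2 * pi * x * b + c)).
Proof.
apply: (measurableT_comp (@measurable_sin R)); apply: measurable_funD => //.
by apply: measurable_funM => //; apply: measurable_funM.
Qed.

Lemma integrable_gauss_cos (b c : R) :
  mu.-integrable setT (fun x => (g x * cos (2 * pi * x * b + c))%:E).
Proof.
apply: gdom_integrable; first exact: measurable_funM.
apply: (@gdom_le _ _ _ _ (fun x => cos (2 * pi * x * b + c) * g x)).
  by move=> x; rewrite mulrC.
by apply: (@gdomMl _ _ _ _ 1) => // x; rewrite ?sqr_ge0// ler_norml cos_geN1 cos_le1.
Qed.

Lemma integrable_xgauss_sin (b c : R) :
  mu.-integrable setT (fun x => (x * g x * sin (2 * pi * x * b + c))%:E).
Proof.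
apply: gdom_integrable; first by apply: measurable_funM => //; exact: measurable_funM.
apply: (@gdom_le _ _ _ _ (fun x => sin (2 * pi * x * b + c) * (x * g x))).
  by move=> x; rewrite mulrC.
by apply: (@gdomMl _ _ _ _ 1) => // x; rewrite ?sqr_ge0// ler_norml sin_geN1 sin_le1.
Qed.

(** The derivative of [g x * sin (2 * pi * x * b + c)] has integral 0, and its two terms are the two
    sides up to constants. *)
Let ibp (b c : R) : \int[mu]_x (x * g x * sin (2 * pi * x * b + c)) =
  b / a * \int[mu]_x (g x * cos (2 * pi * x * b + c)).
Proof.
have h (x : R) : is_derive x (1:R) (fun x => g x * sin (2 * pi * x * b + c))
   (- (2 * pi * a) * (x * g x * sin (2 * pi * x * b + c)) +
    2 * pi * b * (g x * cos (2 * pi * x * b + c))).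
  apply: is_derive_eq; rewrite /g /GRing.scale /=; ring.
have gc : gdom sq (fun x => g x * cos (2 * pi * x * b + c)).
  apply: (@gdom_le _ _ _ _ (fun x => cos (2 * pi * x * b + c) * g x)).
    by move=> x; rewrite mulrC.
  by apply: (@gdomMl _ _ _ _ 1) => // x; rewrite ?sqr_ge0// ler_norml cos_geN1 cos_le1.
have gs : gdom sq (fun x => g x * sin (2 * pi * x * b + c)).
  apply: (@gdom_le _ _ _ _ (fun x => sin (2 * pi * x * b + c) * g x)).
    by move=> x; rewrite mulrC.
  by apply: (@gdomMl _ _ _ _ 1) => // x; rewrite ?sqr_ge0// ler_norml sin_geN1 sin_le1.
have gxs : gdom sq (fun x => x * g x * sin (2 * pi * x * b + c)).
  apply: (@gdom_le _ _ _ _ (fun x => sin (2 * pi * x * b + c) * (x * g x))).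
    by move=> x; rewrite mulrC.
  by apply: (@gdomMl _ _ _ _ 1) => // x; rewrite ?sqr_ge0// ler_norml sin_geN1 sin_le1.
have := Rintegral_derive0 h.
rewrite RintegralD//; last 2 first.
- by apply: integrable_scale => //; exact: integrable_xgauss_sin.
- by apply: integrable_scale => //; exact: integrable_gauss_cos.
rewrite !RintegralZl//; do ?[exact: integrable_gauss_cos|exact: integrable_xgauss_sin].
have alg (p I J : R) : p != 0 -> - (2 * p * a) * I + 2 * p * b * J = 0 -> I = b / a * J.
  move=> p0 H; apply/eqP; rewrite -subr_eq0; apply/eqP.
  have pa0 : 2 * p * a != 0 by rewrite !mulf_neq0// gt_eqF.
  by apply: (mulfI pa0); rewrite mulr0 -[in RHS]oppr0 -{}H; field; rewrite gt_eqF.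
move=> H; apply: (alg pi); first by rewrite gt_eqF ?pi_gt0.
apply: H.
(* Continuity of the derivative is obtained by differentiating once more. *)
- apply: (@is_derive_continuous _ (fun x =>
     - (2 * pi * a) * (g x * sin (2 * pi * x * b + c) + x * (- (2 * pi * a * x) * g x) * sin (2 * pi * x * b + c) + 2 * pi * b * (x * g x * cos (2 * pi * x * b + c)))
     + 2 * pi * b * (- (2 * pi * a * x) * g x * cos (2 * pi * x * b + c) - 2 * pi * b * (g x * sin (2 * pi * x * b + c))))) => x.
  by apply: is_derive_eq; rewrite /g /GRing.scale /=; ring.
- exact: gs.
- by apply: gdomD => [x||]; [exact: sqr_ge0|apply: gdomZ => // x; exact: sqr_ge0|apply: gdomZ => // x; exact: sqr_ge0].
Qed.

Let y (c b : R) := \int[mu]_x (g x * cos (2 * pi * x * b + c)).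

(** Differentiation under the integral, with majorant 2 pi |x g(x)|, followed by [ibp]: a linear
    first-order equation in the frequency. *)
Let dy (c b : R) : is_derive b (1 : R) (y c) (- (2 * pi * b / a) * y c b).
Proof.
pose f (b x : R) := g x * cos (2 * pi * x * b + c).
have df x (t : R) : is_derive t (1:R) (f ^~ x) (- (2 * pi) * (x * g x * sin (2 * pi * x * t + c))).
  by apply: is_derive_eq; rewrite /GRing.scale /=; ring.
have d1f t x : partial1of2 f t x = - (2 * pi) * (x * g x * sin (2 * pi * x * t + c)).
  by rewrite partial1of2E; exact: derive_val.
have hI : (`]b - 1, b + 1[%classic : set R) b by rewrite /= in_itv/= ltrDl ltrBlDr ltrDl ltr01.
have hint t : (`]b - 1, b + 1[%classic : set R) t -> mu.-integrable setT (EFin \o f t).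
  by move=> _; exact: integrable_gauss_cos.
have hder t x : (`]b - 1, b + 1[%classic : set R) t -> [set: R] x -> derivable (f ^~ x) t 1.
  by move=> _ _; apply: ex_derive; exact: df.
have G0 x : 0 <= 2 * pi * `|x * g x| by rewrite !mulr_ge0 ?pi_ge0.
have Gint : mu.-integrable setT (EFin \o (fun x => 2 * pi * `|x * g x|)).
  apply: gdom_integrable; first by apply: measurable_funM => //; apply: measurableT_comp => //; exact: measurable_funM.
  by apply: gdomZ => [x|]; [exact: sqr_ge0|apply: gdom_le gdom_xg => x; rewrite normr_id].
have hub t x : (`]b - 1, b + 1[%classic : set R) t -> [set: R] x -> `|partial1of2 f t x| <= 2 * pi * `|x * g x|.
  move=> _ _; rewrite d1f normrM [X in X * _]normrN [X in X * _]ger0_norm ?mulr_ge0 ?pi_ge0// ler_wpM2l ?mulr_ge0 ?pi_ge0//.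
  by rewrite normrM ler_piMr// ler_norml sin_geN1 sin_le1.
have D := derivable_under_integral measurableT hI hint hder G0 Gint hub.
have E := differentiation_under_integral measurableT hI hint hder G0 Gint hub.
apply: DeriveDef; first exact: D.
rewrite -derive1E [LHS]E.
under eq_Rintegral do rewrite d1f.
rewrite RintegralZl//; last exact: integrable_xgauss_sin.
by rewrite ibp /y; field; rewrite gt_eqF.
Qed.

(** By [dy], [y c b * expR (pi / a * b ^+ 2)] is constant in [b], and at b = 0 it is a Gaussian
    integral. The free phase [c] covers sines and lets the formula be iterated in two variables. *)
Lemma Rintegral_gauss_cos (b c : R) :
  \int[mu]_x (g x * cos (2 * pi * x * b + c)) =
  cos c * (Num.sqrt a)^-1 * expR (- (pi / a * b ^+ 2)).
Proof.
have dz (t : R) : is_derive t (1 : R) (fun t => y c t * expR (pi / a * t ^+ 2)) 0.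
  have dyt := dy c t.
  by apply: is_derive_eq; rewrite /GRing.scale /=; field; rewrite gt_eqF.
have := is_derive_0_is_cst b 0 dz.
rewrite expr0n mulr0 expR0 mulr1 /y.
under [X in _ = X]eq_Rintegral do rewrite mulr0 add0r.
rewrite RintegralZr//; last exact: integrable_gauss.
rewrite {2}/Rintegral integral_gauss_scale//= => H.
apply: (mulIf (x := expR (pi / a * b ^+ 2))); first by rewrite gt_eqF ?expR_gt0.
by rewrite H expRN mulrC mulfVK// gt_eqF ?expR_gt0.
Qed.
End cosine.

(** Integration of the derivative of x^(n+1) exp(-pi x^2), whose boundary terms vanish. *)
Lemma moment_recur n : 2 * pi * \int[mu]_x (x ^+ n.+2 * expR (- (pi * x ^+ 2))) =
  n.+1%:R * \int[mu]_x (x ^+ n * expR (- (pi * x ^+ 2))).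
Proof.
have dX := is_derive_exprn.
pose g (x : R) := expR (- (pi * x ^+ 2)).
have gg : gdom sq g.
  by exists 1, 1; split => // x; rewrite /g mul1r mulr1 ger0_norm ?expR_ge0.
have gn m : gdom sq (fun x => x ^+ m * g x).
  by apply: (@gdomX _ _ _ _ m _ id) => // x; rewrite sqr_ge0.
have cn m : continuous (fun x : R => x ^+ m * g x).
  case: m => [|m].
    have -> : (fun x : R => x ^+ 0 * g x) = g by apply/funext => x; rewrite expr0 mul1r.
    apply: (@is_derive_continuous _ (fun x : R => - (2 * pi * x) * g x)) => x.
    by apply: is_derive_eq; rewrite /g /GRing.scale /=; ring.
  apply: (@is_derive_continuous _ (fun x : R => m.+1%:R * x ^+ m * g x - 2 * pi * x * x ^+ m.+1 * g x)) => x.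
  by apply: is_derive_eq; rewrite /g /GRing.scale /=; ring.
have intn m : mu.-integrable setT (EFin \o (fun x => x ^+ m * g x)).
  by apply: gdom_integrable => //; apply: continuous_measurable_fun.
have h (x : R) : is_derive x (1 : R) (fun x => x ^+ n.+1 * g x)
   (n.+1%:R * (x ^+ n * g x) - 2 * pi * (x ^+ n.+2 * g x)).
  by apply: is_derive_eq; rewrite /g /GRing.scale /= !exprS; ring.
have := Rintegral_derive0 h.
rewrite RintegralB//; last 2 first.
- by apply: integrable_scale => //; exact: intn.
- by apply: integrable_scale => //; exact: intn.
rewrite !RintegralZl//.
move=> H; apply/esym/eqP; rewrite -subr_eq0; apply/eqP/H.
- move=> x; apply: cvgB; apply: cvgMl_tmp; exact: cn.
- exact: gn.
- apply: gdomD => [x||]; [exact: sqr_ge0|by apply: gdomZ => // x; exact: sqr_ge0|].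
  by apply: (@gdom_le _ _ _ _ (fun x => 2 * pi * (x ^+ n.+2 * g x))) => [x|]; [by rewrite normrN|by apply: gdomZ => // t; exact: sqr_ge0].
Qed.

End GaussianIntegrals.

(** * Gaussians on the plane and their Fourier transforms *)

Section Plane.
Context {R : realType}.
Local Notation mu := (@lebesgue_measure R).
Local Notation nu := (@leb2 R).
Local Notation plane := (measurableTypeR R * measurableTypeR R)%type.
Implicit Types (a b c : R) (k n : nat) (z w : plane).

Definition nsq z : R := z.1 ^+ 2 + z.2 ^+ 2.

Lemma nsq_ge0 z : 0 <= nsq z.
Proof. by rewrite addr_ge0// sqr_ge0. Qed.

Lemma measurable_nsq : measurable_fun setT nsq.
Proof. by apply: measurable_funD; apply: measurable_funX. Qed.

Definition gauss2 a z : R := expR (- (pi * a * nsq z)).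

Lemma gauss2_ge0 a z : 0 <= gauss2 a z.
Proof. exact: expR_ge0. Qed.

Lemma gauss2E a z :
  gauss2 a z = expR (- (pi * a * z.1 ^+ 2)) * expR (- (pi * a * z.2 ^+ 2)).
Proof. by rewrite -expRD /gauss2 /nsq mulrDr opprD. Qed.

Lemma measurable_gauss2 a : measurable_fun setT (gauss2 a).
Proof.
apply: (measurableT_comp (@measurable_expR R)); apply: measurable_funN.
by apply: measurable_funM => //; exact: measurable_nsq.
Qed.

Lemma ge0_integral_leb2_12 (f : plane -> \bar R) : measurable_fun setT f ->
  (forall z, 0 <= f z)%E -> (\int[nu]_z f z = \int[mu]_x \int[mu]_y f (x, y))%E.
Proof. by move=> mf f0; rewrite /leb2 fubini_tonelli1. Qed.

Lemma ge0_integral_leb2_21 (f : plane -> \bar R) : measurable_fun setT f ->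
  (forall z, 0 <= f z)%E -> (\int[nu]_z f z = \int[mu]_y \int[mu]_x f (x, y))%E.
Proof. by move=> mf f0; rewrite /leb2 fubini_tonelli2. Qed.

Lemma integral_gauss2 a : 0 < a -> (\int[nu]_z (gauss2 a z)%:E = (a^-1)%:E)%E.
Proof.
move=> a0; rewrite ge0_integral_leb2_12; last 2 first.
- by apply/measurable_EFinP; exact: measurable_gauss2.
- by move=> z; rewrite lee_fin gauss2_ge0.
have inner x : (\int[mu]_y (gauss2 a (x, y))%:E =
    (Num.sqrt a)^-1%:E * (expR (- (pi * a * x ^+ 2)))%:E)%E.
  under eq_integral => y _ do rewrite gauss2E/= EFinM.
  rewrite ge0_integralZl_EFin ?expR_ge0//; last by have /integrableP[] := integrable_gauss a0.
  by rewrite integral_gauss_scale// muleC.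
under eq_integral do rewrite inner.
rewrite ge0_integralZl_EFin ?invr_ge0 ?sqrtr_ge0//; last first.
- by have /integrableP[] := integrable_gauss a0.
by rewrite integral_gauss_scale// -EFinM -invfM -expr2 sqr_sqrtr// ltW.
Qed.

Lemma integrable_gauss2 a : 0 < a -> nu.-integrable setT (EFin \o gauss2 a).
Proof.
move=> a0; apply/integrableP; split.
  by apply/measurable_EFinP; exact: measurable_gauss2.
under eq_integral do rewrite gee0_abs ?lee_fin ?gauss2_ge0//.
by rewrite integral_gauss2// ltry.
Qed.

Lemma gdom_integrable2 (f : plane -> R) : measurable_fun setT f -> gdom nsq f ->
  nu.-integrable setT (EFin \o f).
Proof.
move=> mf [C [a [C0 a0 fle]]].
have ig : nu.-integrable setT (EFin \o (fun z => C * gauss2 a z)).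
  by apply: integrable_scale => //; exact: integrable_gauss2.
apply: le_integrable ig => //; first exact/measurable_EFinP.
by move=> x _ /=; rewrite lee_fin (le_trans (fle x)) ?ler_norm.
Qed.

Lemma gdom_slice1 (f : plane -> R) (y : R) : gdom nsq f ->
  gdom (fun x : R => x ^+ 2) (fun x => f (x, y)).
Proof.
move=> [C [a [C0 a0 fle]]]; exists C, a; split => // x.
apply: (le_trans (fle _)); rewrite ler_wpM2l// ler_expR lerN2 ler_wpM2l//.
  by rewrite mulr_ge0 ?pi_ge0 ?ltW.
by rewrite lerDl sqr_ge0.
Qed.

Lemma gdom_slice2 (f : plane -> R) (x : R) : gdom nsq f ->
  gdom (fun y : R => y ^+ 2) (fun y => f (x, y)).
Proof.
move=> [C [a [C0 a0 fle]]]; exists C, a; split => // y.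
apply: (le_trans (fle _)); rewrite ler_wpM2l// ler_expR lerN2 ler_wpM2l//.
  by rewrite mulr_ge0 ?pi_ge0 ?ltW.
by rewrite lerDr sqr_ge0.
Qed.

Lemma Rintegral_leb2_12 (f : plane -> R) : measurable_fun setT f -> gdom nsq f ->
  \int[nu]_z f z = \int[mu]_x \int[mu]_y f (x, y).
Proof.
move=> mf gf; have intf := gdom_integrable2 mf gf.
rewrite /Rintegral -(integral12_prod_meas1 intf); congr fine.
apply: eq_integral => x _; rewrite /fubini_F/= fineK//.
apply: integrable_fin_num => //; apply: gdom_integrable; last exact: gdom_slice2.
by apply: measurableT_comp.
Qed.

Lemma Rintegral_leb2_21 (f : plane -> R) : measurable_fun setT f -> gdom nsq f ->
  \int[nu]_z f z = \int[mu]_y \int[mu]_x f (x, y).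
Proof.
move=> mf gf; have intf := gdom_integrable2 mf gf.
rewrite /Rintegral -(integral21_prod_meas1 intf); congr fine.
apply: eq_integral => y _; rewrite /fubini_G/= fineK//.
apply: integrable_fin_num => //; apply: gdom_integrable; last exact: gdom_slice1.
by apply: measurableT_comp.
Qed.

Lemma Rintegral_leb2_derive1 (F f : plane -> R) :
  (forall x y : R, is_derive x (1 : R) (fun x => F (x, y)) (f (x, y))) ->
  (forall y : R, continuous (fun x : R => f (x, y))) ->
  measurable_fun setT f -> gdom nsq F -> gdom nsq f -> \int[nu]_z f z = 0.
Proof.
move=> dF cf mf gF gf; rewrite Rintegral_leb2_21//.
rewrite /Rintegral integral0_eq// => y _.
apply: (congr1 EFin); apply: (Rintegral_derive0 (fun x => dF x y)) => //; exact: gdom_slice1.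
Qed.

Lemma Rintegral_leb2_derive2 (F f : plane -> R) :
  (forall x y : R, is_derive y (1 : R) (fun y => F (x, y)) (f (x, y))) ->
  (forall x : R, continuous (fun y : R => f (x, y))) ->
  measurable_fun setT f -> gdom nsq F -> gdom nsq f -> \int[nu]_z f z = 0.
Proof.
move=> dF cf mf gF gf; rewrite Rintegral_leb2_12//.
rewrite /Rintegral integral0_eq// => x _.
apply: (congr1 EFin); apply: (Rintegral_derive0 (fun y => dF x y)) => //; exact: gdom_slice2.
Qed.

Lemma measurable_dot2 w : measurable_fun setT (fun z => dot2 z w).
Proof. by apply: measurable_funD; apply: measurable_funM. Qed.

Lemma measurable_cos2 w c : measurable_fun setT (fun z => cos (2 * pi * dot2 z w + c)).
Proof.
apply: (measurableT_comp (@measurable_cos R)); apply: measurable_funD => //.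
by apply: measurable_funM => //; exact: measurable_dot2.
Qed.

(** The inner integral takes [2 * pi * x * w.1 + c] as its phase and returns the cosine of that
    phase, to which the one-variable formula applies again. *)
Lemma Rintegral_gauss2_cos a w c : 0 < a ->
  \int[nu]_z (gauss2 a z * cos (2 * pi * dot2 z w + c)) =
  cos c / a * gauss2 a^-1 w.
Proof.
move=> a0.
have gg : gdom nsq (fun z => gauss2 a z * cos (2 * pi * dot2 z w + c)).
  apply: (@gdom_le _ _ _ _ (fun z => cos (2 * pi * dot2 z w + c) * gauss2 a z)).
    by move=> z; rewrite mulrC.
  apply: (@gdomMl _ _ _ nsq_ge0 1); last exact: gdom_gauss.
  by move=> z; rewrite ler_norml cos_geN1 cos_le1.
have mg : measurable_fun setT (fun z => gauss2 a z * cos (2 * pi * dot2 z w + c)).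
  by apply: measurable_funM; [exact: measurable_gauss2|exact: measurable_cos2].
rewrite Rintegral_leb2_12//.
transitivity (\int[mu]_x (expR (- (pi / a * w.2 ^+ 2)) / Num.sqrt a *
   (expR (- (pi * a * x ^+ 2)) * cos (2 * pi * x * w.1 + c)))).
  apply: eq_Rintegral => x _.
  transitivity (\int[mu]_y (expR (- (pi * a * x ^+ 2)) * (expR (- (pi * a * y ^+ 2)) *
      cos (2 * pi * y * w.2 + (2 * pi * x * w.1 + c))))).
    apply: eq_Rintegral => y _; rewrite gauss2E /dot2 /= -mulrA.
    by congr (_ * (_ * cos _)); ring.
  rewrite RintegralZl//; last exact: integrable_gauss_cos.
  rewrite Rintegral_gauss_cos//; ring.
rewrite RintegralZl//; last exact: integrable_gauss_cos.
rewrite Rintegral_gauss_cos// gauss2E.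
have -> : cos c / a = (Num.sqrt a)^-1 * cos c * (Num.sqrt a)^-1.
  by rewrite mulrAC -mulrA mulrA -expr2 exprVn sqr_sqrtr ?ltW// mulrC.
ring.
Qed.

End Plane.

(** * Affine changes of variables on the plane *)

Section PlaneAffine.
Context {R : realType}.
Local Notation mu := (@lebesgue_measure R).
Local Notation nu := (@leb2 R).
Local Notation plane := (measurableTypeR R * measurableTypeR R)%type.

Lemma ge0_integral_leb2_affine (c d e : R) (f : plane -> \bar R) : 0 < c ->
  measurable_fun setT f -> (forall z, 0 <= f z)%E ->
  (\int[nu]_z f z = (c ^+ 2)%:E * \int[nu]_z f (c * z.1 + d, c * z.2 + e)%R)%E.
Proof.
move=> c0 mf f0.
have mT : measurable_fun setT (fun z : plane => (c * z.1 + d, c * z.2 + e) : plane).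
  by apply/measurable_fun_pairP; split; apply: measurable_funD => //; apply: measurable_funM.
rewrite ge0_integral_leb2_12// [in RHS]ge0_integral_leb2_12//; last exact: measurableT_comp.
rewrite (@ge0_integral_affine _ c d)//; last 2 first.
- exact: measurable_fun_fubini_tonelli_F.
- by move=> x; apply: integral_ge0.
transitivity (c%:E * \int[mu]_x (c%:E * \int[mu]_y f (c * x + d, c * y + e)%R))%E.
  congr (_ * _)%E; apply: eq_integral => x _.
  rewrite (@ge0_integral_affine _ c e)//.
  by apply: measurableT_comp.
rewrite ge0_integralZl_EFin ?ltW//; last 2 first.
- by move=> x _; apply: integral_ge0.
- have m3 : measurable_fun setT (fun z : plane => f (c * z.1 + d, c * z.2 + e)).
    exact: measurableT_comp.
  exact: (measurable_fun_fubini_tonelli_F _ m3 (fun _ => f0 _)).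
by rewrite muleA -EFinM -expr2.
Qed.

Lemma Rintegral_leb2_shift (d e : R) (f : plane -> R) : measurable_fun setT f ->
  \int[nu]_z f (z.1 + d, z.2 + e) = \int[nu]_z f z.
Proof.
move=> mf; rewrite /Rintegral; congr fine.
have H (h : plane -> \bar R) : measurable_fun setT h -> (forall z, 0 <= h z)%E ->
    (\int[nu]_z h (z.1 + d, z.2 + e)%R = \int[nu]_z h z)%E.
  move=> mh h0; rewrite [RHS](@ge0_integral_leb2_affine 1 d e)//.
  by rewrite expr1n mul1e; apply: eq_integral => z _; rewrite !mul1r.
have mf' : measurable_fun setT (EFin \o f) by exact/measurable_EFinP.
rewrite [LHS]integralE [RHS]integralE; congr (_ - _)%E.
  rewrite -[RHS](H _ (measurable_funepos mf') (funepos_ge0 _)).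
  by apply: eq_integral => z _; rewrite !funeposE.
rewrite -[RHS](H _ (measurable_funeneg mf') (funeneg_ge0 _)).
by apply: eq_integral => z _; rewrite !funenegE.
Qed.
End PlaneAffine.

(** * Powers of z times Gaussians *)

Section PlaneHarmonics.
Context {R : realType}.
Local Notation mu := (@lebesgue_measure R).
Local Notation nu := (@leb2 R).
Local Notation plane := (measurableTypeR R * measurableTypeR R)%type.
Implicit Types (a b c u v : R) (k n : nat) (z w : plane).

Definition zre k z : R := complex.Re (toC z ^+ k).
Definition zim k z : R := complex.Im (toC z ^+ k).

Lemma zreS k z : zre k.+1 z = z.1 * zre k z - z.2 * zim k z.
Proof. by rewrite /zre /zim exprS; case: (toC z ^+ k) => p q; rewrite /toC; simpc. Qed.

Lemma zimS k z : zim k.+1 z = z.1 * zim k z + z.2 * zre k z.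
Proof. by rewrite /zre /zim exprS; case: (toC z ^+ k) => p q; rewrite /toC; simpc. Qed.

Lemma zre0 z : zre 0 z = 1. Proof. by []. Qed.
Lemma zim0 z : zim 0 z = 0. Proof. by []. Qed.

Lemma measurable_zre_zim k : measurable_fun setT (zre k) /\ measurable_fun setT (zim k).
Proof.
elim: k => [|k [IH1 IH2]].
  by split; [rewrite (_ : zre 0 = cst 1)|rewrite (_ : zim 0 = cst 0)] => //; apply/funext.
split.
  rewrite (_ : zre k.+1 = (fun z => z.1 * zre k z) \- (fun z => z.2 * zim k z)).
    by apply: measurable_funB; apply: measurable_funM.
  by apply/funext => z; rewrite zreS.
rewrite (_ : zim k.+1 = (fun z => z.1 * zim k z) \+ (fun z => z.2 * zre k z)).
  by apply: measurable_funD; apply: measurable_funM.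
by apply/funext => z; rewrite zimS.
Qed.

(** Both parts of d/dx z^k = k z^(k-1); for k = 0 the truncated predecessor is multiplied by 0. *)
Lemma is_derive1_zre_zim k (x y : R) :
  is_derive x (1 : R) (fun x => zre k (x, y)) (k%:R * zre k.-1 (x, y)) /\
  is_derive x (1 : R) (fun x => zim k (x, y)) (k%:R * zim k.-1 (x, y)).
Proof.
elim: k => [|k [IH1 IH2]].
  have e1 : (fun x : R => zre 0 (x, y)) = cst 1 by apply/funext.
  have e0 : (fun x : R => zim 0 (x, y)) = cst 0 by apply/funext.
  split; apply: (@is_derive_eq _ _ _ _ _ _ _ 0); rewrite ?mul0r ?e1 ?e0//;
  exact: is_derive_cst.
split.
  rewrite (_ : (fun x => zre k.+1 (x, y)) = (fun x => x * zre k (x, y) - y * zim k (x, y))).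
    apply: is_derive_eq; rewrite /GRing.scale /=.
    case: k {IH1 IH2} => [|k] /=; first by rewrite zre0 zim0; ring.
    by rewrite (zreS k)/= -[k.+2]addn1 natrD; ring.
  by apply/funext => t; rewrite zreS.
rewrite (_ : (fun x => zim k.+1 (x, y)) = (fun x => x * zim k (x, y) + y * zre k (x, y))).
  apply: is_derive_eq; rewrite /GRing.scale /=.
  case: k {IH1 IH2} => [|k] /=; first by rewrite zre0 zim0; ring.
  by rewrite (zimS k)/= -[k.+2]addn1 natrD; ring.
by apply/funext => t; rewrite zimS.
Qed.

(** Both parts of d/dy z^k = i k z^(k-1). With the x-derivative, this is the Cauchy-Riemann equation
    exploited in [zkerE]. *)
Lemma is_derive2_zre_zim k (x y : R) :
  is_derive y (1 : R) (fun y => zre k (x, y)) (- (k%:R * zim k.-1 (x, y))) /\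
  is_derive y (1 : R) (fun y => zim k (x, y)) (k%:R * zre k.-1 (x, y)).
Proof.
elim: k => [|k [IH1 IH2]].
  have e1 : (fun y : R => zre 0 (x, y)) = cst 1 by apply/funext.
  have e0 : (fun y : R => zim 0 (x, y)) = cst 0 by apply/funext.
  split; apply: (@is_derive_eq _ _ _ _ _ _ _ 0); rewrite ?mul0r ?oppr0 ?e1 ?e0//;
  exact: is_derive_cst.
split.
  rewrite (_ : (fun y => zre k.+1 (x, y)) = (fun y => x * zre k (x, y) - y * zim k (x, y))).
    apply: is_derive_eq; rewrite /GRing.scale /=.
    case: k {IH1 IH2} => [|k] /=; first by rewrite zre0 zim0; ring.
    by rewrite (zimS k)/= -[k.+2]addn1 natrD; ring.
  by apply/funext => t; rewrite zreS.
rewrite (_ : (fun y => zim k.+1 (x, y)) = (fun y => x * zim k (x, y) + y * zre k (x, y))).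
  apply: is_derive_eq; rewrite /GRing.scale /=.
  case: k {IH1 IH2} => [|k] /=; first by rewrite zre0 zim0; ring.
  by rewrite (zreS k)/= -[k.+2]addn1 natrD; ring.
by apply/funext => t; rewrite zimS.
Qed.

Lemma coord_nsq1 z : z.1 ^+ 2 <= nsq z.
Proof. by rewrite lerDl sqr_ge0. Qed.

Lemma coord_nsq2 z : z.2 ^+ 2 <= nsq z.
Proof. by rewrite lerDr sqr_ge0. Qed.

Lemma gdom_coord1 (f : plane -> R) : gdom nsq f -> gdom nsq (fun z => z.1 * f z).
Proof. by apply: (@gdomX _ _ _ nsq_ge0 1); exact: coord_nsq1. Qed.

Lemma gdom_coord2 (f : plane -> R) : gdom nsq f -> gdom nsq (fun z => z.2 * f z).
Proof. by apply: (@gdomX _ _ _ nsq_ge0 1); exact: coord_nsq2. Qed.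

Lemma gdom2Z c (f : plane -> R) : gdom nsq f -> gdom nsq (fun z => c * f z).
Proof. by apply: gdomZ; exact: nsq_ge0. Qed.

Lemma gdom2D (f g : plane -> R) : gdom nsq f -> gdom nsq g -> gdom nsq (fun z => f z + g z).
Proof. by apply: gdomD; exact: nsq_ge0. Qed.

Lemma gdom2_cos (t : plane -> R) (f : plane -> R) : gdom nsq f ->
  gdom nsq (fun z => cos (t z) * f z).
Proof.
by apply: (@gdomMl _ _ _ nsq_ge0 1) => z; rewrite ler_norml cos_geN1 cos_le1.
Qed.

Lemma gdom2_sin (t : plane -> R) (f : plane -> R) : gdom nsq f ->
  gdom nsq (fun z => sin (t z) * f z).
Proof.
by apply: (@gdomMl _ _ _ nsq_ge0 1) => z; rewrite ler_norml sin_geN1 sin_le1.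
Qed.

Lemma gdom_zre_zim k (f : plane -> R) : gdom nsq f ->
  gdom nsq (fun z => zre k z * f z) /\ gdom nsq (fun z => zim k z * f z).
Proof.
move=> gf; elim: k => [|k [IH1 IH2]].
  split; first by apply: gdom_le gf => z; rewrite zre0 mul1r.
  by apply: gdom_le gf => z; rewrite zim0 mul0r normr0.
split.
  apply: (@gdom_le _ _ _ _ (fun z => z.1 * (zre k z * f z) + (-1) * (z.2 * (zim k z * f z)))).
    by move=> z; rewrite zreS le_eqVlt; apply/orP; left; apply/eqP; congr `|_|; ring.
  by apply: gdom2D; [exact: gdom_coord1|apply: gdom2Z; exact: gdom_coord2].
apply: (@gdom_le _ _ _ _ (fun z => z.1 * (zim k z * f z) + z.2 * (zre k z * f z))).
  by move=> z; rewrite zimS le_eqVlt; apply/orP; left; apply/eqP; congr `|_|; ring.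
by apply: gdom2D; [exact: gdom_coord1|exact: gdom_coord2].
Qed.

(* The real part of [(u + i v) z^k exp (- 2 i pi z.w)]. *)
Definition zker k u v w z : R :=
  cos (2 * pi * dot2 z w) * (u * zre k z - v * zim k z) +
  sin (2 * pi * dot2 z w) * (u * zim k z + v * zre k z).

(** Integration by parts with d/dx + i d/dy, which annihilates z^k. On z^k exp(-2 i pi z.w) times
    the Gaussian it produces - 2 pi a z^(k+1) from the Gaussian and - 2 i pi w z^k from the
    exponential, so one power of z is traded for the factor - i w / a. *)
Lemma zkerE a k u v w : 0 < a ->
  \int[nu]_z (zker k.+1 u v w z * gauss2 a z) =
  \int[nu]_z (zker k ((u * w.2 + v * w.1) / a) ((v * w.2 - u * w.1) / a) w z * gauss2 a z).
Proof.
move=> a0.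
pose th z := 2 * pi * dot2 z w.
pose g := gauss2 a.
have gg : gdom nsq g by apply: gdom_gauss.
have [gA gB] := (fun n => (gdom_zre_zim n gg).1, fun n => (gdom_zre_zim n gg).2).
have gL n (p q : R) : gdom nsq (fun z => (p * zre n z + q * zim n z) * g z).
  apply: (@gdom_le _ _ _ _ (fun z => p * (zre n z * g z) + q * (zim n z * g z))).
    by move=> z; rewrite mulrDl !mulrA.
  by apply: gdom2D; exact: gdom2Z.
pose K n (p q r t : R) z := cos (th z) * (p * zre n z + q * zim n z) +
  sin (th z) * (r * zim n z + t * zre n z).
have gK n (p q r t : R) : gdom nsq (fun z => K n p q r t z * g z).
  apply: (@gdom_le _ _ _ _ (fun z => cos (th z) * ((p * zre n z + q * zim n z) * g z) +
     sin (th z) * ((t * zre n z + r * zim n z) * g z))).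
    by move=> z; rewrite /K mulrDl !mulrA (addrC (r * _)).
  by apply: gdom2D; [apply: gdom2_cos|apply: gdom2_sin]; exact: gL.
have mth : measurable_fun setT th.
  by apply: measurable_funM => //; exact: measurable_dot2.
have mA n := (measurable_zre_zim n).1.
have mB n := (measurable_zre_zim n).2.
have mg : measurable_fun setT g by exact: measurable_gauss2.
have mcth : measurable_fun setT (cos \o th) by apply: measurableT_comp => //; exact: measurable_cos.
have msth : measurable_fun setT (sin \o th) by apply: measurableT_comp => //; exact: measurable_sin.
have mK n (p q r t : R) : measurable_fun setT (K n p q r t).
  apply: measurable_funD; apply: measurable_funM => //; apply: measurable_funD;
  exact: measurable_funM.
have zK n p q z : zker n p q w z = K n p (- q) p q z by rewrite /zker /K mulNr.
(* [d1 p q] and [d2 p q] are the x- and y-derivatives of the real part of (p + i q) z^k exp(-2 i pi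
   z.w) times [g]. *)
pose d1 p q z := K k.-1 (p * k%:R) (- (q * k%:R)) (p * k%:R) (q * k%:R) z * g z +
  (2 * pi * w.1 * (K k q p q (- p) z * g z) +
  - (2 * pi * a) * (z.1 * (K k p (- q) p q z * g z))).
pose d2 p q z := K k.-1 (- (q * k%:R)) (- (p * k%:R)) (- (q * k%:R)) (p * k%:R) z * g z +
  (2 * pi * w.2 * (K k q p q (- p) z * g z) +
  - (2 * pi * a) * (z.2 * (K k p (- q) p q z * g z))).
have gd1 p q : gdom nsq (d1 p q).
  apply: gdom2D; first exact: gK.
  by apply: gdom2D; apply: gdom2Z; [exact: gK|apply: gdom_coord1; exact: gK].
have gd2 p q : gdom nsq (d2 p q).
  apply: gdom2D; first exact: gK.
  by apply: gdom2D; apply: gdom2Z; [exact: gK|apply: gdom_coord2; exact: gK].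
have mKg n (p q r t : R) : measurable_fun setT (fun z => K n p q r t z * g z).
  exact: measurable_funM.
have md1 p q : measurable_fun setT (d1 p q).
  apply: measurable_funD => //; apply: measurable_funD; first exact: measurable_funM.
  by apply: measurable_funM => //; apply: measurable_funM.
have md2 p q : measurable_fun setT (d2 p q).
  apply: measurable_funD => //; apply: measurable_funD; first exact: measurable_funM.
  by apply: measurable_funM => //; apply: measurable_funM.
have i1 p q : \int[nu]_z d1 p q z = 0.
  have dA n x y := (is_derive1_zre_zim n x y).1.
  have dB n x y := (is_derive1_zre_zim n x y).2.
  apply: (@Rintegral_leb2_derive1 _ (fun z => K k p (- q) p q z * g z)) => //.
  - move=> x y; rewrite /d1 /K /th /dot2 /g /gauss2 /nsq /=.
    by apply: is_derive_eq; rewrite /GRing.scale /=; ring.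
  - move=> y x; rewrite /d1 /K /th /dot2 /g /gauss2 /nsq /=.
    apply/differentiable_continuous/derivable1_diffP.
    by apply: ex_derive.
have i2 p q : \int[nu]_z d2 p q z = 0.
  have dA n x y := (is_derive2_zre_zim n x y).1.
  have dB n x y := (is_derive2_zre_zim n x y).2.
  apply: (@Rintegral_leb2_derive2 _ (fun z => K k p (- q) p q z * g z)) => //.
  - move=> x y; rewrite /d2 /K /th /dot2 /g /gauss2 /nsq /=.
    by apply: is_derive_eq; rewrite /GRing.scale /=; ring.
  - move=> y x; rewrite /d2 /K /th /dot2 /g /gauss2 /nsq /=.
    apply/differentiable_continuous/derivable1_diffP.
    by apply: ex_derive.
have id1 p q : nu.-integrable setT (EFin \o d1 p q) by exact: gdom_integrable2.
have id2 p q : nu.-integrable setT (EFin \o d2 p q) by exact: gdom_integrable2.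
have iK n (p q r t : R) : nu.-integrable setT (EFin \o (fun z => K n p q r t z * g z)).
  exact: gdom_integrable2.
have izK n p q : nu.-integrable setT (EFin \o (fun z => zker n p q w z * g z)).
  by under eq_fun do rewrite zK; exact: iK.
(* As - v + i u = i (u + i v), the sum is the real part of d/dx + i d/dy applied to the complex
   integrand; the terms in z^(k-1) cancel. *)
have : \int[nu]_z (d1 u v z + d2 (- v) u z) = 0.
  by rewrite RintegralD// i1 i2 addr0.
have -> : (fun z => d1 u v z + d2 (- v) u z) = (fun z => - (2 * pi * a) *
   (zker k.+1 u v w z * g z - zker k ((u * w.2 + v * w.1) / a) ((v * w.2 - u * w.1) / a) w z * g z)).
  apply/funext => z; rewrite !zK /d1 /d2 /K zreS zimS.
  move: (cos (th z)) (sin (th z)) (g z) => c s G.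
  by field; rewrite gt_eqF.
rewrite RintegralZl//; last first.
  rewrite (_ : _ \o _ = (fun z => (zker k.+1 u v w z * g z)%:E) \-
      (fun z => (zker k ((u * w.2 + v * w.1) / a) ((v * w.2 - u * w.1) / a) w z * g z)%:E))%E.
    by apply: integrableB => //; exact: izK.
  by apply/funext => z /=; rewrite EFinB.
rewrite RintegralB//.
move/eqP; rewrite mulf_eq0 oppr_eq0 !mulf_eq0 (gt_eqF a0) (gt_eqF (pi_gt0 R)) (pnatr_eq0 R 2)/=.
by rewrite subr_eq0 => /eqP.
Qed.

(* The real part of [(u + i v)] times the identity
   [fourier (z^k gauss2 a) w = (- i w / a)^k / a * gauss2 a^-1 w]. *)
Lemma Rintegral_zker a k u v w : 0 < a ->
  \int[nu]_z (zker k u v w z * gauss2 a z) =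
  complex.Re ((u +i* v)%C * ((w.2 / a) +i* (- w.1 / a))%C ^+ k) / a * gauss2 a^-1 w.
Proof.
move=> a0; elim: k u v => [|k IH] u v; last first.
  rewrite zkerE// IH exprS mulrA; congr (complex.Re (_ * _) / _ * _).
  by simpc; congr (_ +i* _)%C; field; rewrite gt_eqF.
rewrite expr0 mulr1/=.
have gg : gdom nsq (gauss2 a) by apply: gdom_gauss.
have mg : measurable_fun setT (gauss2 a) by exact: measurable_gauss2.
have ic c : nu.-integrable setT (EFin \o (fun z => gauss2 a z * cos (2 * pi * dot2 z w + c))).
  apply: gdom_integrable2.
    by apply: measurable_funM => //; exact: measurable_cos2.
  apply: (@gdom_le _ _ _ _ (fun z => cos (2 * pi * dot2 z w + c) * gauss2 a z)).
    by move=> z; rewrite mulrC.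
  exact: gdom2_cos.
(* The sine is minus a cosine with phase pi / 2, for which the cosine formula returns 0. *)
transitivity (\int[nu]_z (u * (gauss2 a z * cos (2 * pi * dot2 z w + 0)) +
   - v * (gauss2 a z * cos (2 * pi * dot2 z w + pi / 2)))).
  apply: eq_Rintegral => z _; rewrite cosDpihalf addr0 /zker zre0 zim0; ring.
rewrite RintegralD//; [|exact: integrable_scale|exact: integrable_scale].
rewrite !RintegralZl// !Rintegral_gauss2_cos// cos0 cos_pihalf; ring.
Qed.

End PlaneHarmonics.

(** * Gaussian mixtures *)

Section GaussianMixture.
Context {R : realType}.
Local Notation mu := (@lebesgue_measure R).
Local Notation nu := (@leb2 R).
Local Notation plane := (measurableTypeR R * measurableTypeR R)%type.
Implicit Types (k n : nat) (z w : plane).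

(** [fine] sends an infinite integral to 0, so the scalar comes out even when [f] is not integrable.
    This spares side conditions when mixtures are manipulated. *)
Lemma ge0_RintegralZl d (T : measurableType d) (m : {measure set T -> \bar R})
    (c : R) (f : T -> R) : measurable_fun setT f -> (forall x, 0 <= f x) ->
  \int[m]_x (c * f x) = c * \int[m]_x f x.
Proof.
move=> mf f0; have mf' : measurable_fun setT (EFin \o f) by exact/measurable_EFinP.
have [foo|] := ltP (\int[m]_x (f x)%:E)%E +oo%E.
  apply: RintegralZl => //; apply/integrableP; split => //.
  by under eq_integral do rewrite gee0_abs ?lee_fin//.
rewrite leye_eq => /eqP foo; rewrite [in RHS]/Rintegral foo mulr0 /Rintegral.
have [c0|c0] := leP 0 c.
  under eq_integral do rewrite EFinM.
  rewrite ge0_integralZl_EFin//; last by move=> x _; rewrite lee_fin.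
  rewrite foo; move: c0; rewrite le_eqVlt => /predU1P[<-|c0]; first by rewrite mul0e.
  by rewrite gt0_muley.
have -> : (fun x => (c * f x)%:E) = (fun x => - ((- c)%:E * (f x)%:E))%E.
  by apply/funext => x; rewrite -EFinM -EFinN mulNr opprK.
rewrite integral_ge0N; last first.
  by move=> x _; rewrite -EFinM lee_fin mulr_ge0// oppr_ge0 ltW.
rewrite ge0_integralZl_EFin ?oppr_ge0 ?(ltW c0)//; last by move=> x _; rewrite lee_fin.
by rewrite foo gt0_muley ?lte_fin ?oppr_gt0.
Qed.

Definition nrm z : R := Num.sqrt (nsq z).

Lemma nrm_ge0 z : 0 <= nrm z. Proof. exact: sqrtr_ge0. Qed.

Lemma sqr_nrm z : nrm z ^+ 2 = nsq z.
Proof. by rewrite sqr_sqrtr// nsq_ge0. Qed.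

Lemma measurable_nrm : measurable_fun setT nrm.
Proof. by apply: (measurableT_comp (@measurable_sqrt R)); exact: measurable_nsq. Qed.

Lemma gdom_nrm n a : 0 < a -> gdom nsq (fun z => nrm z ^+ n * gauss2 a z).
Proof.
move=> a0; apply: (@gdomX _ _ _ nsq_ge0); first by move=> z; rewrite sqr_nrm.
exact: gdom_gauss.
Qed.

Lemma zre_zim_sqr k z : zre k z ^+ 2 + zim k z ^+ 2 = nsq z ^+ k.
Proof.
elim: k => [|k IH]; first by rewrite zre0 zim0 expr0 expr1n expr0n addr0.
by rewrite zreS zimS [RHS]exprS -IH /nsq; ring.
Qed.

Lemma zker_le k u v w z : u ^+ 2 + v ^+ 2 = 1 -> `|zker k u v w z| <= nrm z ^+ k.
Proof.
move=> uv; rewrite -(@ler_pXn2r _ 2) ?nnegrE ?exprn_ge0 ?nrm_ge0//.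
rewrite -exprM mulnC exprM sqr_nrm real_normK ?num_real// -zre_zim_sqr /zker.
have := cos2Dsin2 (2 * pi * dot2 z w).
move: (cos _) (sin _) (zre k z) (zim k z) => c s A B cs.
have -> : A ^+ 2 + B ^+ 2 = (u ^+ 2 + v ^+ 2) * (A ^+ 2 + B ^+ 2) * (c ^+ 2 + s ^+ 2).
  by rewrite uv cs mul1r mulr1.
rewrite -subr_ge0; set X := (X in 0 <= X).
(* The gap is the square of the imaginary part of (u + i v) z^k exp(-2 i pi z.w). *)
suff -> : X = (s * (u * A - v * B) - c * (u * B + v * A)) ^+ 2 by exact: sqr_ge0.
by rewrite /X; ring.
Qed.

Lemma measurable_zker k u v w : measurable_fun setT (zker k u v w).
Proof.
have [mA mB] := @measurable_zre_zim R k.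
have mth : measurable_fun setT (fun z => 2 * pi * dot2 z w).
  by apply: measurable_funM => //; exact: measurable_dot2.
apply: measurable_funD; apply: measurable_funM.
- exact: (measurableT_comp (@measurable_cos R)).
- by apply: measurable_funB; apply: measurable_funM.
- exact: (measurableT_comp (@measurable_sin R)).
- by apply: measurable_funD; apply: measurable_funM.
Qed.

(** Disks exhaust the plane, and a multiple of a Gaussian dominates the indicator of each. *)
Lemma leb2_sigma_finite : sigma_finite setT nu.
Proof.
exists (fun n => [set z : plane | nsq z <= n%:R]).
  apply/seteqP; split => // z _; exists (Num.truncn (nsq z)).+1 => //=.
  exact/ltW/truncnS_gt.
move=> n; have mF : measurable [set z : plane | nsq z <= n%:R].
  rewrite -[X in measurable X]setTI.
  have := @measurable_nsq R measurableT `]-oo, n%:R]%classic (measurable_itv _).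
  by congr (measurable (_ `&` _)); apply/seteqP; split => z /=; rewrite in_itv.
split => //; rewrite -[X in (leb2 X)]setIT -integral_indic//.
have ig : nu.-integrable setT (EFin \o (fun z => expR (pi * n%:R) * gauss2 1 z)).
  by apply: integrable_scale => //; exact: integrable_gauss2.
apply: (@le_lt_trans _ _ (\int[nu]_z (expR (pi * n%:R) * gauss2 1 z)%:E)%E).
  apply: ge0_le_integral => //.
  - by apply/measurable_EFinP; exact: measurable_indic.
  - by case/integrableP : ig.
  - move=> z _; rewrite lee_fin indicE; case: (boolP (z \in _)) => [|_].
      rewrite inE /= => zn; rewrite /gauss2 mulr1 -expRD; apply: le_trans (expR_ge1Dx _).
      by rewrite lerDl subr_ge0 ler_wpM2l ?pi_ge0.
    by rewrite mulr_ge0 ?expR_ge0// gauss2_ge0.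
have /integrableP[_] := ig.
under eq_integral do rewrite gee0_abs ?lee_fin ?mulr_ge0 ?expR_ge0 ?gauss2_ge0//.
by [].
Qed.

(** [leb2] is typed as a bare measure while Fubini asks for a sigma-finite structure; this repacks
    the same set function. *)
Definition leb2s : {sigma_finite_measure set plane -> \bar R} :=
  HB.pack_for {sigma_finite_measure set plane -> \bar R} (Measure.sort nu)
    (Measure_isSigmaFinite.Build _ _ _ (Measure.sort nu) leb2_sigma_finite).

(* Functions [z^k * mix b a z] form a class stable under the Fourier transform:
   each Gaussian satisfies [gauss2 a ~> a^-k.+1 * gauss2 a^-1] up to [(- i)^k]. *)
Definition mix (b a : R -> R) z : R := \int[mu]_s (b s * gauss2 (a s) z).

Section mix.
Variables (b a : R -> R).
Hypotheses (mb : measurable_fun setT b) (ma : measurable_fun setT a).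
Hypothesis b0 : forall s, 0 <= b s.
Hypothesis a0 : forall s, b s != 0 -> 0 < a s.

Lemma measurable_mix_kernel : measurable_fun setT
  (fun t : plane * measurableTypeR R => b t.2 * gauss2 (a t.2) t.1).
Proof.
apply: measurable_funM; first exact: measurableT_comp.
apply: (measurableT_comp (@measurable_expR R)); apply: measurable_funN.
apply: measurable_funM.
  by apply: measurable_funM => //; exact: measurableT_comp.
by apply: (measurableT_comp (@measurable_nsq R)).
Qed.

Let mk := measurable_mix_kernel.

Lemma mix_kernel_ge0 s z : 0 <= b s * gauss2 (a s) z.
Proof. by rewrite mulr_ge0// gauss2_ge0. Qed.

Lemma mix_ge0 z : 0 <= mix b a z.
Proof. by apply: Rintegral_ge0 => s _; exact: mix_kernel_ge0. Qed.

Lemma measurable_mix : measurable_fun setT (mix b a).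
Proof.
apply: (measurableT_comp (@fine_measurable R setT measurableT)).
apply: (measurable_fun_fubini_tonelli_F (m2 := mu) (fun t => (b t.2 * gauss2 (a t.2) t.1)%:E)).
  exact/measurable_EFinP.
by move=> t; rewrite lee_fin mix_kernel_ge0.
Qed.

(** The majorant is stated in the extended reals, so that it also certifies finiteness of the
    [s]-integral at each point. A weight of finite mass admits a Gaussian times a power of |z|; the
    weight s^m on the whole line has infinite mass, and its majorant comes from the exact formula
    for |z|^(-k). *)
Variables (k : nat) (Phi : plane -> R).
Hypothesis PhiP : forall z,
  (\int[mu]_s (nrm z ^+ k * (b s * gauss2 (a s) z))%:E <= (Phi z)%:E)%E.
Hypothesis intPhi : nu.-integrable setT (EFin \o Phi).

Let mslice z : measurable_fun setT (fun s : measurableTypeR R => b s * gauss2 (a s) z).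
Proof.
apply: measurable_funM => //; apply: (measurableT_comp (@measurable_expR R)).
by apply: measurable_funN; apply: measurable_funM => //; exact: measurable_funM.
Qed.

Lemma nrm_mix_le z : nrm z ^+ k * mix b a z <= Phi z.
Proof.
rewrite -ge0_RintegralZl//; last by move=> s; exact: mix_kernel_ge0.
rewrite /Rintegral -lee_fin fineK//.
rewrite ge0_fin_numE; first exact: le_lt_trans (PhiP z) (ltry _).
by apply: integral_ge0 => s _; rewrite lee_fin mulr_ge0 ?exprn_ge0 ?nrm_ge0 ?mix_kernel_ge0.
Qed.

Section test.
Variable q : plane -> R.
Hypothesis mq : measurable_fun setT q.
Hypothesis qle : forall z, `|q z| <= nrm z ^+ k.

Let F (t : plane * measurableTypeR R) := (q t.1 * (b t.2 * gauss2 (a t.2) t.1))%:E.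

Let mF : measurable_fun setT F.
Proof.
by apply/measurable_EFinP; apply: measurable_funM => //; exact: measurableT_comp.
Qed.

Let intF : (leb2s \x mu)%E.-integrable setT F.
Proof.
apply/(@integrable12ltyP _ _ _ _ _ leb2s mu) => //.
apply: (@le_lt_trans _ _ (\int[nu]_z `|(Phi z)%:E|)%E); last by case/integrableP : intPhi.
apply: ge0_le_integral => //.
- by move=> z _; apply: integral_ge0.
- apply: (measurable_fun_fubini_tonelli_F (m2 := mu) (abse \o F)) => [|t].
    exact: measurableT_comp.
  exact: abse_ge0.
- by apply: measurableT_comp => //; case/integrableP : intPhi.
- move=> z _; apply: (le_trans _ (lee_abs _)); apply: le_trans (PhiP z).
  apply: ge0_le_integral => //.
  + apply: measurableT_comp => //; apply/measurable_EFinP.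
    rewrite /=; apply: measurable_funM; first exact: measurable_cst.
    exact: mslice.
  + by apply/measurable_EFinP; apply: measurable_funM.
  + move=> s _; rewrite /F/= lee_fin normrM (ger0_norm (mix_kernel_ge0 s z)).
    by rewrite ler_wpM2r ?mix_kernel_ge0.
Qed.

Lemma integrable_mix : nu.-integrable setT (EFin \o (fun z => q z * mix b a z)).
Proof.
apply: (le_integrable _ _ _ intPhi) => //.
  by apply/measurable_EFinP; apply: measurable_funM => //; exact: measurable_mix.
move=> z _ /=; rewrite lee_fin normrM (ger0_norm (mix_ge0 z)).
apply: (@le_trans _ _ (nrm z ^+ k * mix b a z)); first by rewrite ler_wpM2r ?mix_ge0.
by rewrite (le_trans (nrm_mix_le z))// ler_norm.
Qed.

(** Fubini: [Phi] gives absolute convergence for every test function of growth |z|^k. *)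
Lemma Rintegral_mix : \int[nu]_z (q z * mix b a z) =
  \int[mu]_s (b s * \int[nu]_z (q z * gauss2 (a s) z)).
Proof.
have := @Fubini _ _ _ _ _ leb2s mu _ intF; rewrite /Rintegral => FE.
transitivity (fine (\int[nu]_z \int[mu]_s F (z, s))); [|rewrite FE]; congr fine.
  apply: eq_integral => z _.
  rewrite -[X in (X)%:E]ge0_RintegralZl//; last by move=> s; exact: mix_kernel_ge0.
  rewrite /Rintegral fineK// fin_num_abs.
  apply: (le_lt_trans (le_abse_integral _ _ _)) => //.
    by apply/measurable_EFinP; apply: measurable_funM.
  apply: (le_lt_trans _ (ltry (Phi z))); apply: le_trans (PhiP z).
  apply: ge0_le_integral => //.
  + apply: measurableT_comp => //; apply/measurable_EFinP.
    rewrite /=; apply: measurable_funM; first exact: measurable_cst.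
    exact: mslice.
  + by apply/measurable_EFinP; apply: measurable_funM.
  + move=> s _; rewrite /F/= lee_fin normrM (ger0_norm (mix_kernel_ge0 s z)).
    by rewrite ler_wpM2r ?mix_kernel_ge0.
apply: eq_integral => s _.
(* Positivity of [a s] is known only where [b s] is nonzero, so null weights are treated apart. *)
have [bs|bs] := eqVneq (b s) 0.
  rewrite bs mul0r; apply: integral0_eq => z _.
  by rewrite /F/= bs mul0r mulr0.
have ig : nu.-integrable setT (EFin \o (fun z => q z * gauss2 (a s) z)).
  apply: gdom_integrable2.
    by apply: measurable_funM => //; exact: measurable_gauss2.
  apply: gdom_le (gdom_nrm k (a0 bs)) => z.
  by rewrite !normrM ler_wpM2r// (le_trans (qle z))// ler_norm.
rewrite -RintegralZl// /Rintegral fineK; last first.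
  apply: integrable_fin_num => //.
  exact: (integrable_scale (b s) _ ig).
by apply: eq_integral => z _; rewrite /F/= mulrCA.
Qed.

End test.

(** The Gaussian of parameter [a s] contributes (- i w / a s)^k / a s; by homogeneity all powers of
    [a s] move into the weight. *)
Lemma Rintegral_zker_mix u v w : u ^+ 2 + v ^+ 2 = 1 ->
  \int[nu]_z (zker k u v w z * mix b a z) =
  complex.Re ((u +i* v)%C * (w.2 +i* (- w.1))%C ^+ k) *
  mix (fun s => b s / a s ^+ k.+1) (fun s => (a s)^-1) w.
Proof.
move=> uv; rewrite Rintegral_mix; [|exact: measurable_zker|by move=> z; exact: zker_le].
rewrite -ge0_RintegralZl; last 2 first.
- have mia : measurable_fun setT (fun s => (a s)^-1) by exact: (measurableT_comp (@measurable_inv R)).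
  apply: measurable_funM.
    apply: measurable_funM => //; apply: (measurableT_comp (@measurable_inv R)).
    exact: measurable_funX.
  apply: (measurableT_comp (@measurable_expR R)); apply: measurable_funN.
  by apply: measurable_funM => //; apply: measurable_funM.
- move=> s; rewrite mulr_ge0 ?gauss2_ge0//.
  have [->|bs] := eqVneq (b s) 0; first by rewrite mul0r.
  by rewrite divr_ge0// exprn_ge0// ltW// a0.
apply: eq_Rintegral => s _.
have [->|bs] := eqVneq (b s) 0; first by rewrite !mul0r mulr0.
have as0 := a0 bs.
rewrite Rintegral_zker//.
have -> : ((w.2 / a s) +i* (- w.1 / a s))%C = (a s)^-1%:C%C * (w.2 +i* (- w.1))%C.
  by simpc; congr (_ +i* _)%C; ring.
rewrite exprMn -rmorphXn/= [X in complex.Re X]mulrCA.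
have ReM (x : R) (y : R[i]) : complex.Re (x%:C%C * y) = x * complex.Re y.
  by case: y => y1 y2; simpc.
rewrite ReM exprVn exprS; field.
by rewrite expf_neq0 gt_eqF.
Qed.

(** The real part is the case (u, v) = (1, 0) of the kernel formula, the imaginary part the case (0,
    -1), because Re (- i X) = Im X. *)
Lemma fourier_mix w :
  fourier (fun z => toC z ^+ k * (mix b a z)%:C%C) w =
  (- 'i%C * toC w) ^+ k * (mix (fun s => b s / a s ^+ k.+1) (fun s => (a s)^-1) w)%:C%C.
Proof.
have -> : - 'i%C * toC w = (w.2 +i* (- w.1))%C :> R[i].
  by rewrite /toC; case: w => x y; simpc.
have E (X : R[i]) (m : R) : X * m%:C%C = (complex.Re X * m +i* (complex.Im X * m))%C.
  by case: X => x y; simpc.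
rewrite [RHS]E /fourier /cintegral; congr (_ +i* _)%C.
  have := @Rintegral_zker_mix 1 0 w; rewrite expr1n expr0n addr0 => /(_ erefl).
  have -> : (1 +i* 0)%C = 1 :> R[i] by [].
  rewrite mul1r => <-; apply: eq_Rintegral => z _.
  rewrite E /cis cosN sinN /zker /zre /zim; case: (toC z ^+ k) => x y /=; ring.
have := @Rintegral_zker_mix 0 (-1) w; rewrite sqrrN expr1n expr0n add0r => /(_ erefl).
have -> : complex.Re ((0 +i* (-1))%C * (w.2 +i* - w.1)%C ^+ k) = complex.Im ((w.2 +i* - w.1)%C ^+ k).
  by case: (_ ^+ k) => x y; simpc => /=; ring.
move=> <-; apply: eq_Rintegral => z _.
rewrite E /cis cosN sinN /zker /zre /zim; case: (toC z ^+ k) => x y /=; ring.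
Qed.

End mix.
End GaussianMixture.

(** * Moments of Gaussians on the line and on the plane *)

Section Moments.
Context {R : realType}.
Local Notation mu := (@lebesgue_measure R).
Local Notation nu := (@leb2 R).
Local Notation plane := (measurableTypeR R * measurableTypeR R)%type.
Implicit Types (n : nat) (z : plane).

Definition gmom n : R := \int[mu]_x (x ^+ n * expR (- (pi * x ^+ 2))).
Definition gmom2 n : R := \int[nu]_z (nrm z ^+ n * gauss2 1 z).

Let mgm n : measurable_fun setT (fun x : R => x ^+ n * expR (- (pi * x ^+ 2))).
Proof.
apply: measurable_funM => //; apply: (measurableT_comp (@measurable_expR R)).
by apply: measurable_funN; apply: measurable_funM => //.
Qed.

Lemma integrable_gmom n :
  mu.-integrable setT (EFin \o (fun x => x ^+ n * expR (- (pi * x ^+ 2)))).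
Proof.
apply: gdom_integrable => //; apply: (@gdomX _ _ _ _ n _ id) => //.
- by move=> x; exact: sqr_ge0.
- by exists 1, 1; split => // x; rewrite mul1r mulr1 ger0_norm ?expR_ge0.
Qed.

Lemma ge0_integral_fineK d (T : measurableType d) (m : {measure set T -> \bar R})
  (f : T -> R) : (forall x, 0 <= f x) -> m.-integrable setT (EFin \o f) ->
  (\int[m]_x (f x)%:E)%E = (\int[m]_x f x)%:E.
Proof. by move=> f0 intf; rewrite /Rintegral fineK//; exact: integrable_fin_num. Qed.

Lemma integral_gmom n : ~~ odd n ->
  (\int[mu]_x (x ^+ n * expR (- (pi * x ^+ 2)))%:E)%E = (gmom n)%:E.
Proof.
move=> n_even; apply: ge0_integral_fineK; last exact: integrable_gmom.
by move=> x; rewrite mulr_ge0 ?expR_ge0// exprn_even_ge0.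
Qed.

(** A dilation by c. For c = |z| it says that |z|^(n+1) times the integral of s^n exp(-pi s^2 |z|^2)
    does not depend on z, which represents |z|^(-k) with k = n + 1. *)
Lemma integral_gmom_scale n (c : R) : ~~ odd n -> 0 < c ->
  (\int[mu]_x (c ^+ n.+1 * (x ^+ n * expR (- (pi * x ^+ 2 * c ^+ 2))))%:E)%E = (gmom n)%:E.
Proof.
move=> n_even c0; rewrite -integral_gmom// [RHS](@ge0_integral_affine _ c 0)//; last 2 first.
- by apply/measurable_EFinP; exact: mgm.
- by move=> x; rewrite lee_fin mulr_ge0 ?expR_ge0// exprn_even_ge0.
rewrite -ge0_integralZl_EFin ?ltW//; last 2 first.
- by move=> x _; rewrite lee_fin mulr_ge0 ?expR_ge0// exprn_even_ge0.
- apply/measurable_EFinP; apply: (measurableT_comp (mgm n)).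
  by apply: measurable_funD => //; exact: measurable_funM.
apply: eq_integral => x _; rewrite -EFinM addr0 !exprMn exprS !mulrA.
by congr (_ * expR _)%:E; ring.
Qed.

(** Induction in steps of two: [moment_recur] ties [gmom n.+2] to [gmom n], and [gmom 0] is 1. *)
Lemma gmom_gt0 n : ~~ odd n -> 0 < gmom n.
Proof.
move: {2}n (leqnn n) => N; elim: N n => [|N IH] [|[|n]]// nN n_even.
- rewrite /gmom; under eq_Rintegral do rewrite expr0 mul1r -[pi]mulr1.
  by rewrite /Rintegral integral_gauss_scale//= sqrtr1 invr1.
- rewrite /gmom; under eq_Rintegral do rewrite expr0 mul1r -[pi]mulr1.
  by rewrite /Rintegral integral_gauss_scale//= sqrtr1 invr1.
have := @moment_recur R n; rewrite -/(gmom n) -/(gmom n.+2) => H.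
have g0 : 0 < gmom n by apply: IH; [exact: ltnW|rewrite /= negbK in n_even].
have : 0 < 2 * pi * gmom n.+2 by rewrite H mulr_gt0.
by rewrite pmulr_rgt0// mulr_gt0 ?pi_gt0.
Qed.

Lemma measurable_nrm_gauss n a : measurable_fun setT (fun z : plane => nrm z ^+ n * gauss2 a z).
Proof.
by apply: measurable_funM; [apply: measurable_funX; exact: measurable_nrm|exact: measurable_gauss2].
Qed.

Lemma nrm_gauss_ge0 n a z : 0 <= nrm z ^+ n * gauss2 a z.
Proof. by rewrite mulr_ge0 ?gauss2_ge0// exprn_ge0// nrm_ge0. Qed.

Lemma integrable_nrm_gauss n a : 0 < a ->
  nu.-integrable setT (EFin \o (fun z => nrm z ^+ n * gauss2 a z)).
Proof.
by move=> a0; apply: gdom_integrable2; [exact: measurable_nrm_gauss|exact: gdom_nrm].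
Qed.

Lemma integral_gmom2 n :
  (\int[nu]_z (nrm z ^+ n * gauss2 1 z)%:E)%E = (gmom2 n)%:E.
Proof.
apply: ge0_integral_fineK; last exact: integrable_nrm_gauss.
by move=> z; exact: nrm_gauss_ge0.
Qed.

Lemma nrmZ (c : R) z : 0 <= c -> nrm (c * z.1 + 0, c * z.2 + 0) = c * nrm z.
Proof.
move=> c0; rewrite /nrm /nsq /= !addr0 !exprMn -mulrDr sqrtrM ?sqr_ge0//.
by rewrite sqrtr_sqr ger0_norm.
Qed.

Lemma Rintegral_nrm_gauss n (c : R) : 0 < c ->
  \int[nu]_z (nrm z ^+ n * gauss2 (c ^+ 2) z) = gmom2 n / c ^+ n.+2.
Proof.
move=> c0; have cn0 : c != 0 by rewrite gt_eqF.
apply: (mulfI (expf_neq0 n.+2 cn0)); rewrite mulrCA divff ?expf_neq0// mulr1.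
rewrite -RintegralZl//; last by apply: integrable_nrm_gauss; rewrite exprn_gt0.
rewrite /gmom2 {2}/Rintegral (@ge0_integral_leb2_affine _ c 0 0)//; last 2 first.
- by apply/measurable_EFinP; exact: measurable_nrm_gauss.
- by move=> z; rewrite lee_fin nrm_gauss_ge0.
rewrite -ge0_integralZl_EFin ?sqr_ge0//; last 2 first.
- by move=> z _; rewrite lee_fin nrm_gauss_ge0.
- apply/measurable_EFinP; apply: (measurableT_comp (measurable_nrm_gauss n 1)).
  by apply/measurable_fun_pairP; split; apply: measurable_funD => //; apply: measurable_funM.
congr fine; apply: eq_integral => z _; rewrite -EFinM nrmZ ?ltW// exprMn.
rewrite /gauss2 /nsq /= !addr0 !exprMn -mulrDr mulr1.
rewrite !mulrA -exprD addnC addn2; congr (_ * expR _)%:E; ring.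
Qed.

(** Slopes replace polar coordinates: with y = |x| m, the integrand |z|^n exp(-pi |z|^2) dy becomes
    |x|^(n+1) (1 + m^2)^(n/2) exp(-pi x^2 (1 + m^2)) dm. After exchanging the integrals, the one in
    x equals gmom (n+1) / (1 + m^2). Oddness of n gives x^(n+1) = |x|^(n+1). *)
Lemma gmom2_ge n : odd n -> gmom n.+1 / 2 <= gmom2 n.
Proof.
move=> n_odd; have n1_even : ~~ odd n.+1 by rewrite /= n_odd.
have n1_0 : 0 <= gmom n.+1 by exact/ltW/gmom_gt0.
pose H (t : measurableTypeR R * measurableTypeR R) : R :=
  t.1 ^+ n.+1 * (Num.sqrt (1 + t.2 ^+ 2) ^+ n * expR (- (pi * t.1 ^+ 2 * (1 + t.2 ^+ 2)))).
have H0 t : 0 <= H t.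
  by rewrite mulr_ge0 ?exprn_even_ge0// mulr_ge0 ?expR_ge0// exprn_ge0 ?sqrtr_ge0.
have m2 : measurable_fun setT (fun t : plane => 1 + t.2 ^+ 2).
  by apply: measurable_funD => //; apply: measurable_funX.
have mH : measurable_fun setT H.
  apply: measurable_funM; first exact: measurable_funX.
  apply: measurable_funM.
    by apply: measurable_funX; apply: (measurableT_comp (@measurable_sqrt R)).
  apply: (measurableT_comp (@measurable_expR R)); apply: measurable_funN.
  by apply: measurable_funM => //; apply: measurable_funM => //; apply: measurable_funX.
rewrite -lee_fin -integral_gmom2 ge0_integral_leb2_12; last 2 first.
- by apply/measurable_EFinP; exact: measurable_nrm_gauss.
- by move=> z; rewrite lee_fin nrm_gauss_ge0.
apply: (@le_trans _ _ (\int[mu]_x \int[mu]_m (H (x, m))%:E)%E); last first.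
  apply: ge0_le_integral => //.
  - by move=> x _; apply: integral_ge0 => m _; rewrite lee_fin.
  - apply: (measurable_fun_fubini_tonelli_F (fun t => (H t)%:E)) => //.
    exact/measurable_EFinP.
  - apply: (measurable_fun_fubini_tonelli_F (fun t => (nrm t ^+ n * gauss2 1 t)%:E)) => //.
      by apply/measurable_EFinP; exact: measurable_nrm_gauss.
    by move=> t; rewrite lee_fin nrm_gauss_ge0.
  - move=> x _; have [->|x0] := eqVneq x 0.
      rewrite integral0_eq => [|m _]; last by rewrite /H /= expr0n mul0r.
      by apply: integral_ge0 => y _; rewrite lee_fin nrm_gauss_ge0.
    rewrite [leRHS](@ge0_integral_affine _ `|x| 0)//; last 3 first.
    - by rewrite normr_gt0.
    - apply/measurable_EFinP.
      exact: (measurableT_comp (measurable_nrm_gauss n 1) (pair1_measurable x)).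
    - by move=> y; rewrite lee_fin nrm_gauss_ge0.
    rewrite -ge0_integralZl_EFin//; last 2 first.
    - by move=> y _; rewrite lee_fin nrm_gauss_ge0.
    - apply/measurable_EFinP; apply: (measurableT_comp (measurable_nrm_gauss n 1)).
      apply/measurable_fun_pairP; split; first exact: measurable_cst.
      by apply: measurable_funD => //; apply: measurable_funM.
    rewrite le_eqVlt; apply/orP; left; apply/eqP; apply: eq_integral => m _.
    rewrite -EFinM /H /=; congr EFin.
    have E : nsq (x, `|x| * m + 0) = `|x| ^+ 2 * (1 + m ^+ 2).
      by rewrite /nsq /= addr0 exprMn real_normK ?num_real//; ring.
    rewrite /gauss2 /nrm E sqrtrM ?sqr_ge0// sqrtr_sqr normr_id exprMn !mulrA.
    rewrite -exprS -[x ^+ n.+1]ger0_norm ?exprn_even_ge0// normrX.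
    have := real_normK (num_real x); rewrite !expr2 => h.
    have -> : pi * 1 * `|x| * `|x| = pi * x * x by rewrite -!mulrA h mul1r.
    by [].
have mHE : measurable_fun setT (fun t => (H t)%:E) by exact/measurable_EFinP.
have HE0 t : (0 <= (H t)%:E)%E by rewrite lee_fin.
rewrite -(ge0_integral_leb2_12 mHE HE0) (ge0_integral_leb2_21 mHE HE0).
have E m : (\int[mu]_x (H (x, m))%:E = (gmom n.+1 / (1 + m ^+ 2))%:E)%E.
  have m0 : 0 < 1 + m ^+ 2 by rewrite ltr_wpDr ?sqr_ge0.
  have c0 : 0 < Num.sqrt (1 + m ^+ 2) by rewrite sqrtr_gt0.
  rewrite mulrC EFinM -(integral_gmom_scale n1_even c0).
  rewrite -ge0_integralZl_EFin//; last 3 first.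
  - by move=> x _; rewrite lee_fin mulr_ge0 ?exprn_ge0 ?sqrtr_ge0// mulr_ge0 ?expR_ge0// exprn_even_ge0.
  - apply/measurable_EFinP; apply: measurable_funM => //; apply: measurable_funM => //.
    apply: (measurableT_comp (@measurable_expR R)); apply: measurable_funN.
    by apply: measurable_funM => //; apply: measurable_funM => //; apply: measurable_funX.
  - by rewrite invr_ge0 ltW.
  apply: eq_integral => x _; rewrite -EFinM /H/= sqr_sqrtr ?ltW//; congr EFin.
  have -> (y : R) : y ^+ n.+2 = y ^+ n * y ^+ 2 by rewrite -exprD addn2.
  rewrite [Num.sqrt _ ^+ 2]sqr_sqrtr ?ltW//.
  move: (Num.sqrt _ ^+ n) (expR _) (x ^+ n.+1) => S e X.
  by field; rewrite gt_eqF.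
under eq_integral do rewrite E.
(* Only slopes in [0, 1] are kept, where 1 / (1 + m^2) >= 1/2. *)
apply: (@le_trans _ _ (\int[mu]_(m in `[0%R, 1%R]) (gmom n.+1 / 2)%:E)%E).
  rewrite integral_cst//= lebesgue_measure_itv/= lte_fin ltr01 oppr0 addr0.
  by rewrite mule1.
rewrite [leLHS]integral_mkcond; apply: ge0_le_integral => //.
- by move=> m _; rewrite patchE; case: ifP => // _; rewrite lee_fin divr_ge0.
- by apply/(measurable_restrictT _ _).1.
- apply/measurable_EFinP; apply: measurable_funM => //.
  apply: (measurableT_comp (@measurable_inv R)).
  by apply: measurable_funD => //; apply: measurable_funX.
- move=> m _; rewrite patchE; case: ifPn => [|_]; last first.
    by rewrite lee_fin divr_ge0// addr_ge0// sqr_ge0.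
  rewrite inE /= in_itv/= => /andP[m0 m1]; rewrite lee_fin ler_wpM2l//.
  rewrite lef_pV2 ?posrE ?ltr_wpDr ?sqr_ge0//.
  by rewrite (_ : 2 = 1 + 1)// lerD2l expr_le1.
Qed.

(** Source of the power of k: by [moment_recur], raising the degree by two multiplies a
    one-dimensional moment by (n+1) / (2 pi), and [gmom2_ge] costs a further 1/2. *)
Lemma gmom2_ge_gmom n : ~~ odd n -> n.+1%:R / (4 * pi) * gmom n <= gmom2 n.+1.
Proof.
move=> n_even; apply: (le_trans _ (gmom2_ge _)); last by [].
have := @moment_recur R n; rewrite -/(gmom n) -/(gmom n.+2) => H.
have p0 := pi_gt0 R.
rewrite le_eqVlt; apply/orP; left; apply/eqP.
have -> : n.+1%:R / (4 * pi) * gmom n = (n.+1%:R * gmom n) / (4 * pi) by rewrite mulrAC.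
rewrite -H; move: (gmom n.+2) (pi : R) p0 => G p p0.
by field; rewrite gt_eqF.
Qed.

End Moments.

(** * Integrability of inverse powers *)

Section Japanese.
Context {R : realType}.
Local Notation mu := (@lebesgue_measure R).
Local Notation nu := (@leb2 R).
Local Notation plane := (measurableTypeR R * measurableTypeR R)%type.
Implicit Types (b c x : R) (z : plane).

Lemma ler_powRl c x y : 0 <= c -> 0 <= x -> x <= y -> x `^ c <= y `^ c.
Proof. by move=> c0 x0 xy; apply: ge0_ler_powR; rewrite ?nnegrE// (le_trans x0). Qed.

Lemma powRN_cvg0 c : 0 < c -> (fun x : R => x `^ (- c)) x @[x --> +oo] --> (0 : R).
Proof.
move=> c0; apply/cvgr0Pnorm_le => e e0; near=> x.
have x0 : 0 < x by near: x; exact: nbhs_pinfty_gt.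
rewrite ger0_norm ?powR_ge0// powRN -[e]invrK lef_pV2 ?posrE ?powR_gt0 ?invr_gt0//.
have -> : e^-1 = (e^-1 `^ c^-1) `^ c by rewrite -powRrM mulVf ?gt_eqF// powRr1// invr_ge0 ltW.
have xM : e^-1 `^ c^-1 < x by near: x; exact: nbhs_pinfty_gt.
by apply: ge0_ler_powR; rewrite ?nnegrE ?powR_ge0 ?ltW.
Unshelve. all: by end_near. Qed.

Lemma integral_powRN_lty c : 1 < c ->
  (\int[mu]_(x in `[1%R, +oo[) (x `^ (- c))%:E < +oo)%E.
Proof.
move=> c1; have c10 : 0 < c - 1 by rewrite subr_gt0.
pose F x : R := - x `^ (- (c - 1)).
have H : (\int[mu]_(x in `[1%R, +oo[) ((c - 1) * x `^ (- c))%:E = 0%:E - (F 1)%:E)%E.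
  apply: ge0_continuous_FTC2y.
  - by move=> x _; rewrite mulr_ge0 ?powR_ge0// ltW.
  - apply: continuous_in_subspaceT => x; rewrite inE /= in_itv/= andbT => x1.
    have x0 : 0 < x by exact: lt_le_trans x1.
    apply/differentiable_continuous/derivable1_diffP.
    have d := is_derive1_powR (- c) x0.
    by apply: ex_derive.
  - rewrite -[X in _ --> X]oppr0; apply: cvgN; exact: powRN_cvg0.
  - move=> x x1; have x0 : 0 < x by exact: lt_trans x1.
    have d := is_derive1_powR (- (c - 1)) x0.
    by apply: ex_derive.
  - apply: cvg_at_right_filter.
    have d := is_derive1_powR (- (c - 1)) (@ltr01 R).
    apply/differentiable_continuous/derivable1_diffP.
    by apply: ex_derive.
  - move=> x; rewrite in_itv/= andbT => x1; have x0 : 0 < x by exact: lt_trans x1.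
    have d := is_derive1_powR (- (c - 1)) x0.
    rewrite derive1E; apply: derive_val.
    apply: is_derive_eq; rewrite /=.
    have -> : - (c - 1) - 1 = - c by ring.
    by ring.
move: H; rewrite /F powR1; under eq_integral do rewrite EFinM.
rewrite ge0_integralZl_EFin ?ltW//; last 2 first.
- by move=> x _; rewrite lee_fin powR_ge0.
- by apply/measurable_EFinP; apply: measurable_funTS; exact: measurable_powR.
case: (\int[_]_(_ in _) _)%E => [r||].
- by rewrite ltry.
- by rewrite gt0_muley.
- by [].
Qed.

Lemma continuous_japanese b : continuous (fun x : R => (1 + x ^+ 2) `^ (- b)).
Proof.
move=> x; have x0 : 0 < 1 + x ^+ 2 by rewrite ltr_wpDr ?sqr_ge0.
have d := is_derive1_powR (- b) x0.
have d2 : is_derive x (1 : R) (fun x : R => 1 + x ^+ 2) (2 * x).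
  by apply: is_derive_eq; rewrite /GRing.scale /=; ring.
have d3 := @is_derive1_comp _ ((@powR R)^~ (- b)) (fun x => 1 + x ^+ 2) x _ _ d d2.
by apply/differentiable_continuous/derivable1_diffP; apply: ex_derive.
Qed.

(** The integrand is bounded on [0, 1) and at most x^(-2b) beyond, with 2b > 1. *)
Lemma integral_japanese_lty b : 2^-1 < b ->
  (\int[mu]_x ((1 + x ^+ 2) `^ (- b))%:E < +oo)%E.
Proof.
move=> b2; rewrite ge0_symfun_integralT/=; last 3 first.
- by move=> x; exact: powR_ge0.
- exact: continuous_japanese.
- by move=> x; rewrite /= sqrrN.
rewrite lte_mul_pinfty//.
have mj (D : set R) : measurable_fun D (fun x => ((1 + x ^+ 2) `^ (- b))%:E).
  apply/measurable_EFinP; apply: measurable_funTS; apply: continuous_measurable_fun.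
  exact: continuous_japanese.
have -> : [set x : R | 0 <= x] = `[0%R, 1%R[ `|` `[1%R, +oo[.
  apply/seteqP; split => x /=; rewrite !in_itv/= ?andbT.
    by case: (ltP x 1) => ? ?; [left; apply/andP|right].
  by move=> [/andP[]//|]; exact: le_trans.
rewrite ge0_integral_setU//=; last 3 first.
- exact: mj.
- by move=> x _; rewrite lee_fin powR_ge0.
- apply/disj_setPS => x /=; rewrite !in_itv/= andbT => -[/andP[_]].
  by rewrite ltNge => /negP.
rewrite lte_add_pinfty//.
  apply: (@le_lt_trans _ _ (\int[mu]_(x in `[0%R, 1%R[) 1%:E)%E).
    apply: ge0_le_integral => //.
    - by move=> x _; rewrite lee_fin powR_ge0.
    - exact: mj.
    - move=> x _; rewrite lee_fin powRN invf_le1 ?powR_gt0 ?ltr_wpDr ?sqr_ge0//.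
      rewrite -[leLHS](powRr0 (1 + x ^+ 2)) ler_powR ?lerDl ?sqr_ge0//.
      by rewrite ltW// (lt_trans _ b2).
  by rewrite integral_cst//= lebesgue_measure_itv/= lte_fin ltr01 oppr0 adde0 mule1 ltry.
apply: (@le_lt_trans _ _ (\int[mu]_(x in `[1%R, +oo[) (x `^ (- (2 * b)))%:E)%E).
  apply: ge0_le_integral => //.
  - by move=> x _; rewrite lee_fin powR_ge0.
  - exact: mj.
  - by apply/measurable_EFinP; apply: measurable_funTS; exact: measurable_powR.
  - move=> x /=; rewrite in_itv/= andbT => x1; have x0 : 0 < x by exact: lt_le_trans x1.
    rewrite lee_fin !powRN lef_pV2 ?posrE ?powR_gt0 ?ltr_wpDr ?sqr_ge0//.
    rewrite powRrM (powR_mulrn 2 (ltW x0)) ler_powRl ?sqr_ge0 ?lerDr//.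
    by rewrite ltW// (lt_trans _ b2).
by apply: integral_powRN_lty; rewrite mulrC -ltr_pdivrMr// div1r.
Qed.

(** Since (1 + |z|^2)^2 >= (1 + x^2) (1 + y^2), the integrand is at most a product of one-variable
    factors with exponent b / 2 > 1/2. *)
Lemma integral_japanese2_lty b : 1 < b ->
  (\int[nu]_z ((1 + nsq z) `^ (- b))%:E < +oo)%E.
Proof.
move=> b1; pose j (x : R) := (1 + x ^+ 2) `^ (- (b / 2)).
have b20 : 0 < b / 2 by rewrite divr_gt0// (lt_trans _ b1).
have mj : measurable_fun setT j by apply: continuous_measurable_fun; exact: continuous_japanese.
have j0 x : 0 <= j x by exact: powR_ge0.
have b2 : 2^-1 < b / 2 by rewrite ltr_pdivlMr// mulVf.
have fj := integral_japanese_lty b2.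
apply: (@le_lt_trans _ _ (\int[nu]_z (j z.1 * j z.2)%:E)%E).
  apply: ge0_le_integral => //.
  - by move=> z _; rewrite lee_fin powR_ge0.
  - apply/measurable_EFinP; apply: (measurableT_comp (@measurable_powR R (- b))).
    by apply: measurable_funD => //; exact: measurable_nsq.
  - by apply/measurable_EFinP; apply: measurable_funM; exact: measurableT_comp.
  - move=> z _; rewrite lee_fin /j -powRM ?addr_ge0 ?sqr_ge0//.
    rewrite !powRN lef_pV2 ?posrE ?powR_gt0 ?mulr_gt0 ?ltr_wpDr ?nsq_ge0 ?sqr_ge0//.
    have -> : (1 + nsq z) `^ b = ((1 + nsq z) ^+ 2) `^ (b / 2).
      have n0 : 0 <= 1 + nsq z by rewrite addr_ge0 ?nsq_ge0.
      transitivity ((1 + nsq z) `^ (2%:R * (b / 2))).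
        by congr (_ `^ _); field.
      by rewrite powRrM (powR_mulrn 2 n0).
    apply: ler_powRl; [exact: ltW|by rewrite mulr_ge0 ?addr_ge0 ?sqr_ge0|].
    by rewrite expr2 ler_pM ?addr_ge0 ?sqr_ge0// lerD2l ?coord_nsq1 ?coord_nsq2.
have mjE : measurable_fun setT (EFin \o j) by exact/measurable_EFinP.
rewrite ge0_integral_leb2_12; last 2 first.
- by apply/measurable_EFinP; apply: measurable_funM; exact: measurableT_comp.
- by move=> z; rewrite lee_fin mulr_ge0.
pose J := (\int[mu]_x (j x)%:E)%E.
have J0 : (0 <= J)%E by apply: integral_ge0 => x _; rewrite lee_fin.
have E x : (\int[mu]_y (j (x, y).1 * j (x, y).2)%:E = (fine J)%:E * (j x)%:E)%E.
  under eq_integral do rewrite /= EFinM.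
  rewrite ge0_integralZl_EFin//; last by move=> y _; rewrite lee_fin.
  by rewrite fineK ?ge0_fin_numE// muleC.
under eq_integral do rewrite E.
rewrite ge0_integralZl_EFin//; [|by move=> y _; rewrite lee_fin|by rewrite fine_ge0].
by rewrite lte_mul_pinfty// ?lee_fin ?fine_ge0.
Qed.

Lemma normc_nneg (X : R[i]) : 0 <= Normc.normc X.
Proof. by case: X => x y; exact: sqrtr_ge0. Qed.

Lemma measurable_normc (f : plane -> R[i]) : cmeasurable f ->
  measurable_fun setT (fun z => Normc.normc (f z)).
Proof.
move=> [mf1 mf2].
rewrite (_ : (fun z => _) = (fun z => Num.sqrt (complex.Re (f z) ^+ 2 + complex.Im (f z) ^+ 2))).
  apply: (measurableT_comp (@measurable_sqrt R)).
  by apply: measurable_funD; apply: measurable_funX.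
by apply/funext => z; case: (f z).
Qed.

Lemma cLnorm_lty (p N C : R) (f : plane -> R[i]) : cmeasurable f -> 1 < p -> 1 < N * p ->
  (forall z, Normc.normc (f z) <= C * (1 + nsq z) `^ (- N)) -> (cLnorm p f < +oo)%E.
Proof.
move=> mf p1 Np fle; have p0 : 0 < p by exact: lt_trans p1.
have mn := measurable_normc mf; have n0 z := normc_nneg (f z).
have C0 : 0 <= C.
  by have := le_trans (n0 (0, 0)) (fle (0, 0)); rewrite pmulr_lge0// powR_gt0 ?ltr_wpDr ?nsq_ge0.
rewrite /cLnorm unlock poweR_lty//.
under eq_integral => z _ do rewrite gee0_abs ?lee_fin// poweR_EFin.
apply: (@le_lt_trans _ _ (\int[nu]_z (C `^ p * (1 + nsq z) `^ (- (N * p)))%:E)%E).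
  apply: ge0_le_integral => //.
  - by move=> z _; rewrite lee_fin powR_ge0.
  - by apply/measurable_EFinP; apply: (measurableT_comp (@measurable_powR R p)).
  - apply/measurable_EFinP; apply: measurable_funM => //.
    apply: (measurableT_comp (@measurable_powR R (- (N * p)))).
    by apply: measurable_funD => //; exact: measurable_nsq.
  - move=> z _; rewrite lee_fin -mulNr powRrM -powRM ?powR_ge0//.
    by apply: ler_powRl => //; exact: ltW.
under eq_integral do rewrite EFinM.
rewrite ge0_integralZl_EFin ?powR_ge0//; last 2 first.
- by move=> z _; rewrite lee_fin powR_ge0.
- apply/measurable_EFinP; apply: (measurableT_comp (@measurable_powR R (- (N * p)))).
  by apply: measurable_funD => //; exact: measurable_nsq.
by rewrite lte_mul_pinfty ?lee_fin ?powR_ge0// integral_japanese2_lty.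
Qed.

End Japanese.

(** * Decay of cosine transforms *)

Section CosineTransform.
Context {R : realType}.
Local Notation mu := (@lebesgue_measure R).
Local Notation nu := (@leb2 R).
Local Notation plane := (measurableTypeR R * measurableTypeR R)%type.
Implicit Types (x z w d : plane) (t : R).

Lemma nrm_shift_le z d : `|nrm (z.1 + d.1, z.2 + d.2) - nrm z| <= nrm d.
Proof.
have H (u v : plane) : nrm (u.1 + v.1, u.2 + v.2) <= nrm u + nrm v.
  by case: u v => [u1 u2] [v1 v2]; exact: (@le_normcD R (toC (u1, u2)) (toC (v1, v2))).
rewrite ler_norml lerBlDr (addrC (nrm d)) H andbT.
rewrite lerBrDr -(lerD2l (nrm d)) addrA subrr add0r.
have := H (z.1 + d.1, z.2 + d.2) (- d.1, - d.2); rewrite /= !addrK -surjective_pairing.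
rewrite addrC; have -> : nrm (- d.1, - d.2) = nrm d by rewrite /nrm /nsq/= !sqrrN.
by rewrite addrC.
Qed.

Section fixed.
Variables (G : plane -> R) (mG : measurable_fun setT G).
Hypothesis iG : nu.-integrable setT (EFin \o G).

(** The phase [t] gathers both parts of the inverse Fourier transform of a real [G]: 0 gives the
    cosine part, - pi / 2 the sine part. *)
Definition costr t x : R := \int[nu]_z (G z * cos (2 * pi * dot2 x z + t)).

Let mc t x : measurable_fun setT (fun z => cos (2 * pi * dot2 x z + t)).
Proof.
apply: (measurableT_comp (@measurable_cos R)); apply: measurable_funD => //.
by apply: measurable_funM => //; apply: measurable_funD; apply: measurable_funM.
Qed.

Lemma integrable_costr t x :
  nu.-integrable setT (EFin \o (fun z => G z * cos (2 * pi * dot2 x z + t))).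
Proof.
apply: le_integrable iG => //.
  by apply/measurable_EFinP; apply: measurable_funM.
move=> z _ /=; rewrite lee_fin normrM ler_piMr//.
by rewrite ler_norml cos_geN1 cos_le1.
Qed.

Let F t (p : plane * plane) := (gauss2 1 p.1 * (G p.2 * cos (2 * pi * dot2 p.1 p.2 + t)))%:E.

Let mF t : measurable_fun setT (F t).
Proof.
apply/measurable_EFinP; apply: measurable_funM.
  by apply: (measurableT_comp (measurable_gauss2 1)).
apply: measurable_funM; first exact: measurableT_comp.
apply: (measurableT_comp (@measurable_cos R)); apply: measurable_funD => //.
apply: measurable_funM => //; apply: measurable_funD; apply: measurable_funM;
by apply: measurableT_comp.
Qed.

Let intF t : (@leb2s R \x @leb2s R)%E.-integrable setT (F t).
Proof.
apply/(@integrable12ltyP _ _ _ _ _ (@leb2s R) (@leb2s R)) => //.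
pose I := (\int[nu]_z `|(G z)%:E|)%E.
have I0 : (0 <= I)%E by apply: integral_ge0.
have Ioo : (I < +oo)%E by case/integrableP : iG.
apply: (@le_lt_trans _ _ (\int[nu]_x ((fine I)%:E * (gauss2 1 x)%:E))%E).
  apply: ge0_le_integral => //.
  - by move=> z _; apply: integral_ge0.
  - apply: (measurable_fun_fubini_tonelli_F (m2 := @leb2s R) (abse \o F t)) => [|p].
      exact: measurableT_comp.
    exact: abse_ge0.
  - by apply: measurable_funeM; apply/measurable_EFinP; exact: measurable_gauss2.
  - move=> x _; rewrite fineK ?ge0_fin_numE// muleC -ge0_integralZl_EFin ?gauss2_ge0//; last first.
      by apply: measurableT_comp => //; exact/measurable_EFinP.
    apply: ge0_le_integral => //.
    + apply: measurableT_comp => //; apply/measurable_EFinP; rewrite /=.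
      by apply: measurable_funM => //; apply: measurable_funM.
    + by apply: measurable_funeM; apply: measurableT_comp => //; exact/measurable_EFinP.
    + move=> z _; rewrite /F /= lee_fin normrM (ger0_norm (gauss2_ge0 _ _)) ler_wpM2l ?gauss2_ge0//.
      by rewrite normrM ler_piMr// ler_norml cos_geN1 cos_le1.
rewrite ge0_integralZl_EFin ?fine_ge0//; last 2 first.
- by move=> z _; rewrite lee_fin gauss2_ge0.
- by apply/measurable_EFinP; exact: measurable_gauss2.
by rewrite integral_gauss2// -EFinM ltry.
Qed.

Let innerF t x : (\int[nu]_z F t (x, z))%E = (gauss2 1 x * costr t x)%:E.
Proof.
rewrite /costr -RintegralZl//; last exact: integrable_costr.
rewrite /Rintegral fineK//; apply: integrable_fin_num => //.
by apply: (integrable_scale (gauss2 1 x) _ (integrable_costr t x)).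
Qed.

(** Fubini gives measurability for an integrand that is integrable on the product, so the transform
    is first weighted by a Gaussian, which is then divided out. *)
Lemma measurable_costr t : measurable_fun setT (costr t).
Proof.
have := measurable_fubini_F (intF t).
have -> : fubini_F (@leb2s R) (F t) = (fun x => (gauss2 1 x * costr t x)%:E).
  by apply/funext => x; rewrite -innerF.
move=> /measurable_EFinP H.
have -> : costr t = (fun x => (gauss2 1 x)^-1 * (gauss2 1 x * costr t x)).
  by apply/funext => x; rewrite mulKf// gt_eqF// expR_gt0.
apply: measurable_funM => //; apply: (measurableT_comp (@measurable_inv R)).
exact: measurable_gauss2.
Qed.

(** Multiplication formula: Fubini moves the cosine transform onto the Gaussian, which is its own
    transform. *)
Lemma Rintegral_gauss2_costr :
  \int[nu]_x (gauss2 1 x * costr 0 x) = \int[nu]_z (G z * gauss2 1 z).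
Proof.
have FE := @Fubini _ _ _ _ _ (@leb2s R) (@leb2s R) _ (intF 0).
transitivity (fine (\int[nu]_x \int[nu]_z F 0 (x, z)))%E.
  by rewrite /Rintegral; congr fine; apply: eq_integral => x _; rewrite innerF.
rewrite [in LHS]FE /Rintegral; congr fine; apply: eq_integral => z _.
transitivity (\int[nu]_x (G z * (gauss2 1 x * cos (2 * pi * dot2 x z + 0)))%:E)%E.
  by apply: eq_integral => x _; rewrite /F/=; congr EFin; rewrite mulrCA.
have ic : nu.-integrable setT (EFin \o (fun x => gauss2 1 x * cos (2 * pi * dot2 x z + 0))).
  apply: gdom_integrable2.
    by apply: measurable_funM; [exact: measurable_gauss2|exact: measurable_cos2].
  apply: (@gdom_le _ _ _ _ (fun x => cos (2 * pi * dot2 x z + 0) * gauss2 1 x)).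
    by move=> x; rewrite mulrC.
  by apply: gdom2_cos; exact: gdom_gauss.
rewrite -[RHS]/((G z * gauss2 1 z)%:E).
transitivity ((\int[nu]_x (G z * (gauss2 1 x * cos (2 * pi * dot2 x z + 0)))))%:E.
  by rewrite /Rintegral fineK//; apply: integrable_fin_num => //; exact: (integrable_scale (G z) _ ic).
by rewrite RintegralZl// Rintegral_gauss2_cos// cos0 divr1 mul1r invr1.
Qed.

(* Translating [G] by half a period in the direction of [x] flips the sign of
   the cosine, so that [costr] only sees a first difference of [G]. *)
Lemma costr_half_period t x d : dot2 x d = 2^-1 ->
  `|costr t x| <= \int[nu]_z `|G (z.1 + d.1, z.2 + d.2) - G z|.
Proof.
move=> xd; pose Gd z := G (z.1 + d.1, z.2 + d.2).
have msh : measurable_fun setT (fun z : plane => (z.1 + d.1, z.2 + d.2) : plane).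
  by apply/measurable_fun_pairP; split; apply: measurable_funD.
have mGd : measurable_fun setT Gd by exact: (measurableT_comp mG).
have iGd : nu.-integrable setT (EFin \o Gd).
  apply/integrableP; split; first exact/measurable_EFinP.
  have /integrableP[_] := iG; congr (_ < _)%E.
  rewrite (@ge0_integral_leb2_affine R 1 d.1 d.2)//; last first.
    by apply: measurableT_comp => //; exact/measurable_EFinP.
  by rewrite expr1n mul1e; apply: eq_integral => z _; rewrite /= !mul1r.
have E : costr t x = - \int[nu]_z (Gd z * cos (2 * pi * dot2 x z + t)).
  rewrite /costr -(@Rintegral_leb2_shift R d.1 d.2 (fun z => G z * cos (2 * pi * dot2 x z + t))); last first.
    by apply: measurable_funM.
  rewrite -[RHS]mulN1r -RintegralZl//; last first.
    apply: le_integrable iGd => //.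
      by apply/measurable_EFinP; apply: measurable_funM.
    move=> z _ /=; rewrite lee_fin normrM ler_piMr//.
    by rewrite ler_norml cos_geN1 cos_le1.
  apply: eq_Rintegral => z _; rewrite mulN1r /Gd -mulrN -cosDpi; congr (_ * cos _).
  have -> : dot2 x (z.1 + d.1, z.2 + d.2) = dot2 x z + dot2 x d by rewrite /dot2 /=; ring.
  by rewrite xd; field.
have iD : nu.-integrable setT (EFin \o (fun z => Gd z - G z)).
  by rewrite (_ : EFin \o _ = (EFin \o Gd) \- (EFin \o G))%E//; exact: integrableB.
have iDc : nu.-integrable setT (EFin \o (fun z => (Gd z - G z) * cos (2 * pi * dot2 x z + t))).
  apply: le_integrable iD => //.
    by apply/measurable_EFinP; apply: measurable_funM => //; exact: measurable_funB.
  move=> z _ /=; rewrite lee_fin normrM ler_piMr//.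
  by rewrite ler_norml cos_geN1 cos_le1.
have iGdc : nu.-integrable setT (EFin \o (fun z => Gd z * cos (2 * pi * dot2 x z + t))).
  apply: le_integrable iGd => //.
    by apply/measurable_EFinP; apply: measurable_funM.
  move=> z _ /=; rewrite lee_fin normrM ler_piMr//.
  by rewrite ler_norml cos_geN1 cos_le1.
have E2 : \int[nu]_z ((Gd z - G z) * cos (2 * pi * dot2 x z + t)) = - (2 * costr t x).
  under eq_Rintegral do rewrite mulrBl.
  rewrite RintegralB//; last exact: integrable_costr.
  rewrite -/(costr t x) -[X in X - _]opprK -E; ring.
have : `|2 * costr t x| <= \int[nu]_z `|Gd z - G z|.
  rewrite -normrN -E2; apply: (le_trans (le_normr_Rintegral _ iDc)) => //.
  apply: le_Rintegral => //.
  - exact: (integrable_abse iDc).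
  - exact: (integrable_abse iD).
  - move=> z _; rewrite normrM ler_piMr//.
    by rewrite ler_norml cos_geN1 cos_le1.
apply: le_trans; by rewrite normrM ger0_norm// ler_peMl// ler1n.
Qed.

Variables (kap : plane -> R).
Hypothesis ikap : nu.-integrable setT (EFin \o kap).
Hypothesis kap0 : forall z, 0 <= kap z.
Hypothesis lipG : forall d z, nrm d <= 1 ->
  `|G (z.1 + d.1, z.2 + d.2) - G z| <= nrm d * kap z.

(** For |x| >= 1/2 the half-period shift d = x / (2 |x|^2) has length 1 / (2 |x|) <= 1, so the first
    difference is O(1 / |x|); for smaller x the L^1 norm of [G] suffices. *)
Lemma costr_decay : exists C, forall t x, `|costr t x| <= C * (1 + nsq x) `^ (- 2^-1).
Proof.
have n1 x : 0 <= 1 + nsq x by exact: addr_ge0 ler01 (nsq_ge0 x).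
pose L := \int[nu]_z kap z; pose I := \int[nu]_z `|G z|.
have L0 : 0 <= L by apply: Rintegral_ge0.
have I0 : 0 <= I by apply: Rintegral_ge0.
(* The 3 comes from sqrt(1 + |x|^2) <= 3 |x| for |x| >= 1/2, the 2 from sqrt(1 + |x|^2) <= 2 for |x|
   < 1/2. *)
exists (2 * I + 3 * L) => t x.
have j0 : 0 < (1 + nsq x) `^ 2^-1 by rewrite powR_gt0// ltr_wpDr ?nsq_ge0.
rewrite powRN ler_pdivlMr//.
have -> : (1 + nsq x) `^ 2^-1 = Num.sqrt (1 + nsq x) by rewrite powR12_sqrt.
have [x2|x2] := leP 2^-1 (nrm x).
  have x0 : 0 < nrm x by apply: lt_le_trans x2.
  have n0 : 0 < nsq x by rewrite -sqr_nrm exprn_gt0.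
  pose d : plane := ((2 * nsq x)^-1 * x.1, (2 * nsq x)^-1 * x.2).
  have nd : nrm d = (2 * nrm x)^-1.
    have := @nrmZ R (2 * nsq x)^-1 x; rewrite !addr0 => ->; last first.
      by rewrite invr_ge0 mulr_ge0// ltW.
    by rewrite -sqr_nrm; field; rewrite gt_eqF.
  have xd : dot2 x d = 2^-1.
    have -> : dot2 x d = (2 * nsq x)^-1 * nsq x by rewrite /dot2 /d /= /nsq; ring.
    by field; rewrite gt_eqF.
  have d1 : nrm d <= 1 by rewrite nd invf_le1 ?mulr_gt0// mulrC -ler_pdivrMr// div1r.
  have msh : measurable_fun setT (fun z : plane => (z.1 + d.1, z.2 + d.2) : plane).
    by apply/measurable_fun_pairP; split; apply: measurable_funD.
  have H : `|costr t x| <= (2 * nrm x)^-1 * L.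
    apply: (le_trans (costr_half_period t xd)); rewrite -nd /L -RintegralZl//.
    apply: le_Rintegral => //.
    - apply: (le_integrable _ _ _ (integrable_scale (nrm d) measurableT ikap)) => //.
        apply/measurable_EFinP; apply: measurableT_comp => //.
        by apply: measurable_funB => //; exact: (measurableT_comp mG).
      by move=> z _ /=; rewrite lee_fin normr_id (le_trans (lipG _ d1))// ler_norm.
    - exact: (integrable_scale (nrm d) measurableT ikap).
    - by move=> z _; exact: lipG.
  have sx : Num.sqrt (1 + nsq x) <= 3 * nrm x.
    rewrite -(@ler_pXn2r _ 2) ?nnegrE ?sqrtr_ge0 ?mulr_ge0 ?nrm_ge0//.
    rewrite sqr_sqrtr//.
    have -> : (3 * nrm x) ^+ 2 = 9 * nsq x by rewrite -sqr_nrm; ring.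
    have : (2^-1 : R) ^+ 2 <= nrm x ^+ 2 by rewrite ler_pXn2r ?nnegrE ?nrm_ge0.
    rewrite sqr_nrm; lra.
  apply: (@le_trans _ _ ((2 * nrm x)^-1 * L * (3 * nrm x))).
    by apply: ler_pM => //; exact: sqrtr_ge0.
  have -> : (2 * nrm x)^-1 * L * (3 * nrm x) = 3 / 2 * L by field; rewrite gt_eqF.
  lra.
have H : `|costr t x| <= I.
  apply: (le_trans (le_normr_Rintegral _ (integrable_costr t x))) => //.
  apply: le_Rintegral => //.
  - exact: (integrable_abse (integrable_costr t x)).
  - exact: (integrable_abse iG).
  - move=> z _; rewrite normrM ler_piMr//.
    by rewrite ler_norml cos_geN1 cos_le1.
have sx : Num.sqrt (1 + nsq x) <= 2.
  rewrite -(@ler_pXn2r _ 2) ?nnegrE ?sqrtr_ge0// sqr_sqrtr//.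
  have : nrm x ^+ 2 <= (2^-1 : R) ^+ 2 by rewrite ler_pXn2r ?nnegrE ?nrm_ge0// ltW.
  rewrite sqr_nrm; lra.
apply: (@le_trans _ _ (I * 2)); first by apply: ler_pM => //; exact: sqrtr_ge0.
lra.
Qed.

Lemma inv_fourier_real (c : R[i]) x :
  inv_fourier (fun z => c * (G z)%:C%C) x = c * (costr 0 x +i* costr (- (pi / 2)) x)%C.
Proof.
have sinE y : sin y = cos (y - pi / 2) :> R by rewrite cosBpihalf.
have ic := integrable_costr 0 x; have isn := integrable_costr (- (pi / 2)) x.
case: c => p q; rewrite /inv_fourier /cintegral; simpc; congr (_ +i* _)%C.
  transitivity (\int[nu]_z (p * (G z * cos (2 * pi * dot2 x z + 0)) -
      q * (G z * cos (2 * pi * dot2 x z - pi / 2)))).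
    apply: eq_Rintegral => z _; rewrite /cis; simpc => /=.
    by rewrite ?addr0 sinE; ring.
  rewrite RintegralB//; [|exact: integrable_scale|exact: integrable_scale].
  by rewrite !RintegralZl.
transitivity (\int[nu]_z (p * (G z * cos (2 * pi * dot2 x z - pi / 2)) +
    q * (G z * cos (2 * pi * dot2 x z + 0)))).
  apply: eq_Rintegral => z _; rewrite /cis; simpc => /=.
  by rewrite ?addr0 sinE; ring.
rewrite RintegralD//; [|exact: integrable_scale|exact: integrable_scale].
by rewrite !RintegralZl.
Qed.

End fixed.
End CosineTransform.

(** * Lipschitz bounds and inverse Fourier formulas for mixtures *)

Section MixtureTools.
Context {R : realType}.
Local Notation mu := (@lebesgue_measure R).
Local Notation nu := (@leb2 R).
Local Notation plane := (measurableTypeR R * measurableTypeR R)%type.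
Implicit Types (k n : nat) (z w d : plane).

Lemma normcM_real (X : R[i]) (m : R) : 0 <= m ->
  Normc.normc (X * m%:C%C) = Normc.normc X * m.
Proof.
move=> m0; case: X => x y; simpc; rewrite /Normc.normc/= !exprMn -mulrDl.
by rewrite sqrtrM ?addr_ge0 ?sqr_ge0// sqrtr_sqr ger0_norm.
Qed.

Lemma normc_toCX k z : Normc.normc (toC z ^+ k) = nrm z ^+ k.
Proof.
elim: k => [|k IH]; first by rewrite !expr0 /Normc.normc /= expr1n expr0n addr0 sqrtr1.
by rewrite !exprS Normc.normcM IH.
Qed.

Section mass.
Variables (b a : R -> R).
Hypotheses (mb : measurable_fun setT b) (ma : measurable_fun setT a).
Hypothesis b0 : forall s, 0 <= b s.
Variables (alpha K : R).
Hypothesis alpha0 : 0 < alpha.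
Hypothesis a_ge : forall s, b s != 0 -> alpha <= a s.
Hypothesis bK : (\int[mu]_s (b s)%:E <= K%:E)%E.

Lemma mix_mass_ge0 : 0 <= K.
Proof.
rewrite -lee_fin; apply: le_trans bK; apply: integral_ge0 => s _.
by rewrite lee_fin.
Qed.

Lemma mix_mass_le n z : (\int[mu]_s (nrm z ^+ n * (b s * gauss2 (a s) z))%:E <=
  (K * (nrm z ^+ n * gauss2 alpha z))%:E)%E.
Proof.
pose c := nrm z ^+ n * gauss2 alpha z.
have c0 : 0 <= c by rewrite mulr_ge0 ?exprn_ge0 ?nrm_ge0 ?gauss2_ge0.
apply: (@le_trans _ _ (\int[mu]_s (c%:E * (b s)%:E))%E).
  apply: ge0_le_integral => //.
  - by move=> s _; rewrite lee_fin !mulr_ge0 ?exprn_ge0 ?nrm_ge0 ?gauss2_ge0.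
  - apply/measurable_EFinP; apply: measurable_funM => //; apply: measurable_funM => //.
    apply: (measurableT_comp (@measurable_expR R)); apply: measurable_funN.
    by apply: measurable_funM => //; exact: measurable_funM.
  - by apply: measurable_funeM; exact/measurable_EFinP.
  - move=> s _; rewrite lee_fin /c -mulrA ler_wpM2l ?exprn_ge0 ?nrm_ge0// mulrC.
    have [->|bs] := eqVneq (b s) 0; first by rewrite !mulr0.
    rewrite ler_wpM2r// ler_expR lerN2 ler_wpM2r ?nsq_ge0// ler_wpM2l ?pi_ge0//.
    exact: a_ge.
rewrite ge0_integralZl_EFin//; last 2 first.
- by move=> s _; rewrite lee_fin.
- exact/measurable_EFinP.
by rewrite -/c [leRHS]EFinM muleC lee_wpmul2r// lee_fin.
Qed.

Lemma mix_mass_integrable n :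
  nu.-integrable setT (EFin \o (fun z => K * (nrm z ^+ n * gauss2 alpha z))).
Proof. by apply: integrable_scale => //; exact: integrable_nrm_gauss. Qed.

Section lip.
Variables (k : nat) (beta : R).
Hypothesis a_le : forall s, b s != 0 -> a s <= beta.

Let phi (c t : R) := t ^+ k * expR (- (pi * c * t ^+ 2)).

Let M n := expR (pi * alpha) * (n`!%:R * (2 / (pi * alpha)) ^+ n) * expR (pi * alpha / 2).

Let M_ge0 n : 0 <= M n.
Proof.
have pa : 0 < pi * alpha by rewrite mulr_gt0// pi_gt0.
by rewrite !mulr_ge0 ?expR_ge0 ?exprn_ge0 ?divr_ge0// ltW.
Qed.

(** The mean value theorem evaluates at some [u] between two radii, while the Lipschitz majorant
    must depend on [x] alone. The power is absorbed at 1 + u^2 >= u, and x^2 <= 2 u^2 + 2 converts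
    decay in [u] into decay in [x] with parameter alpha / 4. *)
Let profile_le n (x u : R) : 0 <= x -> 0 <= u -> `|u - x| <= 1 ->
  u ^+ n * expR (- (pi * alpha * u ^+ 2)) <= M n * expR (- (pi * (alpha / 4) * x ^+ 2)).
Proof.
move=> x0 u0 ux; have pa : 0 < pi * alpha by rewrite mulr_gt0// pi_gt0.
have T0 : 0 <= 1 + u ^+ 2 by rewrite addr_ge0 ?sqr_ge0.
have uT : u <= 1 + u ^+ 2 by nra.
have H := @exprn_expRN_le R n (pi * alpha) _ pa T0.
apply: (@le_trans _ _ (expR (pi * alpha) * ((1 + u ^+ 2) ^+ n * expR (- (pi * alpha * (1 + u ^+ 2)))))).
  rewrite [leRHS]mulrCA -expRD; have -> : pi * alpha - pi * alpha * (1 + u ^+ 2) = - (pi * alpha * u ^+ 2) by ring.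
  by rewrite ler_wpM2r ?expR_ge0// lerXn2r ?nnegrE.
have -> : M n * expR (- (pi * (alpha / 4) * x ^+ 2)) = expR (pi * alpha) *
    (n`!%:R * (2 / (pi * alpha)) ^+ n * (expR (pi * alpha / 2) * expR (- (pi * (alpha / 4) * x ^+ 2)))).
  by rewrite /M !mulrA.
rewrite ler_wpM2l ?expR_ge0//; apply: (le_trans H).
rewrite ler_wpM2l ?mulr_ge0 ?exprn_ge0 ?divr_ge0 ?(ltW pa)//.
rewrite -expRD ler_expR.
have xu : x ^+ 2 <= 2 * u ^+ 2 + 2.
  move: ux; rewrite ler_norml => /andP[l r].
  have : x <= u + 1 by lra.
  move=> xu; have : x ^+ 2 <= (u + 1) ^+ 2 by rewrite lerXn2r ?nnegrE ?addr_ge0.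
  by have := sqr_ge0 (u - 1); nra.
rewrite -subr_ge0.
have -> : pi * alpha / 2 - pi * (alpha / 4) * x ^+ 2 - - (pi * alpha / 2 * (1 + u ^+ 2)) =
  (pi * alpha) / 4 * (2 * u ^+ 2 + 4 - x ^+ 2) by field.
by rewrite mulr_ge0 ?divr_ge0 ?(ltW pa)// subr_ge0; lra.
Qed.

(** Mean value theorem, the derivative of the profile being bounded uniformly over the widths in
    [alpha, beta]. *)
Lemma gauss_profile_lip : exists2 L : R, 0 <= L & forall c x y : R, alpha <= c <= beta ->
  0 <= x -> 0 <= y -> `|y - x| <= 1 ->
  `|phi c y - phi c x| <= `|y - x| * (L * expR (- (pi * (alpha / 4) * x ^+ 2))).
Proof.
have dphi c (t : R) : is_derive t (1 : R) (phi c)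
    ((k%:R * t ^+ k.-1 - 2 * pi * c * t ^+ k.+1) * expR (- (pi * c * t ^+ 2))).
  have d1 : is_derive t (1 : R) (fun t : R => t ^+ k) (k%:R * t ^+ k.-1).
    case: (k) => [|m]; last exact: is_derive_exprn.
    by rewrite mul0r; exact: (is_derive_cst (1 : R)).
  have d2 : is_derive t (1 : R) (fun t : R => - (pi * c * t ^+ 2)) (- (pi * c * (2 * t))).
    by apply: is_derive_eq; rewrite /GRing.scale /=; ring.
  have d3 := @is_derive1_comp _ (@expR R) (fun t : R => - (pi * c * t ^+ 2)) t _ _ (is_derive_expR _) d2.
  have d4 := is_deriveM d1 d3.
  apply: (is_derive_eq d4); rewrite /GRing.scale /= (exprS t k); move: (t ^+ k.-1) (t ^+ k) (expR _) => A B E; ring.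
exists (k%:R * M k.-1 + 2 * pi * `|beta| * M k.+1).
  apply: addr_ge0; first exact: mulr_ge0 (ler0n _ _) (M_ge0 _).
  by apply: mulr_ge0 (M_ge0 _); rewrite !mulr_ge0 ?pi_ge0.
have main c (x u : R) : alpha <= c <= beta -> 0 <= x -> 0 <= u -> `|u - x| <= 1 ->
  `|(k%:R * u ^+ k.-1 - 2 * pi * c * u ^+ k.+1) * expR (- (pi * c * u ^+ 2))| <=
  (k%:R * M k.-1 + 2 * pi * `|beta| * M k.+1) * expR (- (pi * (alpha / 4) * x ^+ 2)).
  move=> /andP[ac cb] x0 u0 ux; have c0 : 0 <= c by rewrite (le_trans _ ac)// ltW.
  rewrite normrM (ger0_norm (expR_ge0 _)).
  apply: (@le_trans _ _ ((k%:R * u ^+ k.-1 + 2 * pi * `|beta| * u ^+ k.+1) * expR (- (pi * alpha * u ^+ 2)))).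
    apply: ler_pM; rewrite ?expR_ge0//.
      apply: (le_trans (ler_normB _ _)).
      rewrite !normrM ?normrX (ger0_norm u0) (ger0_norm (pi_ge0 R)) normr_nat (ger0_norm c0) ger0_norm//.
      rewrite lerD2l ler_wpM2r ?exprn_ge0// ler_wpM2l ?mulr_ge0 ?pi_ge0//.
      exact: le_trans cb (ler_norm _).
    by rewrite ler_expR lerN2 ler_wpM2r ?sqr_ge0// ler_wpM2l ?pi_ge0.
  have := profile_le k.-1 x0 u0 ux; have := profile_le k.+1 x0 u0 ux.
  have : 0 <= 2 * pi * `|beta| by rewrite !mulr_ge0 ?pi_ge0.
  move: (2 * pi * `|beta|) (M k.-1) (M k.+1) (u ^+ k.-1) (u ^+ k.+1) (expR _) (expR _).
  move=> X M1 M2 u1 u2 e1 e2 X0 H2 H1; rewrite 2!(mulrDl _ (X * _)) -!mulrA; apply: lerD.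
    by rewrite ler_wpM2l.
  by rewrite ler_wpM2l.
move=> c x y cab x0 y0 xy.
have cphi (p q : R) : {within `[p, q], continuous (phi c)}.
  by apply: continuous_subspaceT => t; exact: (is_derive_continuous (dphi c)).
have [lexy|/ltW leyx] := leP x y.
  have [u + ->] := MVT_segment lexy (fun t _ => dphi c t) (cphi x y).
  rewrite in_itv/= => /andP[xu uy]; rewrite normrM mulrC ler_wpM2l//.
  apply: main => //; first exact: le_trans xu.
  by rewrite ger0_norm ?subr_ge0//; move: xy; rewrite ger0_norm ?subr_ge0//; lra.
have [u + E] := MVT_segment leyx (fun t _ => dphi c t) (cphi y x).
rewrite distrC E in_itv/= => /andP[yu ux]; rewrite normrM mulrC distrC ler_wpM2l//.
apply: main => //; first exact: le_trans yu.
by rewrite distrC ger0_norm ?subr_ge0//; move: xy; rewrite distrC ger0_norm ?subr_ge0//; lra.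
Qed.

(** Each |z|^k times a Gaussian depends on |z| only, and |z + d| differs from |z| by at most |d|, so
    the radial estimate applies to each component; the finite mass sums them. *)
Lemma mix_lipschitz : exists kap : plane -> R,
  [/\ nu.-integrable setT (EFin \o kap), forall z, 0 <= kap z &
   forall d z, nrm d <= 1 ->
    `|nrm (z.1 + d.1, z.2 + d.2) ^+ k * mix b a (z.1 + d.1, z.2 + d.2) -
      nrm z ^+ k * mix b a z| <= nrm d * kap z].
Proof.
have [L L0 HL] := gauss_profile_lip.
exists (fun z => K * L * gauss2 (alpha / 4) z); split.
- by apply: integrable_scale => //; apply: integrable_gauss2; rewrite divr_gt0.
- by move=> z; rewrite !mulr_ge0 ?mix_mass_ge0 ?gauss2_ge0.
move=> d z d1; set zd := (_, _).
have ib w : mu.-integrable setT (EFin \o (fun s => nrm w ^+ k * (b s * gauss2 (a s) w))).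
  have H := mix_mass_le k w; apply/integrableP; split.
    apply/measurable_EFinP; apply: measurable_funM => //; apply: measurable_funM => //.
    apply: (measurableT_comp (@measurable_expR R)); apply: measurable_funN.
    by apply: measurable_funM => //; exact: measurable_funM.
  apply: le_lt_trans (ltry (K * (nrm w ^+ k * gauss2 alpha w))).
  apply: le_trans H; under eq_integral do rewrite gee0_abs ?lee_fin ?mulr_ge0 ?exprn_ge0 ?nrm_ge0 ?gauss2_ge0//.
  by [].
have mk w : measurable_fun setT (fun s : measurableTypeR R => b s * gauss2 (a s) w).
  apply: measurable_funM => //; apply: (measurableT_comp (@measurable_expR R)); apply: measurable_funN.
  by apply: measurable_funM => //; exact: measurable_funM.
have pE w s : nrm w ^+ k * (b s * gauss2 (a s) w) = b s * phi (a s) (nrm w).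
  by rewrite /phi mulrCA sqr_nrm.
rewrite -!ge0_RintegralZl//; try by move=> s; exact: mix_kernel_ge0.
rewrite -RintegralB//.
have iB := integrableB measurableT (ib zd) (ib z).
apply: (le_trans (le_normr_Rintegral _ iB)) => //.
pose c := nrm d * (L * gauss2 (alpha / 4) z).
have c0 : 0 <= c by rewrite !mulr_ge0 ?nrm_ge0 ?gauss2_ge0.
have ibb : mu.-integrable setT (EFin \o b).
  apply/integrableP; split; first exact/measurable_EFinP.
  under eq_integral do rewrite gee0_abs ?lee_fin//.
  exact: le_lt_trans bK (ltry _).
have -> : nrm d * (K * L * gauss2 (alpha / 4) z) = c * K by rewrite /c; ring.
apply: (@le_trans _ _ (\int[mu]_s (c * b s))).
  apply: le_Rintegral => //.
  - exact: (integrable_abse iB).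
  - exact: integrable_scale.
  move=> s _; rewrite !pE -mulrBr normrM ger0_norm// mulrC.
  have [->|bs] := eqVneq (b s) 0; first by rewrite !mulr0.
  rewrite ler_wpM2r//.
  have sh := nrm_shift_le z d; rewrite -/zd in sh.
  apply: (le_trans (HL _ _ _ _ _ _ _)); rewrite ?nrm_ge0 ?a_ge ?a_le//.
    exact: le_trans sh d1.
  by rewrite sqr_nrm /c ler_wpM2r// mulr_ge0// gauss2_ge0.
rewrite RintegralZl// ler_wpM2l// -lee_fin -ge0_integral_fineK//.
Qed.

End lip.
End mass.

Section complexmix.
Variables (b a : R -> R).
Hypotheses (mb : measurable_fun setT b) (ma : measurable_fun setT a).
Hypothesis b0 : forall s, 0 <= b s.
Hypothesis a0 : forall s, b s != 0 -> 0 < a s.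
Variables (k : nat) (Phi : plane -> R).
Hypothesis PhiP : forall z,
  (\int[mu]_s (nrm z ^+ k * (b s * gauss2 (a s) z))%:E <= (Phi z)%:E)%E.
Hypothesis intPhi : nu.-integrable setT (EFin \o Phi).

Let E (X : R[i]) (m : R) : X * m%:C%C = (complex.Re X * m +i* (complex.Im X * m))%C.
Proof. by case: X => x y; simpc. Qed.

(** [r] is the identity for a function of the class and the rotation w -> - i w for its Fourier
    transform. *)
Lemma cintegrable_mix (r : plane -> plane) : measurable_fun setT r ->
  (forall z, nrm (r z) = nrm z) ->
  cintegrable (fun z => toC (r z) ^+ k * (mix b a z)%:C%C).
Proof.
move=> mr rn; have [mre mim] := @measurable_zre_zim R k.
have zk u v z : zker k u v (0, 0) z = u * zre k z - v * zim k z.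
  by rewrite /zker /dot2 /= !mulr0 addr0 mulr0 cos0 sin0; ring.
have := @integrable_mix R b a mb ma b0 k Phi PhiP intPhi.
move=> I; split.
- have := I (fun z => zre k (r z)) (measurableT_comp mre mr).
  rewrite (_ : (fun z => _) = (EFin \o (fun z => zre k (r z) * mix b a z))); last first.
    by apply/funext => z; rewrite E.
  apply => z; rewrite -(rn z).
  have := @zker_le R k 1 0 (0, 0) (r z); rewrite expr1n expr0n addr0 => /(_ erefl).
  by rewrite zk mul1r mul0r subr0.
- have := I (fun z => zim k (r z)) (measurableT_comp mim mr).
  rewrite (_ : (fun z => _) = (EFin \o (fun z => zim k (r z) * mix b a z))); last first.
    by apply/funext => z; rewrite E.
  apply => z; rewrite -(rn z).
  have := @zker_le R k 0 1 (0, 0) (r z); rewrite expr1n expr0n add0r => /(_ erefl).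
  by rewrite zk mul0r mul1r sub0r normrN.
Qed.

(** The inverse transform of a conjugate is the conjugate of the transform, so this mirrors
    [fourier_mix]. *)
Lemma inv_fourier_conj_mix w :
  inv_fourier (fun z => (toC z ^+ k)^*%C * (mix b a z)%:C%C) w =
  ((- 'i%C * toC w) ^+ k * (mix (fun s => b s / a s ^+ k.+1) (fun s => (a s)^-1) w)%:C%C)^*%C.
Proof.
have d2C x y : dot2 x y = dot2 y x :> R by rewrite /dot2; ring.
have -> : - 'i%C * toC w = (w.2 +i* (- w.1))%C :> R[i].
  by rewrite /toC; case: w => x y; simpc.
rewrite [in RHS]E /inv_fourier /cintegral /=; congr (_ +i* _)%C.
  have := @Rintegral_zker_mix R b a mb ma b0 a0 k Phi PhiP intPhi 1 0 w.
  rewrite expr1n expr0n addr0 => /(_ erefl).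
  have -> : (1 +i* 0)%C = 1 :> R[i] by [].
  rewrite mul1r => <-; apply: eq_Rintegral => z _.
  rewrite E /cis d2C /zker /zre /zim; case: (toC z ^+ k) => x y /=; ring.
rewrite -mulNr.
have := @Rintegral_zker_mix R b a mb ma b0 a0 k Phi PhiP intPhi 0 1 w.
rewrite expr1n expr0n add0r => /(_ erefl).
have -> : complex.Re ((0 +i* 1)%C * (w.2 +i* - w.1)%C ^+ k) = - complex.Im ((w.2 +i* - w.1)%C ^+ k).
  by case: (_ ^+ k) => x y; simpc => /=; ring.
move=> <-; apply: eq_Rintegral => z _.
rewrite E /cis d2C /zker /zre /zim; case: (toC z ^+ k) => x y /=; ring.
Qed.

End complexmix.
End MixtureTools.

(** * The Riesz transform of a Gaussian *)

Section TestGaussian.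
Context {R : realType}.
Local Notation mu := (@lebesgue_measure R).
Local Notation nu := (@leb2 R).
Local Notation plane := (measurableTypeR R * measurableTypeR R)%type.
Implicit Types (k n : nat) (z w : plane).

Variables (m : nat).
Hypothesis m_even : ~~ odd m.
Let k := m.+1.
Let D : R := gmom m.
Let D0 : 0 < D. Proof. exact: gmom_gt0. Qed.

(* [|z|^-k = \int rieszb s * expR (- pi s^2 |z|^2) ds], so that [|z|^-k * gauss2 1]
   is the mixture [mix rieszb riesza]. *)
Definition rieszb (s : R) : R := s ^+ m / gmom m.
Definition riesza (s : R) : R := 1 + s ^+ 2.

Lemma measurable_rieszb : measurable_fun setT rieszb.
Proof. by apply: measurable_funM => //. Qed.

Lemma measurable_riesza : measurable_fun setT riesza.
Proof. by apply: measurable_funD => //. Qed.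

Lemma rieszb_ge0 s : 0 <= rieszb s.
Proof. by rewrite divr_ge0 ?exprn_even_ge0// ltW. Qed.

Lemma riesza_ge1 s : 1 <= riesza s.
Proof. by rewrite lerDl sqr_ge0. Qed.

Lemma riesza_gt0 s : 0 < riesza s.
Proof. by rewrite (lt_le_trans ltr01)// riesza_ge1. Qed.

Lemma integral_riesz z : nrm z != 0 ->
  (\int[mu]_s (nrm z ^+ k * (rieszb s * gauss2 (riesza s) z))%:E = (gauss2 1 z)%:E)%E.
Proof.
move=> z0; have r0 : 0 < nrm z by rewrite lt_def z0 nrm_ge0.
have H := @integral_gmom_scale R m (nrm z) m_even r0.
transitivity (\int[mu]_s ((gauss2 1 z / D)%:E *
    (nrm z ^+ k * (s ^+ m * expR (- (pi * s ^+ 2 * nrm z ^+ 2))))%:E))%E.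
  apply: eq_integral => s _; rewrite -EFinM; congr EFin.
  have -> : gauss2 (riesza s) z = gauss2 1 z * expR (- (pi * s ^+ 2 * nrm z ^+ 2)).
    by rewrite /gauss2 -expRD sqr_nrm /riesza; congr expR; ring.
  by rewrite /rieszb -/D; ring.
rewrite ge0_integralZl_EFin ?divr_ge0 ?gauss2_ge0 ?ltW//; last 2 first.
- move=> s _; rewrite lee_fin mulr_ge0 ?exprn_ge0 ?nrm_ge0//.
  by rewrite mulr_ge0 ?expR_ge0 ?exprn_even_ge0.
- apply/measurable_EFinP; apply: measurable_funM => //; apply: measurable_funM => //.
  apply: (measurableT_comp (@measurable_expR R)); apply: measurable_funN.
  by apply: measurable_funM => //; exact: measurable_funM.
by rewrite H -EFinM divfK// gt_eqF.
Qed.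

Lemma riesz_mix_le z :
  (\int[mu]_s (nrm z ^+ k * (rieszb s * gauss2 (riesza s) z))%:E <= (gauss2 1 z)%:E)%E.
Proof.
have [r0|r0] := eqVneq (nrm z) 0; last by rewrite integral_riesz.
under eq_integral do rewrite r0 exprS !mul0r.
by rewrite integral0 lee_fin gauss2_ge0.
Qed.

Lemma nrm_mix_riesz z : nrm z != 0 -> nrm z ^+ k * mix rieszb riesza z = gauss2 1 z.
Proof.
move=> z0; rewrite -ge0_RintegralZl.
- by rewrite /Rintegral integral_riesz.
- apply: measurable_funM; first exact: measurable_rieszb.
  apply: (measurableT_comp (@measurable_expR R)); apply: measurable_funN.
  apply: measurable_funM => //; apply: measurable_funM => //; exact: measurable_riesza.
- by move=> s; rewrite mulr_ge0 ?gauss2_ge0 ?rieszb_ge0.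
Qed.

Let h z : R[i] := (gauss2 1 z)%:C%C.

Lemma fourier_gauss2 : fourier h = h.
Proof.
apply/funext => w; rewrite /fourier /cintegral /h; congr (_ +i* _)%C.
  transitivity (\int[nu]_z (gauss2 1 z * cos (2 * pi * dot2 z w + 0))).
    by apply: eq_Rintegral => z _; rewrite /cis; simpc => /=; rewrite cosN ?addr0.
  by rewrite Rintegral_gauss2_cos// cos0 divr1 mul1r invr1.
transitivity (\int[nu]_z (gauss2 1 z * cos (2 * pi * dot2 z w + pi / 2))).
  by apply: eq_Rintegral => z _; rewrite /cis; simpc => /=; rewrite sinN cosDpihalf.
by rewrite Rintegral_gauss2_cos// cos_pihalf !mul0r.
Qed.

Lemma fourier_class_gauss2 : fourier_class h.
Proof.
have : cintegrable h.
  split; rewrite /h /=; first exact: integrable_gauss2.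
  exact: integrable0.
by move=> H; split => //; rewrite fourier_gauss2.
Qed.

Lemma cmeasurable_gauss2 : cmeasurable h.
Proof. by split => //=; exact: measurable_gauss2. Qed.

Lemma normC_toC z : `|toC z| = (nrm z)%:C%C.
Proof. by []. Qed.

Lemma criesz_symbolX n z : criesz_symbol z ^+ n = (toC z ^+ n)^*%C * ((nrm z ^+ n)^-1)%:C%C.
Proof.
rewrite /criesz_symbol normC_toC expr_div_n rmorphXn; congr (_ * _).
by rewrite fmorphV rmorphXn.
Qed.

(** Weight that the Fourier transform produces from [rieszb] and [riesza]; unlike [rieszb], it has
    finite mass. *)
Definition rieszb' (s : R) : R := rieszb s / riesza s ^+ k.+1.
Definition riesza' (s : R) : R := (riesza s)^-1.

Lemma measurable_rieszb' : measurable_fun setT rieszb'.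
Proof.
apply: measurable_funM; first exact: measurable_rieszb.
apply: (measurableT_comp (@measurable_inv R)); apply: measurable_funX.
exact: measurable_riesza.
Qed.

Lemma measurable_riesza' : measurable_fun setT riesza'.
Proof. by apply: (measurableT_comp (@measurable_inv R)); exact: measurable_riesza. Qed.

Lemma rieszb'_ge0 s : 0 <= rieszb' s.
Proof. by rewrite divr_ge0 ?rieszb_ge0// exprn_ge0// ltW ?riesza_gt0. Qed.

Lemma riesza'_gt0 s : 0 < riesza' s.
Proof. by rewrite invr_gt0 riesza_gt0. Qed.

Definition riesz_gauss w : R[i] :=
  ((- 'i%C * toC w) ^+ k * (mix rieszb' riesza' w)%:C%C)^*%C.

(** Off the origin |z|^(-k) times the Gaussian is [mix rieszb riesza], so the symbol turns the
    Gaussian into conj(z)^k times a mixture. *)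
Lemma fourier_multiplier_gauss2 :
  fourier_multiplier (fun xi => criesz_symbol xi ^+ k) h = riesz_gauss.
Proof.
apply/funext => w; rewrite /fourier_multiplier /riesz_gauss fourier_gauss2.
rewrite -(@inv_fourier_conj_mix R rieszb riesza measurable_rieszb measurable_riesza
  rieszb_ge0 (fun s _ => riesza_gt0 s) k (gauss2 1) riesz_mix_le (integrable_gauss2 ltr01)).
congr (inv_fourier _ w); apply/funext => z; rewrite criesz_symbolX /h.
(* At the origin |z|^k is not invertible, but both sides vanish because k > 0. *)
have [r0|r0] := eqVneq (nrm z) 0.
  have -> : toC z = 0 by apply/eqP; rewrite -normr_eq0 normC_toC r0.
  by rewrite /k exprS mul0r rmorph0 !mul0r.
rewrite -(nrm_mix_riesz r0) -mulrA -rmorphM/=; congr (_ * _%:C%C).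
by rewrite mulKf// expf_neq0.
Qed.

Lemma normc_riesz_gauss w : Normc.normc (riesz_gauss w) = nrm w ^+ k * mix rieszb' riesza' w.
Proof.
have NJ (X : R[i]) : Normc.normc (X^*%C) = Normc.normc X.
  by case: X => x y; rewrite /Normc.normc /= sqrrN.
rewrite /riesz_gauss NJ normcM_real; last first.
  by apply: mix_ge0; exact: rieszb'_ge0.
have -> : - 'i%C * toC w = toC (w.2, - w.1) by rewrite /toC; case: w => x y; simpc.
rewrite normc_toCX; congr (_ ^+ _ * _).
by rewrite /nrm /nsq /= sqrrN addrC.
Qed.

Lemma cmeasurable_riesz_gauss : cmeasurable riesz_gauss.
Proof.
have E (X : R[i]) (x : R) : (X * x%:C%C)^*%C = (complex.Re X * x +i* - (complex.Im X * x))%C.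
  by case: X => p q; simpc.
have rE w : - 'i%C * toC w = toC (w.2, - w.1) by rewrite /toC; case: w => x y; simpc.
have mr : measurable_fun setT (fun w : plane => (w.2, - w.1) : plane).
  by apply/measurable_fun_pairP; split; [exact: measurable_snd|apply: measurable_funN; exact: measurable_fst].
have mm : measurable_fun setT (mix rieszb' riesza').
  by apply: measurable_mix; [exact: measurable_rieszb'|exact: measurable_riesza'|exact: rieszb'_ge0].
have [mre mim] := @measurable_zre_zim R k.
split; rewrite /riesz_gauss.
  rewrite (_ : (fun z => _) = (fun z => zre k (z.2, - z.1) * mix rieszb' riesza' z)); last first.
    by apply/funext => z; rewrite E rE.
  by apply: measurable_funM => //; exact: (measurableT_comp mre mr).
rewrite (_ : (fun z => _) = (fun z => - (zim k (z.2, - z.1) * mix rieszb' riesza' z))); last first.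
  by apply/funext => z; rewrite E rE.
by apply: measurable_funN; apply: measurable_funM => //; exact: (measurableT_comp mim mr).
Qed.

Lemma rieszb'_mass : exists K, (\int[mu]_s (rieszb' s)%:E <= K%:E)%E.
Proof.
have H : (\int[mu]_x ((1 + x ^+ 2) `^ (- 1))%:E < +oo)%E.
  by apply: integral_japanese_lty; lra.
exists (D^-1 * fine (\int[mu]_x ((1 + x ^+ 2) `^ (- 1))%:E)).
have I0 : (0 <= \int[mu]_x ((1 + x ^+ 2) `^ (- 1))%:E)%E.
  by apply: integral_ge0 => x _; rewrite lee_fin powR_ge0.
rewrite EFinM fineK ?ge0_fin_numE//.
have mp : measurable_fun setT (fun x : R => ((1 + x ^+ 2) `^ (- 1))%:E).
  by apply/measurable_EFinP; apply: continuous_measurable_fun; exact: continuous_japanese.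
rewrite -ge0_integralZl_EFin//; last 2 first.
- by move=> x _; rewrite lee_fin powR_ge0.
- by rewrite invr_ge0 ltW.
apply: ge0_le_integral => //.
- by move=> s _; rewrite lee_fin rieszb'_ge0.
- by apply/measurable_EFinP; exact: measurable_rieszb'.
- exact: measurable_funeM.
move=> s _; rewrite lee_fin powR_inv1 ?(ltW (riesza_gt0 s))// -/(riesza s).
rewrite /rieszb' /rieszb -/D mulrAC mulrC ler_wpM2l ?invr_ge0 ?(ltW D0)//.
rewrite ler_pdivrMr ?exprn_gt0 ?riesza_gt0// exprS mulKf ?gt_eqF ?riesza_gt0//.
have : s ^+ m <= riesza s ^+ m.
  apply: (le_trans (ler_norm _)); rewrite normrX; apply: lerXn2r; rewrite ?nnegrE ?(ltW (riesza_gt0 s))//.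
  by rewrite /riesza -real_normK ?num_real//; have := normr_ge0 s; nra.
move/le_trans; apply; rewrite /k exprS ler_peMl ?riesza_ge1//.
by rewrite exprn_ge0// ltW// riesza_gt0.
Qed.

(** Put v = 1 + s^2 and y = |z|^2 / v. As s^m <= v^(m/2), the left side is at most v^(-3/2) y^(k/2)
    exp(-pi y) / D. As 1 + |z|^2 <= v (1 + y), extracting (1 + |z|^2)^(-N) costs v^N and at most one
    factor 1 + y; the Gaussian in y then bounds (1 + y)^(m/2 + 2). *)
Lemma riesz_kernel_le (N : R) s z : 0 <= N <= 1 ->
  nrm z ^+ k * (rieszb' s * gauss2 (riesza' s) z) <=
  (1 + nsq z) `^ (- N) *
    ((expR pi * ((m./2.+2)`!%:R * (2 / pi) ^+ m./2.+2) / D) * (1 + s ^+ 2) `^ (- (3 / 2 - N))).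
Proof.
move=> /andP[N0 N1]; set j := m./2; have mj : m = j.*2 by rewrite even_halfK.
have v1 := riesza_ge1 s; have v0 := riesza_gt0 s; have p0 := pi_gt0 R.
rewrite /rieszb' /riesza' /rieszb -/(riesza s) -/D.
have s2 : s ^+ m <= riesza s ^+ j.
  rewrite mj -mul2n exprM; apply: lerXn2r; rewrite ?nnegrE ?sqr_ge0 ?(ltW v0)//.
  by rewrite /riesza lerDr.
move: (riesza s) v1 v0 s2 => v v1 v0 s2.
pose y := nsq z / v; have y0 : 0 <= y by rewrite divr_ge0 ?nsq_ge0 ?ltW.
have zE : nsq z = v * y by rewrite /y mulrCA divff ?mulr1 ?gt_eqF.
have n1 : 0 <= 1 + nsq z by exact: addr_ge0 ler01 (nsq_ge0 z).
have nE : nrm z = Num.sqrt v * Num.sqrt y by rewrite /nrm zE sqrtrM ?ltW.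
clearbody y; have sv : Num.sqrt v = v `^ 2^-1 by rewrite powR12_sqrt ?ltW.
have sy : Num.sqrt y <= 1 + y.
  rewrite -(@ler_pXn2r _ 2) ?nnegrE ?sqrtr_ge0 ?addr_ge0// sqr_sqrtr//; nra.
have kE : nrm z ^+ k = v ^+ j * y ^+ j * (Num.sqrt v * Num.sqrt y).
  by rewrite /k mj exprSr -mul2n exprM sqr_nrm zE exprMn -nE.
have JN : (1 + nsq z) `^ N <= v `^ N * (1 + y).
  apply: (@le_trans _ _ ((v * (1 + y)) `^ N)).
    by apply: ler_powRl => //; rewrite ?zE; nra.
  rewrite powRM ?addr_ge0 ?(ltW v0)// ler_wpM2l ?powR_ge0//.
  rewrite -[leRHS]powRr1 ?addr_ge0//; apply: ler_powR => //; by rewrite lerDl.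
have P0 : 0 <= (j.+2)`!%:R * (2 / pi : R) ^+ j.+2.
  by apply: mulr_ge0 => //; apply: exprn_ge0; rewrite divr_ge0// ltW.
have EN : (1 + y) ^+ j.+2 * expR (- (pi * y)) <= expR pi * ((j.+2)`!%:R * (2 / pi) ^+ j.+2).
  have T0 : 0 <= 1 + y by rewrite addr_ge0.
  have := @exprn_expRN_le R j.+2 pi _ p0 T0.
  have -> : expR (- (pi * y)) = expR pi * expR (- (pi * (1 + y))).
    by rewrite -expRD; congr expR; ring.
  move=> H; rewrite mulrCA ler_wpM2l ?expR_ge0//; apply: (le_trans H).
  rewrite -[leRHS]mulr1 ler_wpM2l//.
  by rewrite -[leRHS]expR0 ler_expR oppr_le0 mulr_ge0// divr_ge0// ltW.
have gE : gauss2 v^-1 z = expR (- (pi * y)).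
  by rewrite /gauss2 zE; congr expR; field; rewrite gt_eqF.
have vE : v `^ (- (3 / 2 - N)) = v `^ N * (v `^ 2^-1 / v ^+ 2).
  have v2 : v `^ (- 2) = (v ^+ 2)^-1 by rewrite powRN powR_mulrn ?ltW.
  rewrite -v2 -powRD; last by apply/implyP => _; rewrite gt_eqF.
  rewrite -powRD; last by apply/implyP => _; rewrite gt_eqF.
  by congr (_ `^ _); field.
have J0 : 0 < (1 + nsq z) `^ N by rewrite powR_gt0// ltr_wpDr ?nsq_ge0.
rewrite powRN [leRHS]mulrC ler_pdivlMr// gE vE kE -sv.
apply: (@le_trans _ _ (v ^+ j * y ^+ j * (Num.sqrt v * (1 + y)) *
   (v ^+ j / D / v ^+ k.+1 * expR (- (pi * y))) * (v `^ N * (1 + y)))).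
  have vD : 0 <= v ^+ j / D by rewrite divr_ge0 ?exprn_ge0 ?ltW.
  apply: ler_pM => //; rewrite ?powR_ge0//.
  - apply: mulr_ge0; first by rewrite !mulr_ge0 ?exprn_ge0 ?sqrtr_ge0 ?(ltW v0).
    apply: mulr_ge0 (expR_ge0 _); apply: divr_ge0; last by rewrite exprn_ge0 ?ltW.
    by rewrite divr_ge0 ?exprn_even_ge0 ?ltW.
  apply: ler_pM => //.
  - by rewrite !mulr_ge0 ?exprn_ge0 ?sqrtr_ge0 ?(ltW v0).
  - apply: mulr_ge0 (expR_ge0 _); apply: divr_ge0; last by rewrite exprn_ge0 ?ltW.
    by rewrite divr_ge0 ?exprn_even_ge0 ?ltW.
  - by rewrite !ler_wpM2l ?mulr_ge0 ?exprn_ge0 ?sqrtr_ge0 ?(ltW v0).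
  - rewrite ler_wpM2r ?expR_ge0// ler_wpM2r ?invr_ge0 ?exprn_ge0 ?(ltW v0)//.
    by rewrite ler_wpM2r ?invr_ge0 ?(ltW D0).
have vk : v ^+ k.+1 = v ^+ j * v ^+ j * v ^+ 2.
  by rewrite -!exprD /k mj -addnn addn2.
have -> : v ^+ j * y ^+ j * (Num.sqrt v * (1 + y)) *
   (v ^+ j / D / v ^+ k.+1 * expR (- (pi * y))) * (v `^ N * (1 + y)) =
   (y ^+ j * (1 + y) ^+ 2 * expR (- (pi * y))) / D * (v `^ N * (Num.sqrt v / v ^+ 2)).
  rewrite vk; move: (v `^ N) (Num.sqrt v) (expR _) => V1 V2 e.
  have vn0 : v != 0 by rewrite gt_eqF.
  have Dn0 : D != 0 by rewrite gt_eqF.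
  have := expf_neq0 j vn0; move: (v ^+ j) (y ^+ j) D Dn0 => vj yj D' Dn0 vj0.
  by field; rewrite ?vj0 ?vn0 ?Dn0.
rewrite ler_wpM2r ?mulr_ge0 ?powR_ge0 ?sqrtr_ge0 ?invr_ge0 ?exprn_ge0 ?(ltW v0)//.
rewrite ler_wpM2r ?invr_ge0 ?(ltW D0)//; apply: le_trans EN.
rewrite ler_wpM2r ?expR_ge0// -[j.+2]addn2 exprD ler_wpM2r ?exprn_ge0 ?addr_ge0//.
by apply: lerXn2r; rewrite ?nnegrE ?addr_ge0// lerDr.
Qed.

(** The integral of (1 + s^2)^(-(3/2 - N)) left by [riesz_kernel_le] converges exactly when N <
    1. *)
Lemma riesz_gauss_decay (N : R) : 0 <= N < 1 -> exists C, forall z,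
  Normc.normc (riesz_gauss z) <= C * (1 + nsq z) `^ (- N).
Proof.
move=> /andP[N0 N1].
have mp : measurable_fun setT (fun x : R => ((1 + x ^+ 2) `^ (- (3 / 2 - N)))%:E).
  by apply/measurable_EFinP; apply: continuous_measurable_fun; exact: continuous_japanese.
have H : (\int[mu]_x ((1 + x ^+ 2) `^ (- (3 / 2 - N)))%:E < +oo)%E.
  by apply: integral_japanese_lty; lra.
have I0 : (0 <= \int[mu]_x ((1 + x ^+ 2) `^ (- (3 / 2 - N)))%:E)%E.
  by apply: integral_ge0 => x _; rewrite lee_fin powR_ge0.
set I := (\int[mu]_x _)%E in H I0.
pose A : R := expR pi * ((m./2.+2)`!%:R * (2 / pi) ^+ m./2.+2) / D.
have A0 : 0 <= A.
  apply: divr_ge0; last exact: ltW.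
  apply: mulr_ge0; first exact: expR_ge0.
  by apply: mulr_ge0 => //; apply: exprn_ge0; rewrite divr_ge0// pi_ge0.
have kle s z : nrm z ^+ k * (rieszb' s * gauss2 (riesza' s) z) <=
    (1 + nsq z) `^ (- N) * (A * (1 + s ^+ 2) `^ (- (3 / 2 - N))).
  by apply: riesz_kernel_le; rewrite N0 ltW.
clearbody A; exists (A * fine I) => z; rewrite normc_riesz_gauss.
apply: (@nrm_mix_le R rieszb' riesza' measurable_rieszb' measurable_riesza' rieszb'_ge0 k
  (fun z => A * fine I * (1 + nsq z) `^ (- N))) => w.
apply: (@le_trans _ _ (\int[mu]_s (((1 + nsq w) `^ (- N) * A)%:E * ((1 + s ^+ 2) `^ (- (3 / 2 - N)))%:E))%E).
  apply: ge0_le_integral => //.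
  - move=> s _; rewrite lee_fin mulr_ge0 ?exprn_ge0 ?nrm_ge0//.
    by apply: mix_kernel_ge0; exact: rieszb'_ge0.
  - apply/measurable_EFinP; apply: measurable_funM => //; apply: measurable_funM.
      exact: measurable_rieszb'.
    apply: (measurableT_comp (@measurable_expR R)); apply: measurable_funN.
    apply: measurable_funM => //; apply: measurable_funM => //; exact: measurable_riesza'.
  - exact: measurable_funeM.
  - move=> s _; rewrite -EFinM lee_fin -[leRHS]mulrA; exact: kle.
rewrite ge0_integralZl_EFin ?mulr_ge0 ?powR_ge0//; last first.
  by move=> s _; rewrite lee_fin powR_ge0.
rewrite -/I -(@fineK _ I) ?ge0_fin_numE// -EFinM lee_fin.
by rewrite /= mulrAC mulrC mulrA [leLHS]mulrC mulrA [X in X * _]mulrC.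
Qed.

Lemma gauss2D (c d : R) z : gauss2 (c + d) z = gauss2 c z * gauss2 d z.
Proof. by rewrite /gauss2 -expRD; congr expR; ring. Qed.

Lemma gauss2_mix (b a : R -> R) (c : R) z :
  measurable_fun setT b -> measurable_fun setT a -> (forall s, 0 <= b s) ->
  mix b (fun s => a s + c) z = gauss2 c z * mix b a z.
Proof.
move=> mb ma b0; rewrite -ge0_RintegralZl.
- by apply: eq_Rintegral => s _; rewrite gauss2D mulrA mulrC.
- apply: measurable_funM => //; apply: (measurableT_comp (@measurable_expR R)).
  by apply: measurable_funN; apply: measurable_funM => //; exact: measurable_funM.
- by move=> s; rewrite mulr_ge0 ?gauss2_ge0.
Qed.

Lemma Rintegral_nrm_gauss_sqrt n (c : R) : 0 < c ->
  \int[nu]_z (nrm z ^+ n * gauss2 c z) = gmom2 n / Num.sqrt c ^+ n.+2.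
Proof.
by move=> c0; rewrite -(@Rintegral_nrm_gauss R n (Num.sqrt c)) ?sqrtr_gt0// sqr_sqrtr// ltW.
Qed.

Lemma Rintegral_nrm_gauss2n n (c : R) : 0 < c ->
  \int[nu]_z (nrm z ^+ (n * 2) * gauss2 c z) = gmom2 (n * 2) / c ^+ n.+1.
Proof.
move=> c0; rewrite Rintegral_nrm_gauss_sqrt//; congr (_ / _).
by rewrite -[(n * 2).+2]/(n.+1 * 2)%N mulnC exprM sqr_sqrtr// ltW.
Qed.

Lemma riesz_gauss_pairing (c : R) : 0 < c ->
  \int[nu]_z (nrm z ^+ (k * 2) * mix rieszb' (fun s => riesza' s + c) z) =
  gmom2 k / (c ^+ k.+1 * Num.sqrt (1 + c^-1) ^+ k.+2).
Proof.
move=> c0; have [K HK] := rieszb'_mass.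
(* By Fubini the left side and [c^-k.+1 * \int |z|^(2k) gauss2 c^-1 * mix rieszb riesza]
   are both [gmom2 (2k) * \int rieszb s / (1 + c * riesza s)^k.+1 ds]; in the second
   integral, [|z|^k * mix rieszb riesza = gauss2 1]. *)
have mq : measurable_fun setT (fun z : plane => nrm z ^+ (k * 2)).
  by apply: measurable_funX; exact: measurable_nrm.
have qle z : `|nrm z ^+ (k * 2)| <= nrm z ^+ (k * 2).
  by rewrite ger0_norm// exprn_ge0// nrm_ge0.
have mac : measurable_fun setT (fun s => riesza' s + c).
  by apply: measurable_funD => //; exact: measurable_riesza'.
have ac0 s : rieszb' s != 0 -> 0 < riesza' s + c.
  by move=> _; rewrite addr_gt0 ?riesza'_gt0.
have acc s : rieszb' s != 0 -> c <= riesza' s + c.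
  by move=> _; rewrite lerDr ltW ?riesza'_gt0.
rewrite (@Rintegral_mix R rieszb' _ measurable_rieszb' mac rieszb'_ge0 ac0 (k * 2) _
  (mix_mass_le measurable_rieszb' mac rieszb'_ge0 acc HK (k * 2))
  (mix_mass_integrable K c0 (k * 2)) _ mq qle).
have mac1 : measurable_fun setT (fun s => riesza s + c^-1).
  by apply: measurable_funD => //; exact: measurable_riesza.
have ac1 s : rieszb s != 0 -> 0 < riesza s + c^-1.
  by move=> _; rewrite addr_gt0 ?riesza_gt0 ?invr_gt0.
have PhiP z : (\int[mu]_s (nrm z ^+ (k * 2) * (rieszb s * gauss2 (riesza s + c^-1) z))%:E <=
    (nrm z ^+ k * gauss2 (1 + c^-1) z)%:E)%E.
  rewrite (_ : (fun s => _) = (fun s => (nrm z ^+ k * gauss2 c^-1 z)%:E *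
     (nrm z ^+ k * (rieszb s * gauss2 (riesza s) z))%:E)%E); last first.
    apply/funext => s; rewrite -EFinM; congr EFin; rewrite gauss2D muln2 -addnn exprD.
    by move: (gauss2 _ z) (gauss2 _ z) => A B; ring.
  rewrite ge0_integralZl_EFin ?mulr_ge0 ?exprn_ge0 ?nrm_ge0 ?gauss2_ge0//; last 2 first.
  - move=> s _; rewrite lee_fin mulr_ge0 ?exprn_ge0 ?nrm_ge0//.
    by apply: mix_kernel_ge0; exact: rieszb_ge0.
  - apply/measurable_EFinP; apply: measurable_funM => //; apply: measurable_funM.
      exact: measurable_rieszb.
    apply: (measurableT_comp (@measurable_expR R)); apply: measurable_funN.
    apply: measurable_funM => //; apply: measurable_funM => //; exact: measurable_riesza.
  apply: (@le_trans _ _ ((nrm z ^+ k * gauss2 c^-1 z)%:E * (gauss2 1 z)%:E)%E).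
    by rewrite lee_wpmul2l ?lee_fin ?nrm_gauss_ge0//; exact: riesz_mix_le.
  by rewrite -EFinM lee_fin -mulrA -gauss2D addrC.
have c10 : 0 < 1 + c^-1 by rewrite addr_gt0 ?invr_gt0.
have := @Rintegral_mix R rieszb _ measurable_rieszb mac1 rieszb_ge0 ac1 (k * 2) _ PhiP
  (integrable_nrm_gauss k c10) _ mq qle.
have -> : \int[nu]_z (nrm z ^+ (k * 2) * mix rieszb (fun s => riesza s + c^-1) z) =
    gmom2 k / Num.sqrt (1 + c^-1) ^+ k.+2.
  rewrite -Rintegral_nrm_gauss_sqrt//; apply: eq_Rintegral => z _.
  rewrite gauss2_mix//; [|exact: measurable_rieszb|exact: measurable_riesza|exact: rieszb_ge0].
  have [->|z0] := eqVneq (nrm z) 0; first by rewrite [0 ^+ (k * 2)]exprS [0 ^+ k]exprS !mul0r.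
  by rewrite gauss2D -(nrm_mix_riesz z0) muln2 -addnn exprD; ring.
move=> H; apply: (mulfI (expf_neq0 k.+1 (lt0r_neq0 c0))).
rewrite invfM mulrCA mulVKf ?expf_neq0 ?gt_eqF// H.
rewrite -ge0_RintegralZl; last 2 first.
- apply: (measurable_funM measurable_rieszb').
  rewrite (_ : (fun s => _) = (fun s => gmom2 (k * 2) / (riesza' s + c) ^+ k.+1)).
    apply: measurable_funM => //; apply: (measurableT_comp (@measurable_inv R)).
    exact: measurable_funX.
  by apply/funext => s; rewrite Rintegral_nrm_gauss2n// addr_gt0 ?riesza'_gt0.
- move=> s; rewrite mulr_ge0 ?rieszb'_ge0//; apply: Rintegral_ge0 => z _.
  exact: nrm_gauss_ge0.
apply: eq_Rintegral => s _.
have A0 : 0 < riesza' s + c by rewrite addr_gt0 ?riesza'_gt0.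
have A1 : 0 < riesza s + c^-1 by rewrite (addr_gt0 (riesza_gt0 s)) ?invr_gt0.
rewrite !Rintegral_nrm_gauss2n//.
rewrite /rieszb' /riesza'; have := riesza_gt0 s; move: (riesza s) (rieszb s) => v b v0.
have -> : v^-1 + c = (1 + c * v) / v by field; rewrite gt_eqF.
have -> : v + c^-1 = (1 + c * v) / c by field; rewrite gt_eqF.
have cv : 0 < 1 + c * v by rewrite addr_gt0 ?mulr_gt0.
rewrite !expr_div_n.
have := expf_neq0 k.+1 (lt0r_neq0 cv); have := expf_neq0 k.+1 (lt0r_neq0 v0).
have := expf_neq0 k.+1 (lt0r_neq0 c0).
move: (c ^+ _) (v ^+ _) ((1 + _) ^+ _) (gmom2 _) => p q r g p0 q0 r0.
by field; rewrite ?p0 ?q0 ?r0.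
Qed.

End TestGaussian.

(** * The extremal mixtures *)

Section Bump.
Context {R : realType}.
Local Notation mu := (@lebesgue_measure R).
Local Notation nu := (@leb2 R).
Local Notation plane := (measurableTypeR R * measurableTypeR R)%type.
Implicit Types (k n : nat) (z w : plane) (s : R).

Lemma ge0_le_Rintegral_dom (f g : R -> R) :
  measurable_fun setT f -> (forall s, 0 <= f s <= g s) ->
  mu.-integrable setT (EFin \o g) ->
  mu.-integrable setT (EFin \o f) /\ \int[mu]_s f s <= \int[mu]_s g s.
Proof.
move=> mf fg ig.
have iF : mu.-integrable setT (EFin \o f).
  apply: le_integrable ig => //; first exact/measurable_EFinP.
  move=> s _ /=; have /andP[f0 fgs] := fg s.
  by rewrite lee_fin !ger0_norm// (le_trans f0).
split => //; apply: le_Rintegral => // s _; by have /andP[] := fg s.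
Qed.

Variables (m : nat) (w0 w1 lam : R).
Hypothesis m_even : ~~ odd m.
Hypotheses (w00 : 0 < w0) (w01 : w0 < w1) (lam0 : 0 < lam).
Let k := m.+1.
Let D : R := gmom m.
Let w10 : 0 < w1. Proof. exact: lt_trans w01. Qed.

Definition box s : R := \1_(`[w0, w1]%classic : set R) s.

Lemma measurable_box : measurable_fun setT box.
Proof. exact: measurable_indic. Qed.

Lemma boxP s : box s = (if w0 <= s <= w1 then 1 else 0).
Proof.
rewrite /box indicE; case: ifPn => H; first by rewrite mem_set//= in_itv.
by rewrite memNset//= in_itv; exact/negP.
Qed.

Lemma box_ge0 s : 0 <= box s.
Proof. by rewrite boxP; case: ifP. Qed.

Lemma integral_box : (\int[mu]_s (box s)%:E)%E = (w1 - w0)%:E.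
Proof.
rewrite integral_indic// setIT.
by have := lebesgue_measure_itv `[w0, w1]; rewrite /= lte_fin w01.
Qed.

Lemma box_mass_le (b : R -> R) M : measurable_fun setT b -> (forall s, 0 <= b s <= M * box s) ->
  0 <= M -> (\int[mu]_s (b s)%:E <= (M * (w1 - w0))%:E)%E.
Proof.
move=> mb bM M0; rewrite EFinM -integral_box -ge0_integralZl_EFin//; last 2 first.
- by move=> s _; rewrite lee_fin box_ge0.
- by apply/measurable_EFinP; exact: measurable_box.
apply: ge0_le_integral => //.
- by move=> s _; rewrite lee_fin; have /andP[] := bM s.
- exact/measurable_EFinP.
- by apply: measurable_funeM; apply/measurable_EFinP; exact: measurable_box.
- by move=> s _; rewrite lee_fin; have /andP[] := bM s.
Qed.

Lemma integral_box_inv : (\int[mu]_s (s^-1 * box s)%:E)%E = (ln w1 - ln w0)%:E.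
Proof.
transitivity (\int[mu]_(s in `[w0, w1]) (s^-1)%:E)%E.
  rewrite [RHS]integral_mkcond; apply: eq_integral => s _.
  by rewrite patchE boxP mem_setE in_itv; case: ifP; rewrite ?mulr1 ?mulr0.
rewrite (@continuous_FTC2 _ _ (@ln R))//.
- apply: continuous_in_subspaceT => s; rewrite mem_setE in_itv/= => /andP[ws _].
  by apply: inv_continuous; rewrite gt_eqF// (lt_le_trans w00).
- split.
  + move=> s; rewrite in_itv/= => /andP[ws _].
    by have := @is_derive1_ln R s (lt_trans w00 ws); case.
  + by apply: cvg_at_right_filter; exact: continuous_ln.
  + by apply: cvg_at_left_filter; exact: continuous_ln.
- move=> s; rewrite in_itv/= => /andP[ws _].
  by rewrite derive1E; have := @is_derive1_ln R s (lt_trans w00 ws); case.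
Qed.

Lemma measurable_box_inv : measurable_fun setT (fun s => s^-1 * box s).
Proof. by apply: measurable_funM; [exact: measurable_inv|exact: measurable_box]. Qed.

Lemma box_inv_ge0 s : 0 <= s^-1 * box s.
Proof.
rewrite boxP; case: ifP => [/andP[ws _]|]; last by rewrite mulr0.
by rewrite mulr1 invr_ge0 (le_trans (ltW w00)).
Qed.

Lemma integrable_box_inv : mu.-integrable setT (EFin \o (fun s => s^-1 * box s)).
Proof.
apply/integrableP; split; first by apply/measurable_EFinP; exact: measurable_box_inv.
under eq_integral do rewrite gee0_abs ?lee_fin ?box_inv_ge0//.
by rewrite integral_box_inv ltry.
Qed.

Lemma Rintegral_box_inv : \int[mu]_s (s^-1 * box s) = ln w1 - ln w0.
Proof. by rewrite /Rintegral integral_box_inv. Qed.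

Definition bump s : R := lam * s ^+ m * box s.
(* [fourier (z^k * mix bump s^2) = (- i w)^k * mix bump' s^-2]. *)
Definition bump' s : R := bump s / (s ^+ 2) ^+ k.+1.

Lemma bump_neq0 s : bump s != 0 -> w0 <= s <= w1.
Proof. by rewrite /bump boxP; case: ifP => //; rewrite mulr0 eqxx. Qed.

Lemma bump'_neq0 s : bump' s != 0 -> w0 <= s <= w1.
Proof. by move=> H; apply: bump_neq0; apply: contraNneq H; rewrite /bump' => ->; rewrite mul0r. Qed.

Lemma measurable_bump : measurable_fun setT bump.
Proof. by apply: measurable_funM; [exact: measurable_funM|exact: measurable_box]. Qed.

Lemma measurable_bump' : measurable_fun setT bump'.
Proof.
apply: measurable_funM; first exact: measurable_bump.
by apply: (measurableT_comp (@measurable_inv R)); apply: measurable_funX; exact: measurable_funX.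
Qed.

Lemma bump_ge0 s : 0 <= bump s.
Proof. by rewrite mulr_ge0 ?box_ge0// mulr_ge0 ?exprn_even_ge0// ltW. Qed.

Lemma bump'_ge0 s : 0 <= bump' s.
Proof. by rewrite divr_ge0 ?bump_ge0// exprn_ge0// sqr_ge0. Qed.

Lemma bump_le s : bump s <= lam * w1 ^+ m * box s.
Proof.
rewrite /bump boxP; case: ifP => [/andP[ws sw]|]; last by rewrite !mulr0.
rewrite !mulr1 ler_wpM2l ?(ltW lam0)//; apply: lerXn2r => //; rewrite nnegrE ltW//.
exact: lt_le_trans ws.
Qed.

Lemma bump_mass : (\int[mu]_s (bump s)%:E <= (lam * w1 ^+ m * (w1 - w0))%:E)%E.
Proof.
apply: box_mass_le; first exact: measurable_bump.
  by move=> s; rewrite bump_ge0 bump_le.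
by rewrite mulr_ge0 ?exprn_ge0 ?ltW.
Qed.

Lemma bump'_mass :
  (\int[mu]_s (bump' s)%:E <= (lam * w1 ^+ m / (w0 ^+ 2) ^+ k.+1 * (w1 - w0))%:E)%E.
Proof.
have M0 : 0 <= lam * w1 ^+ m / (w0 ^+ 2) ^+ k.+1.
  apply: divr_ge0; last by apply: exprn_ge0; exact: sqr_ge0.
  by apply: mulr_ge0; [exact: ltW|apply: exprn_ge0; exact: ltW].
apply: box_mass_le => //; first exact: measurable_bump'.
  move=> s; rewrite bump'_ge0 /=; have [->|b0] := eqVneq (bump' s) 0.
    by apply: mulr_ge0 => //; exact: box_ge0.
  have /andP[ws sw] := bump'_neq0 b0; rewrite /bump' [leRHS]mulrAC.
  have s0 : 0 < s by exact: lt_le_trans ws.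
  apply: ler_pM (bump_le s) _; first exact: bump_ge0.
    by rewrite invr_ge0 exprn_ge0// sqr_ge0.
  rewrite lef_pV2 ?posrE ?exprn_gt0//.
  by do 2 (apply: lerXn2r; rewrite ?nnegrE ?exprn_ge0 ?(ltW w00) ?(ltW s0)//).
Qed.

Let ma : measurable_fun setT (fun s : R => s ^+ 2). Proof. exact: measurable_funX. Qed.
Let ma' : measurable_fun setT (fun s : R => (s ^+ 2)^-1).
Proof. exact: (measurableT_comp (@measurable_inv R)). Qed.

Let a_ge s : bump s != 0 -> w0 ^+ 2 <= s ^+ 2.
Proof.
move=> /bump_neq0/andP[ws _]; apply: lerXn2r => //; rewrite nnegrE ltW//.
exact: lt_le_trans ws.
Qed.

Let a'_bd s : bump' s != 0 -> (w1 ^+ 2)^-1 <= (s ^+ 2)^-1 <= (w0 ^+ 2)^-1.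
Proof.
move=> /bump'_neq0/andP[ws sw]; have s0 : 0 < s by exact: lt_le_trans ws.
rewrite !lef_pV2 ?posrE ?exprn_gt0//.
by apply/andP; split; apply: lerXn2r; rewrite ?nnegrE ?(ltW s0) ?(ltW w00) ?(ltW w10).
Qed.

Let a'_ge s : bump' s != 0 -> (w1 ^+ 2)^-1 <= (s ^+ 2)^-1.
Proof. by move=> /a'_bd/andP[]. Qed.

Let a'_le s : bump' s != 0 -> (s ^+ 2)^-1 <= (w0 ^+ 2)^-1.
Proof. by move=> /a'_bd/andP[]. Qed.

Let w02 : 0 < w0 ^+ 2. Proof. by rewrite exprn_gt0. Qed.
Let w12 : 0 < (w1 ^+ 2)^-1. Proof. by rewrite invr_gt0 exprn_gt0. Qed.

Let a_gt0 s : bump s != 0 -> 0 < s ^+ 2.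
Proof. by move=> /a_ge; exact: lt_le_trans. Qed.

Definition fbump z : R[i] := toC z ^+ k * (mix bump (fun s => s ^+ 2) z)%:C%C.
(** Since conj(z)^k z^k / |z|^k = |z|^k, the symbol times the transform of [fbump] is, up to the
    constant (- i)^k, this real, nonnegative and radial function. *)
Definition Gbump z : R := nrm z ^+ k * mix bump' (fun s => (s ^+ 2)^-1) z.

Let PhiB := mix_mass_le measurable_bump ma bump_ge0 a_ge bump_mass.
Let intPhiB := mix_mass_integrable (lam * w1 ^+ m * (w1 - w0)) w02.
Let PhiB' := mix_mass_le measurable_bump' ma' bump'_ge0 a'_ge bump'_mass.
Let intPhiB' := mix_mass_integrable (lam * w1 ^+ m / (w0 ^+ 2) ^+ k.+1 * (w1 - w0)) w12.

Let mE w : - 'i%C * toC w = toC (w.2, - w.1) :> R[i].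
Proof. by rewrite /toC; case: w => x y; simpc. Qed.

Lemma fourier_fbump w : fourier fbump w =
  (- 'i%C * toC w) ^+ k * (mix bump' (fun s => (s ^+ 2)^-1) w)%:C%C.
Proof.
exact: (@fourier_mix R bump _ measurable_bump ma bump_ge0 a_gt0 k _ (PhiB k) (intPhiB k)).
Qed.

Lemma fourier_class_fbump : fourier_class fbump.
Proof.
split.
  by apply: (@cintegrable_mix R bump _ measurable_bump ma bump_ge0 k _ (PhiB k) (intPhiB k) id).
rewrite (_ : fourier fbump = (fun w => toC (w.2, - w.1) ^+ k *
    (mix bump' (fun s => (s ^+ 2)^-1) w)%:C%C)); last first.
  by apply/funext => w; rewrite fourier_fbump mE.
apply: (@cintegrable_mix R bump' _ measurable_bump' ma' bump'_ge0 k _ (PhiB' k) (intPhiB' k)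
  (fun w => (w.2, - w.1))).
  apply/measurable_fun_pairP.
  by split; [exact: measurable_snd|apply: measurable_funN; exact: measurable_fst].
by move=> w; rewrite /nrm /nsq /= sqrrN addrC.
Qed.

Lemma cmeasurable_fbump : cmeasurable fbump.
Proof.
have [[/integrableP[m1 _] /integrableP[m2 _]] _] := fourier_class_fbump.
by split; exact/measurable_EFinP.
Qed.

Lemma normc_fbump z : Normc.normc (fbump z) = nrm z ^+ k * mix bump (fun s => s ^+ 2) z.
Proof. by rewrite normcM_real ?normc_toCX// mix_ge0//; exact: bump_ge0. Qed.

Lemma normc_fbump_le z : Normc.normc (fbump z) <= lam * D.
Proof.
rewrite normc_fbump.
apply: (@nrm_mix_le R bump _ measurable_bump ma bump_ge0 k (cst (lam * D))) => w /=.
have [r0|r0] := eqVneq (nrm w) 0.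
  under eq_integral do rewrite r0 [0 ^+ k]exprS !mul0r.
  by rewrite integral0 lee_fin mulr_ge0 ?ltW// gmom_gt0.
have rp : 0 < nrm w by rewrite lt_def r0 nrm_ge0.
have H := @integral_gmom_scale R m (nrm w) m_even rp.
have mK : measurable_fun setT (fun s : R => (nrm w ^+ k * (s ^+ m * expR (- (pi * s ^+ 2 * nrm w ^+ 2))))%:E).
  apply/measurable_EFinP; apply: measurable_funM => //; apply: measurable_funM => //.
  apply: (measurableT_comp (@measurable_expR R)); apply: measurable_funN.
  by apply: measurable_funM => //; exact: measurable_funM.
have K0 (s : R) : 0 <= nrm w ^+ k * (s ^+ m * expR (- (pi * s ^+ 2 * nrm w ^+ 2))).
  by rewrite mulr_ge0 ?exprn_ge0 ?nrm_ge0// mulr_ge0 ?expR_ge0 ?exprn_even_ge0.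
rewrite EFinM /D -H -ge0_integralZl_EFin//; last 2 first.
- by move=> s _; rewrite lee_fin; exact: K0.
- exact: ltW.
apply: ge0_le_integral => //.
- by move=> s _; rewrite lee_fin mulr_ge0 ?exprn_ge0 ?nrm_ge0// mix_kernel_ge0//; exact: bump_ge0.
- apply/measurable_EFinP; apply: measurable_funM => //; apply: measurable_funM; first exact: measurable_bump.
  apply: (measurableT_comp (@measurable_expR R)); apply: measurable_funN.
  by apply: measurable_funM => //; exact: measurable_funM.
- exact: measurable_funeM.
move=> s _; rewrite -EFinM lee_fin /gauss2 -sqr_nrm [leRHS]mulrCA -/k.
rewrite ler_wpM2l ?exprn_ge0 ?nrm_ge0// [leRHS]mulrA ler_wpM2r ?expR_ge0//.
rewrite /bump boxP; case: ifP => _; first by rewrite mulr1.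
by rewrite mulr0 mulr_ge0 ?exprn_even_ge0// ltW.
Qed.

Lemma integrable_normc_fbump : nu.-integrable setT (EFin \o (fun z => Normc.normc (fbump z))).
Proof.
rewrite (_ : (fun z => _) = (fun z => nrm z ^+ k * mix bump (fun s => s ^+ 2) z)); last first.
  by apply/funext => z; rewrite normc_fbump.
apply: (@integrable_mix R bump _ measurable_bump ma bump_ge0 k _ (PhiB k) (intPhiB k)).
  by apply: measurable_funX; exact: measurable_nrm.
by move=> z; rewrite ger0_norm// exprn_ge0// nrm_ge0.
Qed.

(** The Gaussian of parameter s^2 has k-th moment gmom2 k / s^(k+2), so the weight s^(k-1) leaves
    s^(-3), at most w0^(-2) / s on the box. *)
Lemma Rintegral_fbump_le :
  \int[nu]_z Normc.normc (fbump z) <= lam * gmom2 k / w0 ^+ 2 * (ln w1 - ln w0).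
Proof.
under eq_Rintegral do rewrite normc_fbump.
have g0 : 0 <= gmom2 k :> R by rewrite /gmom2; apply: Rintegral_ge0 => z _; exact: nrm_gauss_ge0.
rewrite (@Rintegral_mix R bump _ measurable_bump ma bump_ge0 a_gt0 k _ (PhiB k) (intPhiB k)); last 2 first.
- by apply: measurable_funX; exact: measurable_nrm.
- by move=> z; rewrite ger0_norm// exprn_ge0// nrm_ge0.
rewrite -Rintegral_box_inv -RintegralZl//; last exact: integrable_box_inv.
rewrite (_ : (fun s => bump s * _) = (fun s => lam * gmom2 k * ((s ^+ 3)^-1 * box s))); last first.
  apply/funext => s; rewrite /bump boxP; case: ifP => [/andP[ws _]|]; last by rewrite !mulr0 mul0r.
  have s0 : 0 < s by exact: lt_le_trans ws.
  rewrite Rintegral_nrm_gauss// !mulr1 /k.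
  have -> : s ^+ m.+3 = s ^+ m * s ^+ 3 by rewrite -exprD addn3.
  by field; rewrite ?expf_neq0 ?gt_eqF.
have := @ge0_le_Rintegral_dom (fun s => lam * gmom2 k * ((s ^+ 3)^-1 * box s))
  (fun s => lam * gmom2 k / w0 ^+ 2 * (s^-1 * box s)).
case => //.
- apply: measurable_funM => //; apply: measurable_funM; last exact: measurable_box.
  by apply: (measurableT_comp (@measurable_inv R)).
- move=> s; rewrite boxP; case: ifP => [/andP[ws _]|]; last by rewrite !mulr0 lexx.
  have s0 : 0 < s by exact: lt_le_trans ws.
  rewrite !mulr1 mulr_ge0 ?invr_ge0 ?exprn_ge0 ?(ltW s0) ?mulr_ge0 ?(ltW lam0)//=.
  rewrite -[leRHS]mulrA ler_wpM2l ?mulr_ge0 ?(ltW lam0)// exprS invfM mulrC ler_wpM2r ?invr_ge0 ?(ltW s0)//.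
  by rewrite lef_pV2 ?posrE ?exprn_gt0//; apply: lerXn2r; rewrite ?nnegrE ?(ltW w00) ?(ltW s0).
- by apply: integrable_scale => //; exact: integrable_box_inv.
Qed.


Lemma symbol_fourier_fbump z :
  criesz_symbol z ^+ k * fourier fbump z = (- 'i%C) ^+ k * (Gbump z)%:C%C.
Proof.
rewrite fourier_fbump criesz_symbolX exprMn /Gbump.
have [r0|r0] := eqVneq (nrm z) 0.
  have -> : toC z = 0 by apply/eqP; rewrite -normr_eq0 normC_toC r0.
  by rewrite r0 [0 ^+ k]exprS [(0 : R) ^+ k]exprS !mul0r rmorph0 !mul0r !mulr0.
have H : (toC z ^+ k)^*%C * toC z ^+ k = (nrm z ^+ k * nrm z ^+ k)%:C%C.
  by rewrite mulrC -sqr_normc normrX normC_toC -!rmorphXn -expr2.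
rewrite rmorphM/=.
have -> (c u v t e : R[i]) : c * u * (v * t * e) = v * (c * t * (u * e)) by ring.
have RC (x y : R) : x%:C%C * y%:C%C = (x * y)%:C%C by rewrite rmorphM.
by rewrite H !RC mulrA mulfK ?expf_neq0.
Qed.

Lemma measurable_Gbump : measurable_fun setT Gbump.
Proof.
apply: measurable_funM; first by apply: measurable_funX; exact: measurable_nrm.
by apply: measurable_mix; [exact: measurable_bump'|exact: ma'|exact: bump'_ge0].
Qed.

Lemma integrable_Gbump : nu.-integrable setT (EFin \o Gbump).
Proof.
apply: (@integrable_mix R bump' _ measurable_bump' ma' bump'_ge0 k _ (PhiB' k) (intPhiB' k)).
  by apply: measurable_funX; exact: measurable_nrm.
by move=> z; rewrite ger0_norm// exprn_ge0// nrm_ge0.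
Qed.

Lemma fourier_multiplier_fbump :
  fourier_multiplier (fun xi => criesz_symbol xi ^+ k) fbump =
  (fun x => (- 'i%C) ^+ k * (costr Gbump 0 x +i* costr Gbump (- (pi / 2)) x)%C).
Proof.
apply/funext => x; rewrite -(inv_fourier_real measurable_Gbump integrable_Gbump).
by congr (inv_fourier _ x); apply/funext => z; exact: symbol_fourier_fbump.
Qed.

(** Truncation keeps s^(-2) between w1^(-2) and w0^(-2), the two bounds that [mix_lipschitz]
    takes. *)
Lemma Gbump_lip : exists kap : plane -> R,
  [/\ nu.-integrable setT (EFin \o kap), forall z, 0 <= kap z &
   forall d z, nrm d <= 1 ->
    `|Gbump (z.1 + d.1, z.2 + d.2) - Gbump z| <= nrm d * kap z].
Proof.
exact: (@mix_lipschitz R bump' _ measurable_bump' ma' bump'_ge0 _ _ w12 a'_ge bump'_mass k _ a'_le).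
Qed.

Definition bump_pairing : R := \int[mu]_s
  (bump s * (gmom2 k / (s ^+ 2) ^+ k.+1 / Num.sqrt (1 + (s ^+ 2)^-1) ^+ k.+2)).

Lemma Rintegral_Gbump_gauss2 : \int[nu]_z (Gbump z * gauss2 1 z) = bump_pairing.
Proof.
have mb := measurable_bump'.
have ma1 : measurable_fun setT (fun s : R => (s ^+ 2)^-1 + 1) by exact: measurable_funD.
have a1 s : bump' s != 0 -> 1 <= (s ^+ 2)^-1 + 1.
  by move=> _; rewrite lerDr invr_ge0 sqr_ge0.
have a10 s : bump' s != 0 -> 0 < (s ^+ 2)^-1 + 1 by move=> /a1; exact: lt_le_trans.
transitivity (\int[nu]_z (nrm z ^+ k * mix bump' (fun s => (s ^+ 2)^-1 + 1) z)).
  apply: eq_Rintegral => z _; rewrite gauss2_mix//; last exact: bump'_ge0.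
  by rewrite /Gbump -mulrA [X in _ * X]mulrC.
rewrite (@Rintegral_mix R bump' _ mb ma1 bump'_ge0 a10 k _
  (mix_mass_le mb ma1 bump'_ge0 a1 bump'_mass k) (mix_mass_integrable _ ltr01 k)); last 2 first.
- by apply: measurable_funX; exact: measurable_nrm.
- by move=> z; rewrite ger0_norm// exprn_ge0// nrm_ge0.
apply: eq_Rintegral => s _; have [b0|b0] := eqVneq (bump s) 0.
  by rewrite /bump' b0 !mul0r.
have s0 : 0 < (s ^+ 2)^-1 + 1 by rewrite ltr_wpDl// invr_ge0 sqr_ge0.
by rewrite Rintegral_nrm_gauss_sqrt// /bump' [1 + _]addrC; ring.
Qed.

(** The phases are z^k and conj((- i z)^k), so moduli carry the whole pairing. Fubini over the
    weight of [fbump] leaves the integrals of [riesz_gauss_pairing] with c = s^2. *)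
Lemma Rintegral_fbump_riesz_gauss :
  \int[nu]_z (Normc.normc (fbump z) * Normc.normc (riesz_gauss m z)) = bump_pairing.
Proof.
have [K HK] := @rieszb'_mass R m m_even.
have mM : measurable_fun setT (mix (rieszb' m) (@riesza' R)).
  apply: measurable_mix; [exact: measurable_rieszb'|exact: measurable_riesza'|].
  exact: rieszb'_ge0.
have M0 z : 0 <= mix (rieszb' m) (@riesza' R) z by apply: mix_ge0; exact: rieszb'_ge0.
have MK z : mix (rieszb' m) (@riesza' R) z <= K.
  rewrite -[leLHS]mul1r -[1](expr0 (nrm z)).
  apply: (@nrm_mix_le R _ _ (@measurable_rieszb' R m) (@measurable_riesza' R)
    (rieszb'_ge0 m_even) 0 (cst K)) => w; apply: le_trans HK; apply: ge0_le_integral => //.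
  - by move=> s _; rewrite lee_fin expr0 mul1r; apply: mix_kernel_ge0; exact: rieszb'_ge0.
  - apply/measurable_EFinP; apply: measurable_funM => //; apply: measurable_funM.
      exact: measurable_rieszb'.
    apply: (measurableT_comp (@measurable_expR R)); apply: measurable_funN.
    apply: measurable_funM => //; apply: measurable_funM => //; exact: measurable_riesza'.
  - by apply/measurable_EFinP; exact: measurable_rieszb'.
  - move=> s _; rewrite lee_fin expr0 mul1r ler_piMr ?rieszb'_ge0//.
    rewrite -expR0 ler_expR oppr_le0; apply: mulr_ge0; last exact: nsq_ge0.
    by apply: mulr_ge0; [exact: pi_ge0|exact/ltW/riesza'_gt0].
have K0 : 0 < K + 1.
  by rewrite ltr_wpDl// (le_trans (M0 (0, 0)) (MK _)).
(* [Rintegral_mix] takes a test function of size at most |z|^(2k); dividing by K + 1, a positive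
   bound on the second mixture, provides one. *)
pose q z := nrm z ^+ (k * 2) * (mix (rieszb' m) (@riesza' R) z / (K + 1)).
have mq : measurable_fun setT q.
  apply: measurable_funM; last exact: measurable_funM.
  by apply: measurable_funX; exact: measurable_nrm.
have q0 z : 0 <= q z.
  by apply: mulr_ge0; [rewrite exprn_ge0// nrm_ge0|apply: divr_ge0 => //; exact: ltW].
have qle z : `|q z| <= nrm z ^+ (k * 2).
  rewrite ger0_norm// /q ler_piMr ?exprn_ge0 ?nrm_ge0//.
  by rewrite ler_pdivrMr// mul1r (le_trans (MK z))// lerDl.
transitivity (\int[nu]_z ((K + 1) * (q z * mix bump (fun s => s ^+ 2) z))).
  apply: eq_Rintegral => z _; rewrite normc_fbump normc_riesz_gauss// -/k.
  rewrite /q muln2 -addnn exprD; move: (mix _ _ z) (mix _ _ z) (nrm z ^+ k) => A B C.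
  by field; rewrite gt_eqF.
rewrite ge0_RintegralZl; last 2 first.
- by apply: measurable_funM => //; apply: measurable_mix; [exact: measurable_bump|exact: ma|exact: bump_ge0].
- by move=> z; rewrite mulr_ge0// mix_ge0//; exact: bump_ge0.
rewrite (@Rintegral_mix R bump _ measurable_bump ma bump_ge0 a_gt0 _ _ (PhiB (k * 2)) (intPhiB (k * 2)) q mq qle).
have qE s : (K + 1) * \int[nu]_z (q z * gauss2 (s ^+ 2) z) =
    \int[nu]_z (nrm z ^+ (k * 2) * mix (rieszb' m) (fun t => riesza' t + s ^+ 2) z).
  rewrite -ge0_RintegralZl; last 2 first.
  - by apply: measurable_funM => //; exact: measurable_gauss2.
  - by move=> z; rewrite mulr_ge0// gauss2_ge0.
  apply: eq_Rintegral => z _; rewrite gauss2_mix; last 3 first.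
  - exact: measurable_rieszb'.
  - exact: measurable_riesza'.
  - exact: rieszb'_ge0.
  rewrite /q; move: (mix _ _ z) (nrm z ^+ _) (gauss2 _ z) => A B C.
  by field; rewrite gt_eqF.
pose X s : R := gmom2 k / (s ^+ 2) ^+ k.+1 / Num.sqrt (1 + (s ^+ 2)^-1) ^+ k.+2.
have mX : measurable_fun setT X.
  apply: measurable_funM.
    apply: measurable_funM => //; apply: (measurableT_comp (@measurable_inv R)).
    by apply: measurable_funX; exact: measurable_funX.
  apply: (measurableT_comp (@measurable_inv R)); apply: measurable_funX.
  by apply: (measurableT_comp (@measurable_sqrt R)); exact: measurable_funD.
have X0 s : 0 <= X s.
  apply: divr_ge0; last by rewrite exprn_ge0// sqrtr_ge0.
  apply: divr_ge0; last by rewrite exprn_ge0// sqr_ge0.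
  by rewrite /gmom2; apply: Rintegral_ge0 => z _; exact: nrm_gauss_ge0.
rewrite (_ : (fun s => bump s * _) = (fun s => (K + 1)^-1 * (bump s * X s))); last first.
  apply/funext => s; have [->|b0] := eqVneq (bump s) 0; first by rewrite !mul0r mulr0.
  apply: (mulfI (lt0r_neq0 K0)); rewrite [RHS]mulVKf ?gt_eqF// mulrCA qE.
  rewrite riesz_gauss_pairing ?a_gt0// /X -[in RHS]mulrA; congr (_ * (_ * _)).
  by move: (_ ^+ k.+1) (_ ^+ k.+2) => A B; rewrite invfM.
rewrite ge0_RintegralZl; last 2 first.
- by apply: measurable_funM => //; exact: measurable_bump.
- by move=> s; rewrite mulr_ge0 ?bump_ge0.
by rewrite mulVKf ?gt_eqF.
Qed.

(** The powers of s reduce to s^(k-1) s^(-2k-2) s^(k+2) = 1 / s. The remaining factor (1 +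
    s^2)^(-(k+2)/2) is smallest at w1. *)
Lemma bump_pairing_ge :
  lam * gmom2 k * (ln w1 - ln w0) / Num.sqrt (1 + w1 ^+ 2) ^+ k.+2 <= bump_pairing.
Proof.
have g0 : 0 <= gmom2 k :> R by rewrite /gmom2; apply: Rintegral_ge0 => z _; exact: nrm_gauss_ge0.
have lg0 : 0 <= lam * gmom2 k by rewrite mulr_ge0// ltW.
have j1 (s : R) : 1 <= Num.sqrt (1 + s ^+ 2) by rewrite -[leLHS]sqrtr1 ler_wsqrtr// lerDl sqr_ge0.
have j0 (s : R) : 0 < Num.sqrt (1 + s ^+ 2) ^+ k.+2 by rewrite exprn_gt0// (lt_le_trans ltr01).
pose F s := lam * gmom2 k / Num.sqrt (1 + s ^+ 2) ^+ k.+2 * (s^-1 * box s).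
have FE s : bump s * (gmom2 k / (s ^+ 2) ^+ k.+1 / Num.sqrt (1 + (s ^+ 2)^-1) ^+ k.+2) = F s.
  rewrite /F /bump boxP; case: ifP => [/andP[ws _]|]; last by rewrite !(mulr0, mul0r).
  have s0 : 0 < s by exact: lt_le_trans ws.
  have -> : 1 + (s ^+ 2)^-1 = (1 + s ^+ 2) / s ^+ 2 by field; rewrite gt_eqF.
  rewrite sqrtrM ?addr_ge0 ?sqr_ge0// sqrtrV ?sqr_ge0// sqrtr_sqr gtr0_norm// expr_div_n.
  have -> : (s ^+ 2) ^+ k.+1 = s ^+ m * s * s ^+ k.+2.
    by rewrite -exprM -exprSr -exprD /k mul2n -addnn; congr (_ ^+ _); rewrite addSnnS.
  have := gt_eqF (j0 s); move: (Num.sqrt _ ^+ _) => X /negbT X0.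
  by field; rewrite ?X0 ?expf_neq0 ?gt_eqF.
rewrite /bump_pairing (_ : (fun s => bump s * _) = F); last by apply/funext.
have iw c : mu.-integrable setT (EFin \o (fun s => c * (s^-1 * box s))).
  by apply: integrable_scale => //; exact: integrable_box_inv.
have mF : measurable_fun setT F.
  apply: measurable_funM; last exact: measurable_box_inv.
  apply: measurable_funM => //; apply: (measurableT_comp (@measurable_inv R)).
  apply: measurable_funX; apply: (measurableT_comp (@measurable_sqrt R)).
  exact: measurable_funD.
have iF : mu.-integrable setT (EFin \o F).
  have [] // := @ge0_le_Rintegral_dom F (fun s => lam * gmom2 k * (s^-1 * box s)) mF _ (iw _).
  move=> s; apply/andP; split.
    by rewrite mulr_ge0 ?box_inv_ge0// divr_ge0// ltW.
  rewrite ler_wpM2r ?box_inv_ge0// ler_pdivrMr// ler_peMr// exprn_ege1//.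
rewrite -mulrAC -Rintegral_box_inv -RintegralZl//; last exact: integrable_box_inv.
apply: le_Rintegral => // s _; rewrite /F boxP; case: ifP => [/andP[ws sw]|]; last by rewrite !mulr0.
have s0 : 0 < s by exact: lt_le_trans ws.
rewrite mulr1 ler_wpM2r ?invr_ge0 ?(ltW s0)// ler_wpM2l// lef_pV2 ?posrE//.
apply: lerXn2r; rewrite ?nnegrE ?sqrtr_ge0//; apply: ler_wsqrtr; rewrite lerD2l.
by apply: lerXn2r; rewrite ?nnegrE ?(ltW s0) ?(ltW w10).
Qed.

End Bump.

(** * The lower bound *)

Section LowerBound.
Context {R : realType}.
Local Notation mu := (@lebesgue_measure R).
Local Notation nu := (@leb2 R).
Local Notation plane := (measurableTypeR R * measurableTypeR R)%type.
Implicit Types (f g : plane -> R[i]) (p q P : R).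

Lemma cLnorm_pairing p q f g : cmeasurable f -> cmeasurable g -> 0 < p -> 0 < q ->
  p^-1 + q^-1 = 1 ->
  (\int[nu]_z (Normc.normc (f z) * Normc.normc (g z))%:E <= cLnorm p f * cLnorm q g)%E.
Proof.
move=> mf mg p0 q0 pq.
have := hoelder nu (measurable_normc mf) (measurable_normc mg) p0 q0 pq.
rewrite Lnorm1; congr (_ <= _)%E; apply: eq_integral => z _.
by rewrite /= ger0_norm// mulr_ge0 ?normc_nneg.
Qed.

Lemma cLnorm_le1 p f : 0 < p ->
  (\int[nu]_z (Normc.normc (f z) `^ p)%:E <= 1)%E -> (cLnorm p f <= 1)%E.
Proof.
move=> p0 H; rewrite /cLnorm unlock.
under eq_integral => z _ do rewrite gee0_abs ?lee_fin ?normc_nneg// poweR_EFin.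
have I0 : (0 <= \int[nu]_z (Normc.normc (f z) `^ p)%:E)%E.
  by apply: integral_ge0 => z _; rewrite lee_fin powR_ge0.
have If : (\int[nu]_z (Normc.normc (f z) `^ p)%:E)%E \is a fin_num.
  by rewrite ge0_fin_numE// (le_lt_trans H) ?ltry.
have one : 1 `^ p^-1 = 1 :> R by rewrite powR1.
rewrite -(fineK If) in I0 H *; rewrite poweR_EFin lee_fin -[leRHS]one.
by apply: ler_powRl => //; rewrite invr_ge0 ltW.
Qed.

Lemma cLnorm_subxx p f : 0 < p -> cLnorm p (fun z => f z - f z) = 0%E.
Proof.
move=> p0; rewrite /cLnorm unlock.
under eq_integral => z _.
  rewrite subrr (_ : Normc.normc 0 = 0); last by rewrite /Normc.normc/= expr0n addr0 sqrtr0.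
  rewrite gee0_abs// poweR_EFin powR0 ?gt_eqF//; over.
by rewrite integral0 poweR_EFin powR0// invr_neq0// gt_eqF.
Qed.

(** The constant sequence [f] serves as approximation, so membership in the graph reduces to [f] and
    its image being in L^p. *)
Lemma criesz_pow_norm_ge k p f : 0 < p -> fourier_class f -> cLfun p f ->
  (cLnorm p f <= 1)%E ->
  cLfun p (fourier_multiplier (fun xi => criesz_symbol xi ^+ k) f) ->
  (cLnorm p (fourier_multiplier (fun xi => (criesz_symbol xi ^+ k)%R) f) <= @criesz_pow_norm R k p)%E.
Proof.
move=> p0 cf lf f1 lT; apply: ereal_sup_ubound.
exists f, (fourier_multiplier (fun xi => criesz_symbol xi ^+ k) f); split => //.
split => //; exists (fun=> f); split => //.
  by rewrite cLnorm_subxx//; exact: cvg_cst.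
by rewrite cLnorm_subxx//; exact: cvg_cst.
Qed.

Lemma cLnorm_gauss2_le1 p : 1 < p -> (cLnorm p (fun z => (gauss2 1 z)%:C%C : R[i]) <= 1)%E.
Proof.
move=> p1; have p0 : 0 < p by exact: lt_trans p1.
apply: cLnorm_le1 => //.
under eq_integral => z _.
  rewrite (_ : Normc.normc _ = gauss2 1 z); last first.
    by rewrite /Normc.normc/= expr0n addr0 sqrtr_sqr ger0_norm// gauss2_ge0.
  rewrite (_ : gauss2 1 z `^ p = gauss2 p z); first over.
  by rewrite /gauss2 -expRM; congr expR; ring.
by rewrite integral_gauss2// lee_fin invf_le1// ltW.
Qed.

Lemma Rintegral_le_integral (f : plane -> R) : (forall z, 0 <= f z) ->
  ((\int[nu]_z f z)%:E <= \int[nu]_z (f z)%:E)%E.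
Proof.
move=> f0; have I0 : (0 <= \int[nu]_z (f z)%:E)%E by apply: integral_ge0 => z _; rewrite lee_fin.
by rewrite /Rintegral; case: (\int[nu]_z _)%E I0 => //= *; rewrite ?leey.
Qed.

Lemma bump_pairing_le_riesz_gauss m (w0 w1 lam p q : R) :
  ~~ odd m -> 0 < w0 -> w0 < w1 -> 0 < lam -> 0 < p -> 0 < q -> p^-1 + q^-1 = 1 ->
  (cLnorm q (fbump m w0 w1 lam) <= 1)%E ->
  ((bump_pairing m w0 w1 lam)%:E <= cLnorm p (riesz_gauss m))%E.
Proof.
move=> me w00 w01 lam0 p0 q0 pq f1.
rewrite -Rintegral_fbump_riesz_gauss//.
apply: (le_trans (Rintegral_le_integral _)).
  by move=> z; rewrite mulr_ge0 ?normc_nneg.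
have pq' : q^-1 + p^-1 = 1 by rewrite addrC.
apply: (le_trans (cLnorm_pairing (cmeasurable_fbump me w00 w01 lam0)
  (cmeasurable_riesz_gauss me) q0 p0 pq')).
by rewrite -[leRHS]mul1e lee_wpmul2r// Lnorm_ge0.
Qed.

Section bumptransform.
Variables (m : nat) (w0 w1 lam : R).
Hypotheses (m_even : ~~ odd m) (w00 : 0 < w0) (w01 : w0 < w1) (lam0 : 0 < lam).
Let k := m.+1.
Let f := fbump m w0 w1 lam.
Let G := Gbump m w0 w1 lam.
Let T := fourier_multiplier (fun xi => criesz_symbol xi ^+ k) f.
Let mG : measurable_fun setT G.
Proof. exact: measurable_Gbump. Qed.
Let iG := integrable_Gbump m_even w00 w01 lam0.

Let TE x : T x = (- 'i%C) ^+ k * (costr G 0 x +i* costr G (- (pi / 2)) x)%C.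
Proof. by rewrite /T fourier_multiplier_fbump. Qed.

Lemma normc_fourier_multiplier_fbump x :
  Normc.normc (T x) = Num.sqrt (costr G 0 x ^+ 2 + costr G (- (pi / 2)) x ^+ 2).
Proof.
rewrite TE Normc.normcM (_ : Normc.normc _ = 1) ?mul1r//.
have i1 : Normc.normc (- 'i%C : R[i]) = 1.
  by rewrite /Normc.normc /= oppr0 expr0n add0r sqrrN expr1n sqrtr1.
elim: k => [|n IH]; first by rewrite expr0 /Normc.normc /= expr1n expr0n addr0 sqrtr1.
by rewrite exprS Normc.normcM IH i1 mul1r.
Qed.

Lemma cmeasurable_fourier_multiplier_fbump : cmeasurable T.
Proof.
have E (X : R[i]) (a b : R) : X * (a +i* b)%C =
    ((complex.Re X * a - complex.Im X * b) +i* (complex.Re X * b + complex.Im X * a))%C.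
  by case: X => x y; simpc; congr (_ +i* _)%C; ring.
have m0 := measurable_costr mG iG 0; have m1 := measurable_costr mG iG (- (pi / 2)).
split.
  rewrite (_ : (fun x => _) = (fun x => complex.Re ((- 'i%C : R[i]) ^+ k) * costr G 0 x -
      complex.Im ((- 'i%C : R[i]) ^+ k) * costr G (- (pi / 2)) x)).
    by apply: measurable_funB; apply: measurable_funM.
  by apply/funext => x; rewrite TE E.
rewrite (_ : (fun x => _) = (fun x => complex.Re ((- 'i%C : R[i]) ^+ k) * costr G (- (pi / 2)) x +
    complex.Im ((- 'i%C : R[i]) ^+ k) * costr G 0 x)).
  by apply: measurable_funD; apply: measurable_funM.
by apply/funext => x; rewrite TE E.
Qed.

(** [costr_decay] supplies the exponent 1/2, and [cLnorm_lty] asks for p / 2 > 1. *)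
Lemma cLfun_fourier_multiplier_fbump p : 2 < p -> cLfun p T.
Proof.
move=> p2; split; first exact: cmeasurable_fourier_multiplier_fbump.
have [kap [ik k0 lk]] := Gbump_lip m_even w00 w01 lam0.
have [C HC] := costr_decay mG iG ik k0 lk.
apply: (@cLnorm_lty R p 2^-1 (2 * C)).
- exact: cmeasurable_fourier_multiplier_fbump.
- by rewrite (lt_trans _ p2)// ltr1n.
- by rewrite mulrC ltr_pdivlMr// mul1r.
move=> x; rewrite normc_fourier_multiplier_fbump.
have H0 := HC 0 x; have H1 := HC (- (pi / 2)) x.
have CJ0 := le_trans (normr_ge0 _) H0.
rewrite -mulrA; move: H0 H1 CJ0; move: (C * _) => c H0 H1 CJ0.
rewrite -(@ler_pXn2r _ 2) ?nnegrE ?sqrtr_ge0 ?mulr_ge0//.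
rewrite sqr_sqrtr ?addr_ge0 ?sqr_ge0//.
move: H0 H1 CJ0; rewrite -[costr G 0 x ^+ 2]real_normK ?num_real// -[costr G _ x ^+ 2]real_normK ?num_real//.
move: `|_| `|_| (normr_ge0 (costr G 0 x)) (normr_ge0 (costr G (- (pi / 2)) x)) => u v.
by nra.
Qed.

Lemma bump_pairing_le_fbump p q : 1 < q -> 0 < p -> p^-1 + q^-1 = 1 ->
  ((bump_pairing m w0 w1 lam)%:E <= cLnorm p T)%E.
Proof.
move=> q1 p0 pq; have q0 : 0 < q by exact: lt_trans q1.
rewrite -Rintegral_Gbump_gauss2// -Rintegral_gauss2_costr//.
have mgc : measurable_fun setT (fun x => gauss2 1 x * costr G 0 x).
  by apply: measurable_funM; [exact: measurable_gauss2|exact: measurable_costr].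
have finle (x : \bar R) : ((fine x)%:E <= `|x|)%E by case: x => [r| |] /=; rewrite ?leey// lee_fin ler_norm.
apply: (le_trans (finle _)).
apply: (le_trans (le_abse_integral _ _ _)) => //; first exact/measurable_EFinP.
(* The modulus of [T] dominates its cosine component, the only one paired with the Gaussian. *)
apply: (@le_trans _ _ (\int[nu]_z (Normc.normc (T z) * Normc.normc ((gauss2 1 z)%:C%C : R[i]))%:E)%E).
  apply: ge0_le_integral => //.
  - by apply: measurableT_comp => //; exact/measurable_EFinP.
  - apply/measurable_EFinP; apply: measurable_funM; apply: measurable_normc.
      exact: cmeasurable_fourier_multiplier_fbump.
    exact: cmeasurable_gauss2.
  move=> x _; rewrite -[leLHS]/(`|gauss2 1 x * costr G 0 x|%:E) lee_fin normrM mulrC.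
  have -> : Normc.normc ((gauss2 1 x)%:C%C : R[i]) = `|gauss2 1 x|.
    by rewrite /Normc.normc/= expr0n addr0 sqrtr_sqr.
  rewrite ler_wpM2r// normc_fourier_multiplier_fbump -sqrtr_sqr ler_wsqrtr//.
  by rewrite lerDl sqr_ge0.
apply: (le_trans (cLnorm_pairing cmeasurable_fourier_multiplier_fbump cmeasurable_gauss2 p0 q0 pq)).
by rewrite -[leRHS]mule1 lee_wpmul2l ?Lnorm_ge0// cLnorm_gauss2_le1.
Qed.

End bumptransform.

(** w1 = k^(-1/2) keeps (1 + w1^2)^((k+2)/2) below exp 3, and w0 = exp(-P) w1 makes ln w1 - ln w0
    equal to P. With X the ratio of the two moments, the supremum of f is at most rho and its L^1
    norm at most rho X k exp(2P) P, so the integral of |f|^P is at most rho^P X k exp(2P) P. *)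
Lemma bump_exists m P : ~~ odd m -> 1 < P -> exists w0 w1 lam : R,
  [/\ 0 < w0, w0 < w1, 0 < lam, (cLnorm P (fbump m w0 w1 lam) <= 1)%E &
    expR (- 6) / (4 * pi) * m.+1%:R `^ (1 - 2 / P) * (P - 1) <= bump_pairing m w0 w1 lam].
Proof.
move=> me P1; have P0 : 0 < P by exact: lt_trans P1.
pose k : R := m.+1%:R; have k1 : 1 <= k by rewrite ler1n.
have k0 : 0 < k by exact: lt_le_trans k1.
pose D : R := gmom m; pose C : R := gmom2 m.+1.
have D0 : 0 < D by exact: gmom_gt0.
have p0 : 0 < pi :> R := pi_gt0 R.
have CD : k / (4 * pi) * D <= C by exact: gmom2_ge_gmom.
have k4 : 0 < k / (4 * pi) by rewrite divr_gt0// mulr_gt0.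
have C0 : 0 < C by apply: lt_le_trans CD; rewrite mulr_gt0.
pose w1 : R := (Num.sqrt k)^-1; pose w0 : R := expR (- P) * w1.
pose X := C / D; have X0 : 0 < X by rewrite divr_gt0.
(* (X k)^(-1/P) cancels the factor X k of that bound, and exp(-3) turns exp(2P) P into P exp(-P) <=
   1. *)
pose rho := (X * k) `^ (- P^-1) * expR (- 3).
pose lam := rho / D.
have sk0 : 0 < Num.sqrt k by rewrite sqrtr_gt0.
have w10 : 0 < w1 by rewrite invr_gt0.
have w00 : 0 < w0 by rewrite mulr_gt0 ?expR_gt0.
have Xk0 : 0 < X * k by rewrite mulr_gt0.
have rho0 : 0 < rho by rewrite mulr_gt0 ?powR_gt0 ?expR_gt0.
have lam0 : 0 < lam by rewrite divr_gt0.
have w01 : w0 < w1 by rewrite /w0 gtr_pMl// -[ltRHS]expR0 ltr_expR oppr_lt0.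
have w12 : w1 ^+ 2 = k^-1 by rewrite /w1 exprVn sqr_sqrtr// ltW.
have w02 : w0 ^+ 2 = expR (- (2 * P)) / k.
  by rewrite /w0 exprMn w12 expr2 -expRD; congr (expR _ / _); ring.
have L : ln w1 - ln w0 = P.
  by rewrite /w0 lnM ?posrE ?expR_gt0// expRK; ring.
have split1 (x : R) : 0 < x -> x `^ P = x `^ (P - 1) * x.
  move=> x0; rewrite -{1}(subrK 1 P) [LHS]powRD; last by apply/implyP => _; rewrite gt_eqF.
  by rewrite powRr1// ltW.
exists w0, w1, lam; split => //.
  apply: cLnorm_le1 => //.
  have nD z : Normc.normc (fbump m w0 w1 lam z) <= rho.
    by apply: le_trans (normc_fbump_le w0 w1 me lam0 z) _; rewrite /lam divfK ?gt_eqF.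
  have mf := measurable_normc (cmeasurable_fbump me w00 w01 lam0).
  apply: (@le_trans _ _ (\int[nu]_z ((rho `^ (P - 1))%:E * (Normc.normc (fbump m w0 w1 lam z))%:E))%E).
    apply: ge0_le_integral => //.
    - by move=> z _; rewrite lee_fin powR_ge0.
    - by apply/measurable_EFinP; apply: (measurableT_comp (@measurable_powR R P)).
    - by apply: measurable_funeM; exact/measurable_EFinP.
    move=> z _; rewrite -EFinM lee_fin.
    have n0 := normc_nneg (fbump m w0 w1 lam z).
    have [->|nz] := eqVneq (Normc.normc (fbump m w0 w1 lam z)) 0.
      by rewrite powR0 ?gt_eqF// mulr0.
    rewrite split1 ?lt_def ?nz// ler_wpM2r//; apply: ler_powRl => //; by rewrite subr_ge0 ltW.
  rewrite ge0_integralZl_EFin ?powR_ge0//; last 2 first.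
  - by move=> z _; rewrite lee_fin normc_nneg.
  - exact/measurable_EFinP.
  rewrite (ge0_integral_fineK _ (integrable_normc_fbump me w00 w01 lam0)); last first.
    by move=> z; exact: normc_nneg.
  rewrite -EFinM lee_fin.
  apply: (@le_trans _ _ (rho `^ (P - 1) * (lam * C / w0 ^+ 2 * P))).
    rewrite ler_wpM2l ?powR_ge0//; have := Rintegral_fbump_le me w00 w01 lam0.
    by rewrite L.
  have -> : lam * C / w0 ^+ 2 * P = rho * (X * k) * (expR (2 * P) * P).
    rewrite w02 expRN /lam /X; have := expR_gt0 (2 * P); move: (expR _) => e e0.
    by field; rewrite !gt_eqF.
  have rP : rho `^ P = (X * k)^-1 * expR (- (3 * P)).
    rewrite /rho powRM ?powR_ge0 ?expR_ge0// -powRrM mulNr mulVf ?gt_eqF//.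
    by rewrite powR_inv1 ?ltW// -expRM mulNr.
  have rD : rho `^ P = rho `^ (P - 1) * rho.
    exact: split1.
  rewrite -mulrA mulrA -rD rP.
  have -> : (X * k)^-1 * expR (- (3 * P)) * (X * k * (expR (2 * P) * P)) = P * expR (- P).
    rewrite (_ : expR (- P) = expR (- (3 * P)) * expR (2 * P)); last first.
      by rewrite -expRD; congr expR; ring.
    move: (expR _) (expR _) => e1 e2; move: (X * k) Xk0 => Y Y0.
    by field; rewrite gt_eqF.
  rewrite expRN ler_pdivrMr ?expR_gt0// mul1r.
  by apply: le_trans (expR_ge1Dx _); rewrite lerDr.
apply: le_trans (bump_pairing_ge m w00 w01 lam0); rewrite L w12 -/C.
have J0 : 0 < Num.sqrt (1 + k^-1) ^+ m.+3.
  by rewrite exprn_gt0// sqrtr_gt0 addr_gt0 ?invr_gt0.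
(* sqrt(1 + 1/k) <= 1 + 1/k <= exp(1/k), and (k + 2) / k <= 3. *)
have J3 : Num.sqrt (1 + k^-1) ^+ m.+3 <= expR 3.
  have ek : 1 + k^-1 <= expR k^-1 by exact: expR_ge1Dx.
  have sk : Num.sqrt (1 + k^-1) <= expR k^-1.
    apply: le_trans ek; rewrite -(@ler_pXn2r _ 2) ?nnegrE ?sqrtr_ge0 ?addr_ge0 ?invr_ge0 ?(ltW k0)//.
    rewrite sqr_sqrtr ?addr_ge0 ?invr_ge0 ?(ltW k0)// ler_eXnr// lerDl invr_ge0 ltW//.
  apply: (@le_trans _ _ (expR k^-1 ^+ m.+3)).
    by apply: lerXn2r => //; rewrite nnegrE ?sqrtr_ge0 ?expR_ge0.
  rewrite -expRM_natl ler_expR (_ : m.+3%:R = k + 2); last by rewrite /k -natrD addn2.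
  by rewrite ler_pdivrMr//; lra.
have lC : lam * C = X * (X * k) `^ (- P^-1) * expR (- 3) by rewrite /lam /rho /X; field; rewrite gt_eqF.
apply: (@le_trans _ _ (lam * C * P * expR (- 3))); last first.
  have lCP : 0 <= lam * C * P by exact: mulr_ge0 (mulr_ge0 (ltW lam0) (ltW C0)) (ltW P0).
  by rewrite expRN ler_wpM2l// lef_pV2 ?posrE ?expR_gt0.
rewrite lC.
have Xk : k / (4 * pi) <= X by rewrite /X ler_pdivlMr.
(* X >= k / (4 pi) enters with the exponent 1 - 1/P >= 0, and (4 pi)^(1 - 1/P) <= 4 pi. *)
have main : k `^ (1 - 2 / P) / (4 * pi) <= X * (X * k) `^ (- P^-1).
  have XE : X * (X * k) `^ (- P^-1) = X `^ (1 - P^-1) * k `^ (- P^-1).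
    rewrite powRM ?(ltW X0) ?(ltW k0)// mulrA; congr (_ * _).
    by rewrite -[X in X * _]powRr1 ?(ltW X0)// -powRD//; apply/implyP => _; rewrite gt_eqF.
  have iP : 0 <= 1 - P^-1 by rewrite subr_ge0 invf_le1// ltW.
  rewrite XE; apply: (@le_trans _ _ ((k / (4 * pi)) `^ (1 - P^-1) * k `^ (- P^-1))); last first.
    by rewrite ler_wpM2r ?powR_ge0//; apply: ler_powRl => //; exact: ltW.
  have pi4 : 1 <= 4 * pi :> R by have := pi_ge2 R; lra.
  rewrite powRM ?(ltW k0) ?invr_ge0 ?mulr_ge0 ?(ltW p0)// mulrAC -powRD; last first.
    by apply/implyP => _; rewrite gt_eqF.
  have -> : 1 - P^-1 + - P^-1 = 1 - 2 / P by field; rewrite gt_eqF.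
  rewrite ler_wpM2l ?powR_ge0//.
  have v0 : 0 < (4 * pi)^-1 :> R by rewrite invr_gt0 mulr_gt0.
  have pi40 : 0 < 4 * pi :> R by exact: lt_le_trans pi4.
  have -> : (4 * pi)^-1 `^ (1 - P^-1) = ((4 * pi) `^ (1 - P^-1))^-1 :> R.
    by rewrite -[X in X `^ _]powR_inv1 ?(ltW pi40)// -powRrM mulN1r powRN.
  rewrite lef_pV2 ?posrE ?powR_gt0//; apply: ler1_powR => //.
  by rewrite gerBl invr_ge0 ltW.
have -> : expR (- 6) = expR (- 3) * expR (- 3) :> R by rewrite -expRD; congr expR; ring.
have e0 := expR_gt0 (- 3 : R); move: (expR _) e0 => e e0.
have -> : e * e / (4 * pi) * m.+1%:R `^ (1 - 2 / P) * (P - 1) =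
  (e * e) * (k `^ (1 - 2 / P) / (4 * pi) * (P - 1)) by rewrite -/k; ring.
rewrite [leRHS](_ : _ = (e * e) * (X * (X * k) `^ (- P^-1) * P)); last by ring.
rewrite ler_wpM2l ?mulr_ge0 ?(ltW e0)//; apply: ler_pM => //.
- by rewrite divr_ge0 ?powR_ge0// mulr_ge0// ltW.
- by rewrite subr_ge0 ltW.
- by rewrite gerBl.
Qed.

End LowerBound.

Theorem theorem1p4 (R : realType) :
  exists c : R, 0 < c /\
    forall (k : nat) (p : R), odd k -> 1 < p ->
      ((c * k%:R `^ (1 - 2 / pstar p) * (pstar p - 1))%:E
         <= criesz_pow_norm k p)%E.
Proof.
exists (expR (- 6) / (4 * pi)); split.
  by rewrite divr_gt0 ?expR_gt0// mulr_gt0 ?pi_gt0.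
case=> [//|m] p /= m_even p1; have p0 : 0 < p by exact: lt_trans p1.
have pm0 : 0 < p - 1 by rewrite subr_gt0.
have [p2|p2] := ltP 2 p.
  have -> : pstar p = p.
    by apply/max_idPl; rewrite ler_pdivrMr//; nra.
  have [w0 [w1 [lam [w00 w01 lam0 f1 H]]]] := bump_exists m_even p1.
  have lT := cLfun_fourier_multiplier_fbump m_even w00 w01 lam0 p2.
  apply: le_trans (criesz_pow_norm_ge p0 (fourier_class_fbump m_even w00 w01 lam0) _ f1 lT).
    apply: (@le_trans _ _ (bump_pairing m w0 w1 lam)%:E); first by rewrite lee_fin.
    apply: (@bump_pairing_le_fbump R m w0 w1 lam m_even w00 w01 lam0 p (p / (p - 1))) => //.
      by rewrite ltr_pdivlMr//; lra.
    by field; rewrite !gt_eqF.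
  split; first exact: cmeasurable_fbump.
  exact: le_lt_trans f1 (ltry _).
(* Here, p = 2 included, P is the conjugate exponent: [fbump] is normalised in L^P and the operator
   acts on the Gaussian. *)
have q1 : 1 < p / (p - 1) by rewrite ltr_pdivlMr//; lra.
have -> : pstar p = p / (p - 1).
  by apply/max_idPr; rewrite ler_pdivlMr//; nra.
have [w0 [w1 [lam [w00 w01 lam0 f1 H]]]] := bump_exists m_even q1.
have h1 := cLnorm_gauss2_le1 p1.
have lh : cLfun p (fun z => (gauss2 1 z)%:C%C : R[i]).
  by split; [exact: cmeasurable_gauss2|exact: le_lt_trans h1 (ltry _)].
have T := @criesz_pow_norm_ge R m.+1 p _ p0 fourier_class_gauss2 lh h1.
rewrite fourier_multiplier_gauss2// in T.
apply: le_trans (T _).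
  apply: (@le_trans _ _ (bump_pairing m w0 w1 lam)%:E); first by rewrite lee_fin.
  apply: (@bump_pairing_le_riesz_gauss R m w0 w1 lam p (p / (p - 1))) => //.
  - exact: lt_trans q1.
  - by field; rewrite !gt_eqF.
split; first exact: cmeasurable_riesz_gauss.
have ip1 : p^-1 < 1 by rewrite invf_lt1.
have ip0 : 0 < p^-1 by rewrite invr_gt0.
(* The midpoint N of 1/p and 1 satisfies both N < 1 and N p > 1. *)
have [C HC] := @riesz_gauss_decay R m m_even ((1 + p^-1) / 2) (ltac:(lra)).
apply: (cLnorm_lty _ p1 _ HC); first exact: cmeasurable_riesz_gauss.
by rewrite (_ : (1 + p^-1) / 2 * p = (p + 1) / 2); [lra|field; rewrite gt_eqF].
Qed.
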